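(* Let $\mathcal{X}$ be a projective, geometrically irreducible, non-singular algebraic curve defined over $\mathbb{F}_q$, let $P$ be an $\mathbb{F}_q$-rational point of $\mathcal{X}$, let $R=\bigcup_{m=0}^\infty\mathcal{L}(mP)$, $\rho=-\nu_P$, and let $\Gamma=\rho(R\setminus\{0\})\subseteq\mathbb{N}_0$ be the Weierstrass semigroup of $P$. Let $P_1,\dots,P_h$ ($h\ge1$) be points of $\mathcal{X}$ different from $P$, of degrees $r_1,\dots,r_h$, with pairwise distinct closed points. Let $r=\mathrm{lcm}(r_1,\dots,r_h)$, let $B=\{f_\eta\mid\eta\in\Gamma\}$ with $\rho(f_\eta)=\eta$ be a basis of $R$ over $\mathbb{F}_q$, let $R'=\mathrm{Span}_{\mathbb{F}_{q^r}}B$, and let $\phi:R'\to\mathbb{F}_{q^r}^h$, $\phi(f)=(f(P_1),\dots,f(P_h))$. Let $C_i=\mathbb{F}_q^{r_i}$ and let $\pi_i:\mathbb{F}_{q^{r_i}}\to C_i$ be $\mathbb{F}_q$-linear isomorphisms, $i=1,\dots,h$; put $\mathcal{R}=\{r_1,\dots,r_h\}$, $\mathcal{C}=\{C_1,\dots,C_h\}$ and $\Delta=\Delta(R',\rho,\phi)$. Then for every $\lambda\in\Gamma$ the minimum distance of $E(\lambda,\mathcal{R},\mathcal{C})$ is at least $$\min\{\sigma_\Delta(\eta)\mid\eta\in\Delta,\ \eta\le\lambda\},$$ and $$\min\{\sigma_\Delta(\eta)\mid\eta\in\Delta,\ \eta\le\lambda\}\ \ge\ h-\lambda.$$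
   Context: $\mathcal{L}(mP)$ is the Riemann–Roch space over $\mathbb{F}_q$ of the divisor $mP$, and $\nu_P$ is the discrete valuation at $P$. Points of $\mathcal{X}$ are points over the algebraic closure $\overline{\mathbb{F}}_q$; the degree of a point $Q$ is the least positive integer $l$ such that $Q$ is $\mathbb{F}_{q^l}$-rational, and its closed point is its orbit $\{Q,\Phi(Q),\dots,\Phi^{l-1}(Q)\}$ under the Frobenius map $\Phi$, which raises homogeneous coordinates to the $q$-th power. $R'=\mathrm{Span}_{\mathbb{F}_{q^r}}B$ is the extension of scalars $R\otimes_{\mathbb{F}_q}\mathbb{F}_{q^r}$ (inside the function field of $\mathcal{X}$ over $\mathbb{F}_{q^r}$), and $\rho=-\nu_P$ extends to it. The set $\Delta(R',\rho,\phi)=\{\alpha(1),\dots,\alpha(h)\}\subseteq\Gamma$: $\alpha(1)=0$, and for $i=2,\dots,h$, $\alpha(i)$ is recursively the smallest element of $\Gamma$ that is greater than $\alpha(1),\dots,\alpha(i-1)$ and satisfies $\phi(f_{\alpha(i)})\notin\mathrm{Span}_{\mathbb{F}_{q^r}}\{\phi(f_\mu)\mid\mu\in\Gamma,\ \mu<\alpha(i)\}$. For $\eta\in\Delta$, $\sigma_\Delta(\eta)=|\{\mu\in\Delta\mid\mu-\eta\in\Gamma\}|$. With $n=\sum_{i=1}^h r_i$, the code is $$E(\lambda,\mathcal{R},\mathcal{C})=\mathrm{Span}_{\mathbb{F}_q}\{(\pi_1(f_\eta(P_1)),\dots,\pi_h(f_\eta(P_h)))\mid\eta\in\Gamma,\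 \eta\le\lambda\}\subseteq\mathbb{F}_q^n,$$ and its minimum distance is the minimum Hamming weight of a nonzero codeword. *)

(* Defs.v *)
From HB Require Import structures.
From mathcomp Require Import all_boot all_order all_algebra.
From mathcomp Require Import ring_quotient fraction.
From mathcomp Require Import boolp classical_sets.
From mathcomp Require Import mpoly.

Set Implicit Arguments.
Unset Strict Implicit.
Unset Printing Implicit Defensive.

Import Order.TTheory GRing.Theory.
Local Open Scope classical_set_scope.
Local Open Scope quotient_scope.
Local Open Scope ring_scope.

(* The smallest element of [A]; 0 if [A] is empty. *)
Definition least (A : set nat) : nat :=
  xget 0%N [set m | A m /\ forall k, A k -> (m <= k)%N].

(* Linear algebra over a set [S] of scalars (such as a subfield of a larger
   field), acting on [V] by [scale]; the vectors are the [v k], [k] in [I]. *)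
Section Span.
Variables (A : nzRingType) (V : zmodType) (scale : A -> V -> V) (S : set A).

Definition span (I : set nat) (v : nat -> V) : set V :=
  [set x | exists m : nat, exists c : nat -> A, (forall k, S (c k)) /\
     x = \sum_(k < m | (k : nat) \in I) scale (c k) (v k)].

Definition linearly_independent (I : set nat) (v : nat -> V) : Prop :=
  forall (m : nat) (c : nat -> A), (forall k, S (c k)) ->
    \sum_(k < m | (k : nat) \in I) scale (c k) (v k) = 0 ->
    forall k, (k < m)%N -> I k -> c k = 0.

Definition is_basis (I : set nat) (v : nat -> V) (W : set V) : Prop :=
  linearly_independent I v /\ span I v = W.
End Span.

(* [K] is meant to be an algebraic closure of [F] via [iota].  A point of
   P^n(K) is represented by a nonzero vector of homogeneous coordinates; two
   nonzero vectors are the same point iff they have the same row space. *)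
Section ProjectiveSpace.
Variables (F : finFieldType) (K : closedFieldType) (n : nat).
Implicit Types Q : 'rV[K]_n.+1.

Definition same_point Q Q' : bool := (Q == Q')%MS.

Definition subfield (l : nat) : set K := [set x | x ^+ (#|F| ^ l) = x].

Definition rational (l : nat) Q : Prop :=
  exists2 Q', same_point Q Q' & forall i, subfield l (Q' 0 i).

Definition has_degree (l : nat) Q : Prop :=
  [/\ (0 < l)%N, rational l Q &
      forall l', (0 < l')%N -> rational l' Q -> (l <= l')%N].

Definition frobenius Q : 'rV[K]_n.+1 := map_mx (fun x => x ^+ #|F|) Q.

Definition closed_point (l : nat) Q : set 'rV[K]_n.+1 :=
  [set Q' | exists2 k, (k < l)%N & same_point Q' (iter k frobenius Q)].

Definition zero_locus (iota : {rmorphism F -> K})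
    (eqns : seq {mpoly F[n.+1]}) : set 'rV[K]_n.+1 :=
  [set Q : 'rV[K]_n.+1 | Q != 0 /\
           forall e, e \in eqns -> (map_mpoly iota e).@[Q 0] = 0].

Definition vanishing_ideal (Y : set 'rV[K]_n.+1) : {pred {mpoly K[n.+1]}} :=
  fun p => `[< forall Q, Y Q -> p.@[Q 0] = 0 >].
End ProjectiveSpace.
Arguments subfield F K l : clear implicits.
Arguments rational F [K n] l Q.
Arguments has_degree F [K n] l Q.
Arguments frobenius F [K n] Q.
Arguments closed_point F [K n] l Q.

(* Closed subvarieties of P^n defined over [F] (the vanishing ideal over [K]
   is generated by homogeneous forms over [F]) and irreducible over [K]. *)
Record variety (F : finFieldType) (K : closedFieldType)
    (iota : {rmorphism F -> K}) (n : nat) := Variety {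
  eqns : seq {mpoly F[n.+1]};
  eqns_homog : forall e, e \in eqns -> exists d, e \is d.-homog;
  eqns_generate : forall p : {mpoly K[n.+1]},
    p \in vanishing_ideal (zero_locus iota eqns) ->
    exists a : 'I_(size eqns) -> {mpoly K[n.+1]},
      p = \sum_i a i * map_mpoly iota eqns`_i;
  nonempty : exists Q, zero_locus iota eqns Q;
  irreducible :
    prime_idealr_closed (vanishing_ideal (zero_locus iota eqns))
}.
Arguments eqns_homog {F K iota n} v.
Arguments eqns_generate {F K iota n} v.
Arguments irreducible {F K iota n} v.

Section FunctionField.
Variables (F : finFieldType) (K : closedFieldType).
Variables (iota : {rmorphism F -> K}) (n : nat) (X : variety iota n).

Definition point_of : set 'rV[K]_n.+1 := zero_locus iota (eqns X).

Definition ideal_of : {pred {mpoly K[n.+1]}} := vanishing_ideal point_of.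

Lemma ideal_of_closed : idealr_closed ideal_of.
Proof.
split.
- by apply/asboolP => Q XQ; rewrite meval0.
- have [Q XQ] := nonempty X; apply/asboolP => /(_ Q XQ)/eqP.
  by rewrite meval1 oner_eq0.
- move=> a p q /asboolP Ip /asboolP Iq; apply/asboolP => Q XQ.
  by rewrite mevalD mevalM Ip // Iq // mulr0 addr0.
Qed.

HB.instance Definition _ :=
  isIdealr.Build {mpoly K[n.+1]} ideal_of ideal_of_closed.
HB.instance Definition _ :=
  isPrimeIdealrClosed.Build {mpoly K[n.+1]} ideal_of (irreducible X).

Definition coord_ring := {ideal_quot ideal_of}.

HB.instance Definition _ := GRing.ComNzRing.on coord_ring.

Definition coord_unit : {pred coord_ring} :=
  fun x => `[< exists y, y * x = 1 >].
Definition coord_inv (x : coord_ring) : coord_ring :=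
  xget x [set y | y * x = 1].

Lemma coord_mulVr : {in coord_unit, left_inverse 1 coord_inv *%R}.
Proof.
move=> x /asboolP xU; rewrite /coord_inv.
by case: xgetP => // xV; case: xU => y /xV.
Qed.

Lemma coord_unitPl (x y : coord_ring) : y * x = 1 -> x \in coord_unit.
Proof. by move=> yx; apply/asboolP; exists y. Qed.

Lemma coord_invr_out : {in [predC coord_unit], coord_inv =1 id}.
Proof.
move=> x /asboolP xU; rewrite /coord_inv; case: xgetP => // y _ yx.
by case: xU; exists y.
Qed.

HB.instance Definition _ := GRing.ComNzRing_hasMulInverse.Build coord_ring
  coord_mulVr coord_unitPl coord_invr_out.
HB.instance Definition _ := GRing.ComUnitRing_isIntegral.Build coord_ring
  (@Quotient.rquot_IdomainAxiom _ ideal_of).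

(* The fields of rational functions live in the fraction field of the
   homogeneous coordinate ring, as the fractions of degree 0. *)
Definition coord_frac := {fraction coord_ring}.

Definition residue (p : {mpoly K[n.+1]}) : coord_ring := \pi_coord_ring p.

Definition form_ratio (p q : {mpoly K[n.+1]}) : coord_frac :=
  tofrac (residue p) / tofrac (residue q).

Definition constant (c : K) : coord_frac := form_ratio c%:MP 1.

Definition scale_by (c : K) (f : coord_frac) : coord_frac := constant c * f.

Definition function_field_closure : set coord_frac :=
  [set f | exists d p q, [/\ p \is d.-homog, q \is d.-homog,
                             q \notin ideal_of & f = form_ratio p q]].

Definition function_field : set coord_frac :=
  [set f | exists d (p q : {mpoly F[n.+1]}),
     [/\ p \is d.-homog, q \is d.-homog, map_mpoly iota q \notin ideal_of &
         f = form_ratio (map_mpoly iota p) (map_mpoly iota q)]].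

Definition algebraically_independent d (t : 'I_d -> coord_frac) : Prop :=
  forall p : {mpoly K[d]}, mmap constant t p = 0 -> p = 0.

(* The dimension is the transcendence degree of the function field over [K]. *)
Definition has_dimension (d : nat) : Prop :=
  (exists2 t : 'I_d -> coord_frac,
     forall i, function_field_closure (t i) & algebraically_independent t) /\
  (forall t : 'I_d.+1 -> coord_frac,
     (forall i, function_field_closure (t i)) -> ~ algebraically_independent t).

Definition jacobian (Q : 'rV[K]_n.+1) : 'M[K]_(size (eqns X), n.+1) :=
  \matrix_(j < size (eqns X), i < n.+1)
    ((map_mpoly iota (eqns X)`_j)^`M(i)).@[Q 0].

(* The Jacobian matrix of homogeneous equations in all n + 1 coordinates has
   the same rank at [Q] as the one in an affine chart, by Euler's identity. *)
Definition nonsingular : Prop :=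
  forall d Q, has_dimension d -> point_of Q -> (\rank (jacobian Q) + d = n)%N.

Section LocalRing.
Variable Q : 'rV[K]_n.+1.

Definition has_value (f : coord_frac) (v : K) : Prop :=
  exists d p q, [/\ p \is d.-homog, q \is d.-homog, q.@[Q 0] != 0,
                    f = form_ratio p q & v = p.@[Q 0] / q.@[Q 0]].

(* 0 where [f] is not regular. *)
Definition eval_at (f : coord_frac) : K := xget 0 (has_value f).

Definition local_ring : set coord_frac := [set f | exists v, has_value f v].

Definition maximal_ideal : set coord_frac := [set f | has_value f 0].

Definition uniformizer (t : coord_frac) : Prop :=
  maximal_ideal t /\
  forall f, maximal_ideal f -> exists2 g, local_ring g & f = g * t.

Definition has_valuation (f : coord_frac) (k : int) : Prop :=
  exists u t, [/\ u != 0, local_ring u, local_ring u^-1, uniformizer t &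
                  f = u * t ^ k].

(* Only meaningful for [f] nonzero. *)
Definition valuation (f : coord_frac) : int := xget 0 (has_valuation f).
End LocalRing.

(* A divisor is given by its multiplicities at the points. *)
Definition riemann_roch (D : 'rV[K]_n.+1 -> int) : set coord_frac :=
  [set f | function_field f /\
     (f != 0 -> forall Q, point_of Q -> 0 <= valuation Q f + D Q)].

Definition multiple_of_point (m : nat) (P : 'rV[K]_n.+1) : 'rV[K]_n.+1 -> int :=
  fun Q => if same_point Q P then m%:Z else 0.

Variable P : 'rV[K]_n.+1.

Definition pole_ring : set coord_frac :=
  [set f | exists m : nat, riemann_roch (multiple_of_point m P) f].

Definition rho (f : coord_frac) : int := - valuation P f.

Definition weierstrass_semigroup : set nat :=
  [set eta | exists f, [/\ pole_ring f, f != 0 & rho f = eta%:Z]].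
End FunctionField.
Arguments pole_ring {F K iota n} X P.

Definition evaluation (F : finFieldType) (K : closedFieldType)
    (iota : {rmorphism F -> K}) (n : nat) (X : variety iota n) (h : nat)
    (Pt : 'I_h -> 'rV[K]_n.+1) (f : coord_frac X) : 'rV[K]_h :=
  \row_i eval_at (Pt i) f.

Section Delta.
Variables (K : closedFieldType) (h : nat).
Variables (Gamma : set nat) (S : set K) (phi_f : nat -> 'rV[K]_h).

(* [:: alpha(1); ...; alpha(i+1)] *)
Fixpoint delta_seq (i : nat) : seq nat :=
  if i is j.+1 then
    let s := delta_seq j in
    rcons s (least [set a | [/\ Gamma a, forall b, b \in s -> (b < a)%N &
      ~ span *:%R S [set mu | Gamma mu /\ (mu < a)%N] phi_f (phi_f a)]])
  else [:: 0%N].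

Definition Delta : seq nat := delta_seq h.-1.

Definition sigma_Delta (eta : nat) : nat :=
  size (undup [seq mu <- Delta | (eta <= mu)%N && ((mu - eta)%N \in Gamma)]).

Definition min_sigma_Delta (lambda : nat) : nat :=
  least [set s | exists eta,
    [/\ eta \in Delta, (eta <= lambda)%N & s = sigma_Delta eta]].
End Delta.

Section Code.
Variables (F : finFieldType) (K : closedFieldType) (iota : {rmorphism F -> K}).

(* [pi], restricted to the subfield of order q^l of [K], is an isomorphism of
   vector spaces over [F]; its values elsewhere are irrelevant. *)
Definition linear_iso (l : nat) (pi : K -> 'rV[F]_l) : Prop :=
  [/\ forall a x y, subfield F K l x -> subfield F K l y ->
        pi (iota a * x + y) = a *: pi x + pi y,
      forall x y, subfield F K l x -> subfield F K l y -> pi x = pi y -> x = y &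
      forall w, exists2 x, subfield F K l x & pi x = w].

Definition code (n : nat) (X : variety iota n) (Gamma : set nat) (h : nat)
    (Pt : 'I_h -> 'rV[K]_n.+1) (r : 'I_h -> nat)
    (pi : forall i, K -> 'rV[F]_(r i)) (f : nat -> coord_frac X)
    (lambda : nat) : set 'rV[F]_(\sum_i r i) :=
  span *:%R setT [set eta | Gamma eta /\ (eta <= lambda)%N]
    (fun eta => \mxrow_i pi i (eval_at (Pt i) (f eta))).

Definition hamming_weight (m : nat) (c : 'rV[F]_m) : nat :=
  #|[set i | c 0 i != 0]%SET|.

Definition minimum_distance (m : nat) (C : set 'rV[F]_m) : nat :=
  least [set w | exists c, [/\ C c, c != 0 & w = hamming_weight c]].
End Code.

(* Main.v *)
From HB Require Import structures.
Require Import Defs.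
From mathcomp Require Import all_boot all_order all_algebra all_solvable all_field.
From mathcomp Require Import boolp classical_sets.
From mathcomp Require Import mpoly.
From mathcomp Require Import zify.

Set Implicit Arguments.
Unset Strict Implicit.
Unset Printing Implicit Defensive.

Import Order.TTheory GRing.Theory Num.Theory.
Local Open Scope ring_scope.

(* The code.  Let [v] be the evaluation vector of a combination of the f_eta,
   eta <= lambda, with leading term at a jump [eta] in Delta once it is reduced
   modulo the kernel of [phi].  For [mu] in Delta with mu - eta in Gamma, the
   componentwise products of [v] with phi(f_(mu - eta)) have leading term
   phi(f_mu); they are sigma(eta) independent vectors supported on the support
   of [v].  Since [phi] is onto, Delta has [h] elements, and those for which
   mu - eta is not in Gamma are pairwise incongruent modulo eta, which gives
   the bound h - lambda.

   The geometry.  Surjectivity of [phi] needs functions with poles only at [P].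
   Smoothness makes the maximal ideals of the local rings principal (Nakayama),
   and transcendence degree 1 makes every nonzero regular function divide a
   power of the uniformizer, so the local rings are discrete valuation rings.
   If the zeros P = Z_0, ..., Z_k of a linear form have multiplicities e_i, and
   y is the form divided by one that does not vanish there, then functions that
   are independent modulo y at the Z_i, multiplied by the powers of 1/y, span
   spaces of dimension m * sum_i e_i with poles of order at most (m + D) * e_i;
   removing the poles at the Z_i with i > 0 leaves a nonzero function for large
   m.  Multiplying quotients of linear forms by polynomials in it separates
   points.  Finally, Frobenius traces descend from K to F. *)

(** * Rational functions and their values *)

(** Three fields meet: the basis [f] and the code live over [F], [Delta] is defined by spans over
    F_{q^r}, and points and values live over [K]. All linear algebra is done over [K]. Among vectors
    with coordinates in F_{q^r}, lying in a span over [K] and over F_{q^r} is the same, so [Delta]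
    consists of the rank jumps of matrices over [K]. Surjectivity of [phi] is used in dual form: a
    linear form on K^h that vanishes on all phi(f_eta) is zero. In this form it reduces to functions
    over [K], where separating functions can be built without care for rationality. Weights over [F]
    are compared block by block: a nonzero coordinate of [v] gives a nonzero block of the codeword.
    The geometry rests on one consequence of transcendence degree 1: for [f] nonzero and any [g],
    some nonzero polynomial in [g] is [f] times a function regular wherever both are. With [g] a
    uniformizer it bounds orders of vanishing; with [g] an affine coordinate it makes the zeros of a
    form finite in number. *)

Section Values.
Variables (F : finFieldType) (K : closedFieldType) (iota : {rmorphism F -> K}).
Variables (n : nat) (X : variety iota n).
Local Notation I := (ideal_of X).
Local Notation KX := (@function_field_closure F K iota n X).
Local Notation cst := (@Defs.constant F K iota n X).
Local Notation fr := (form_ratio X).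
Implicit Types (p q : {mpoly K[n.+1]}) (Q : 'rV[K]_n.+1) (f g : coord_frac X).

Lemma residue_eq0 p : (residue X p == 0) = (p \in I).
Proof.
by rewrite /residue -{2}[p]subr0 Quotient.idealrBE rmorph0.
Qed.

Lemma idealP p : reflect (forall Q, point_of X Q -> p.@[Q 0] = 0) (p \in I).
Proof. exact: asboolP. Qed.

Lemma value_ideal Q p : point_of X Q -> p.@[Q 0] != 0 -> p \notin I.
Proof. by move=> XQ; apply: contra => /idealP/(_ Q XQ)->. Qed.

(** Only quotients of classes of equal degree are functions on the curve, but as a ring morphism
    [cl] reduces identities between such quotients to computations with forms. *)
Definition form_class p : coord_frac X := tofrac (residue X p).
Local Notation cl := form_class.

Lemma form_class_zmod : zmod_morphism cl.
Proof. by move=> p q; rewrite /cl /residue !rmorphB. Qed.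
HB.instance Definition _ := GRing.isZmodMorphism.Build
  {mpoly K[n.+1]} (coord_frac X) cl form_class_zmod.
Lemma form_class_monoid : monoid_morphism cl.
Proof. by rewrite /cl /residue; split=> [|p q]; rewrite ?rmorph1 ?rmorphM. Qed.
HB.instance Definition _ := GRing.isMonoidMorphism.Build
  {mpoly K[n.+1]} (coord_frac X) cl form_class_monoid.

Lemma form_class_eq0 p : (cl p == 0) = (p \in I).
Proof. by rewrite /cl tofrac_eq0 residue_eq0. Qed.

Lemma constantE c : cst c = cl c%:MP.
Proof. by rewrite /Defs.constant /form_ratio -!/(cl _) rmorph1 divr1. Qed.

Lemma constant_zmod : zmod_morphism cst.
Proof. by move=> a b; rewrite !constantE !rmorphB. Qed.
HB.instance Definition _ := GRing.isZmodMorphism.Build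
  K (coord_frac X) cst constant_zmod.
Lemma constant_monoid : monoid_morphism cst.
Proof. by split=> [|a b]; rewrite !constantE ?rmorph1 ?rmorphM. Qed.
HB.instance Definition _ := GRing.isMonoidMorphism.Build
  K (coord_frac X) cst constant_monoid.

Lemma form_ratioE p q : fr p q = cl p / cl q. Proof. by []. Qed.

Local Opaque form_class.

Lemma form_ratio_eq p q p' q' : q \notin I -> q' \notin I ->
  (fr p q == fr p' q') = (p * q' - p' * q \in I).
Proof.
rewrite -!form_class_eq0 rmorphB !rmorphM !form_ratioE => q0 q'0.
by rewrite [RHS]subr_eq0 (eqr_div _ _ q0 q'0).
Qed.

Lemma idealM_notin p q : p \notin I -> q \notin I -> p * q \notin I.
Proof. by rewrite -!form_class_eq0 rmorphM mulf_eq0 => /negPf-> /negPf->. Qed.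

Lemma idealX_notin p k : p \notin I -> p ^+ k \notin I.
Proof.
move=> pI; elim: k => [|k IH]; last by rewrite exprS idealM_notin.
by rewrite expr0 -form_class_eq0 rmorph1 oner_eq0.
Qed.

Lemma homog_constant c : (c%:MP : {mpoly K[n.+1]}) \is 0.-homog.
Proof. by rewrite -[c%:MP]mulr1 mul_mpolyC dhomogZ ?dhomog1. Qed.

Lemma homog_var i : ('X_i : {mpoly K[n.+1]}) \is 1.-homog.
Proof. by rewrite dhomogX; apply/eqP/mdeg1. Qed.

Lemma homog_varX i d : ('X_i ^+ d : {mpoly K[n.+1]}) \is d.-homog.
Proof. by have := dhomogMn d (homog_var i); rewrite mul1n. Qed.

Lemma KX_form d p q : p \is d.-homog -> q \is d.-homog -> q \notin I ->
  KX (fr p q).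
Proof. by move=> hp hq qI; exists d, p, q. Qed.

Lemma KX_constant c : KX (cst c).
Proof.
apply: (@KX_form 0); rewrite ?dhomog1 ?homog_constant //.
by rewrite -form_class_eq0 rmorph1 oner_eq0.
Qed.

Lemma KX_add f g : KX f -> KX g -> KX (f + g).
Proof.
move=> [d [p [q [hp hq qI ->]]]] [d' [p' [q' [hp' hq' q'I ->]]]].
rewrite !form_ratioE addf_div ?form_class_eq0 // -!rmorphM -rmorphD.
apply: (@KX_form (d + d')%N);
  rewrite ?idealM_notin ?dhomogM //.
apply: dhomogD; first exact: dhomogM.
by rewrite addnC; apply: dhomogM.
Qed.

Lemma KX_mul f g : KX f -> KX g -> KX (f * g).
Proof.
move=> [d [p [q [hp hq qI ->]]]] [d' [p' [q' [hp' hq' q'I ->]]]].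
rewrite !form_ratioE mulf_div -!rmorphM.
by apply: (@KX_form (d + d')%N); rewrite ?idealM_notin ?dhomogM.
Qed.

Lemma KX_opp f : KX f -> KX (- f).
Proof. by move=> Kf; rewrite -mulN1r -(rmorphN1 cst); apply/KX_mul/Kf/KX_constant. Qed.

Lemma KX_sub f g : KX f -> KX g -> KX (f - g).
Proof. by move=> Kf /KX_opp; apply: KX_add. Qed.

Lemma KX_sum (J : Type) (r : seq J) (P : pred J) (u : J -> coord_frac X) :
  (forall i, P i -> KX (u i)) -> KX (\sum_(i <- r | P i) u i).
Proof.
move=> Ku; elim/big_ind: _ => //; last exact: KX_add.
by rewrite -(rmorph0 cst); apply: KX_constant.
Qed.

Section AtPoint.
Variables (Q : 'rV[K]_n.+1) (XQ : point_of X Q).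
Local Notation hv := (@has_value F K iota n X Q).
Local Notation reg := (@local_ring F K iota n X Q).

Lemma has_value_form d p q : p \is d.-homog -> q \is d.-homog ->
  q.@[Q 0] != 0 -> hv (fr p q) (p.@[Q 0] / q.@[Q 0]).
Proof. by move=> hp hq qQ; exists d, p, q. Qed.

Lemma has_value_uniq f v w : hv f v -> hv f w -> v = w.
Proof.
move=> [d [p [q [hp hq qQ -> ->]]]] [d' [p' [q' [hp' hq' q'Q /eqP + ->]]]].
rewrite form_ratio_eq ?(value_ideal XQ) // => /idealP/(_ Q XQ)/eqP.
by rewrite mevalB !mevalM subr_eq0 => e; apply/eqP; rewrite eqr_div.
Qed.

Lemma has_value_KX f v : hv f v -> KX f.
Proof.
by move=> [d [p [q [hp hq qQ -> _]]]]; apply: (@KX_form d); rewrite ?(value_ideal XQ).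
Qed.

Lemma has_value_constant c : hv (cst c) c.
Proof.
exists 0%N, c%:MP, 1.
by rewrite homog_constant dhomog1 meval1 mevalC oner_eq0 divr1.
Qed.

Lemma has_valueD f g v w : hv f v -> hv g w -> hv (f + g) (v + w).
Proof.
move=> [d [p [q [hp hq qQ -> ->]]]] [d' [p' [q' [hp' hq' q'Q -> ->]]]].
rewrite !form_ratioE addf_div ?form_class_eq0 ?(value_ideal XQ) //.
rewrite addf_div // -!(rmorphM cl) -(rmorphD cl) -!mevalM -mevalD.
apply: (@has_value_form (d + d')%N); rewrite ?mevalM ?mulf_neq0 ?dhomogM //.
apply: dhomogD; first exact: dhomogM.
by rewrite addnC; apply: dhomogM.
Qed.

Lemma has_valueM f g v w : hv f v -> hv g w -> hv (f * g) (v * w).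
Proof.
move=> [d [p [q [hp hq qQ -> ->]]]] [d' [p' [q' [hp' hq' q'Q -> ->]]]].
rewrite !form_ratioE !mulf_div -!(rmorphM cl) -!mevalM.
by apply: (@has_value_form (d + d')%N); rewrite ?mevalM ?mulf_neq0 ?dhomogM.
Qed.

Lemma has_valueN f v : hv f v -> hv (- f) (- v).
Proof.
move=> fv; rewrite -mulN1r -(rmorphN1 cst) -[- v]mulN1r.
exact: has_valueM (has_value_constant _) fv.
Qed.

Lemma has_valueB f g v w : hv f v -> hv g w -> hv (f - g) (v - w).
Proof. by move=> fv /has_valueN; apply: has_valueD. Qed.

Lemma has_valueV f v : hv f v -> v != 0 -> hv f^-1 v^-1.
Proof.
move=> [d [p [q [hp hq qQ -> ->]]]]; rewrite mulf_eq0 negb_or => /andP[pQ _].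
by rewrite form_ratioE !invf_div; apply: (@has_value_form d).
Qed.

Lemma has_value0 : hv 0 0.
Proof. by rewrite -(rmorph0 cst); apply: has_value_constant. Qed.

Lemma has_value1 : hv 1 1.
Proof. by rewrite -(rmorph1 cst); apply: has_value_constant. Qed.

Lemma has_valueX f v k : hv f v -> hv (f ^+ k) (v ^+ k).
Proof.
move=> fv; elim: k => [|k IH]; first exact: has_value1.
by rewrite !exprS; apply: has_valueM.
Qed.

Lemma has_value_sum (J : Type) (r : seq J) (P : pred J) u v :
  (forall i, P i -> hv (u i) (v i)) ->
  hv (\sum_(i <- r | P i) u i) (\sum_(i <- r | P i) v i).
Proof.
move=> uv; apply: (big_ind2 (fun x y => hv x y)) => //; first exact: has_value0.
by move=> *; apply: has_valueD.
Qed.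

Lemma has_value_prod (J : Type) (r : seq J) (P : pred J) u v :
  (forall i, P i -> hv (u i) (v i)) ->
  hv (\prod_(i <- r | P i) u i) (\prod_(i <- r | P i) v i).
Proof.
move=> uv; apply: (big_ind2 (fun x y => hv x y)) => //; first exact: has_value1.
by move=> *; apply: has_valueM.
Qed.

Lemma eval_atE f v : hv f v -> eval_at Q f = v.
Proof.
move=> fv; rewrite /eval_at; case: xgetP => [w _ /= fw|/(_ v)//].
exact: has_value_uniq fw fv.
Qed.

Lemma local_ringP f : reg f -> hv f (eval_at Q f).
Proof. by move=> [v fv]; rewrite (eval_atE fv). Qed.

Lemma local_ring_KX f : reg f -> KX f.
Proof. by move=> [v /has_value_KX]. Qed.

Lemma local_ringD f g : reg f -> reg g -> reg (f + g).
Proof. by move=> [v fv] [w gw]; exists (v + w); apply: has_valueD. Qed.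

Lemma local_ringM f g : reg f -> reg g -> reg (f * g).
Proof. by move=> [v fv] [w gw]; exists (v * w); apply: has_valueM. Qed.

Lemma local_ringB f g : reg f -> reg g -> reg (f - g).
Proof. by move=> [v fv] [w gw]; exists (v - w); apply: has_valueB. Qed.

Lemma local_ringN f : reg f -> reg (- f).
Proof. by move=> [v fv]; exists (- v); apply: has_valueN. Qed.

Lemma local_ring_constant c : reg (cst c).
Proof. by exists c; apply: has_value_constant. Qed.

Lemma local_ring1 : reg 1.
Proof. by exists 1; apply: has_value1. Qed.

Lemma local_ring0 : reg 0.
Proof. by exists 0; apply: has_value0. Qed.

Lemma local_ringX f k : reg f -> reg (f ^+ k).
Proof. by move=> [v fv]; exists (v ^+ k); apply: has_valueX. Qed.

Lemma local_ring_sum (J : Type) (r : seq J) (P : pred J) u :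
  (forall i, P i -> reg (u i)) -> reg (\sum_(i <- r | P i) u i).
Proof.
by move=> ru; elim/big_ind: _ => //; [apply: local_ring0|apply: local_ringD].
Qed.

Lemma local_ring_prod (J : Type) (r : seq J) (P : pred J) u :
  (forall i, P i -> reg (u i)) -> reg (\prod_(i <- r | P i) u i).
Proof.
by move=> ru; elim/big_ind: _ => //; [apply: local_ring1|apply: local_ringM].
Qed.

End AtPoint.

Lemma meval_scale d p c Q : p \is d.-homog ->
  p.@[(c *: Q) 0] = c ^+ d * p.@[Q 0].
Proof.
move=> /dhomogP hp; rewrite !mevalE mulr_sumr.
apply: eq_big_seq => m /hp md; rewrite mulrCA; congr (_ * _).
under eq_bigr do rewrite mxE exprMn.
by rewrite big_split -expr_sum -md /= mdegE.
Qed.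

Lemma same_pointP Q Q' : Q != 0 ->
  reflect (exists2 c, c != 0 & Q = c *: Q') (same_point Q Q').
Proof.
move=> Q0; apply: (iffP idP) => [/andP[/sub_rVP[c e] _]|[c c0 ->]].
  by exists c => //; apply: contraNneq Q0 => c0; rewrite e c0 scale0r.
by rewrite /same_point !scalemx_sub //= -{1}(scalerK c0 Q') scalemx_sub.
Qed.

Lemma point_neq0 Q : point_of X Q -> Q != 0.
Proof. by case. Qed.

Lemma same_point_sym Q Q' : same_point Q Q' = same_point Q' Q.
Proof. by rewrite /same_point andbC. Qed.

Lemma same_point_refl Q : same_point Q Q.
Proof. by rewrite /same_point submx_refl. Qed.

Lemma same_point_trans Q Q' Q'' : same_point Q Q' -> same_point Q' Q'' -> same_point Q Q''.
Proof.
by move=> /andP[a b] /andP[c d]; rewrite /same_point (submx_trans a c) (submx_trans d b).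
Qed.

Lemma same_point_value Q Q' f v : point_of X Q -> same_point Q Q' ->
  has_value Q f v -> has_value Q' f v.
Proof.
move=> XQ /(same_pointP _ (point_neq0 XQ))[c c0 ->] [d [p [q [hp hq]]]].
rewrite !(meval_scale _ _ hp) !(meval_scale _ _ hq) mulf_eq0 negb_or.
case/andP=> cd qQ -> ->; exists d, p, q; split=> //.
by rewrite -mulf_div divff ?mul1r.
Qed.

End Values.

(** * Algebraic dependence of two functions *)

Section Dependence.
Variables (F : finFieldType) (K : closedFieldType) (iota : {rmorphism F -> K}).
Variables (n : nat) (X : variety iota n).
Local Notation KX := (@function_field_closure F K iota n X).
Local Notation cst := (@Defs.constant F K iota n X).
Implicit Types (Q : 'rV[K]_n.+1) (f g : coord_frac X).

Lemma has_value_horner Q f v (p : {poly K}) : point_of X Q ->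
  has_value Q f v -> has_value Q (map_poly cst p).[f] p.[v].
Proof.
move=> XQ fv; elim/poly_ind: p => [|p c IH].
  by rewrite rmorph0 !horner0; apply: has_value0.
rewrite rmorphD rmorphM /= map_polyX map_polyC !hornerMXaddC.
by apply: (has_valueD XQ); [apply: has_valueM|apply: has_value_constant].
Qed.

Hypothesis dim1 : has_dimension X 1.

(* Dividing an algebraic relation between [f] and [g] by the largest possible
   power of [f] exhibits [f] as a divisor of a nonzero polynomial in [g]. *)
Lemma divides_poly f g : f != 0 -> KX f -> KX g ->
  exists2 p : {poly K}, p != 0 & exists2 h, (map_poly cst p).[g] = f * h &
    forall Q, point_of X Q -> local_ring Q f -> local_ring Q g -> local_ring Q h.
Proof.
move=> f0 Kf Kg.
pose t (i : 'I_2) := if i == ord0 then f else g.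
have Kt i : KX (t i) by rewrite /t; case: ifP.
have {Kt} := dim1.2 t Kt; rewrite /algebraically_independent.
move=> /existsNP[r /not_implyP[r_eq0 /eqP r0]].
have tE m : mmap1 t m = f ^+ m ord0 * g ^+ m ord_max.
  by rewrite /mmap1 big_ord_recl big_ord1 /=; congr (_ * g ^+ m _); apply: val_inj.
pose P k := has (fun m : 'X_{1..2} => m ord0 == k) (msupp r).
have exP : exists k, P k.
  by exists (mlead r ord0); apply/hasP; exists (mlead r); rewrite ?mlead_supp.
case: (ex_minnP exP) => k /hasP[m0 m0r /eqP m0k] kmin.
have kle m : m \in msupp r -> (k <= m ord0)%N.
  by move=> mr; apply: kmin; apply/hasP; exists m.
(* [k] is the least exponent of [f] in the relation [r]. The terms with that exponent give [p], and
   [h] is minus the rest divided by [f ^+ k.+1], so the relation reads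
   [f ^+ k * (p(g) - f * h) = 0]. *)
pose p := \sum_(m <- msupp r | m ord0 == k) r@_m *: 'X^(m ord_max).
pose h := - \sum_(m <- msupp r | m ord0 != k)
  cst r@_m * (f ^+ (m ord0 - k.+1) * g ^+ m ord_max).
exists p.
  apply: contraTneq (m0r) => p0; rewrite -mcoeff_eq0.
  have := congr1 (fun q : {poly K} => q`_(m0 ord_max)) p0.
  rewrite /p coef_sum coef0 => <-.
  rewrite big_mkcond (bigD1_seq m0) ?msupp_uniq //= m0k eqxx big1 ?addr0.
    by rewrite coefZ coefXn eqxx mulr1 eqxx.
  move=> m mm0; case: eqP => // mk; rewrite coefZ coefXn.
  case: eqP => e; last by rewrite mulr0.
  case/eqP: mm0; apply/mnmP => i; case: i => [[|[|//]] i2].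
    have -> : Ordinal i2 = ord0 by apply: val_inj.
    by rewrite m0k mk.
  have -> : Ordinal i2 = ord_max by apply: val_inj.
  by rewrite e.
exists h.
  have : f ^+ k * ((map_poly cst p).[g] - f * h) = 0.
    rewrite -[RHS]r_eq0 /mmap /h mulrN opprK mulrDr.
    rewrite [RHS](bigID (fun m : 'X_{1..2} => m ord0 == k)) /=.
    congr (_ + _).
      rewrite /p rmorph_sum /= horner_sum mulr_sumr.
      apply: eq_bigr => m /eqP mk; rewrite map_polyZ hornerZ map_polyXn hornerXn tE mk.
      by rewrite mulrCA.
    rewrite mulrA -exprSr mulr_sumr big_seq_cond [RHS]big_seq_cond.
    apply: eq_bigr => m /andP[/kle mk mk']; rewrite tE mulrCA; congr (_ * _).
    by rewrite mulrA -exprD subnKC // ltn_neqAle eq_sym mk'.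
  by move/eqP; rewrite mulf_eq0 expf_eq0 (negPf f0) andbF subr_eq0 => /eqP.
move=> Q XQ fQ gQ; apply: local_ringN; apply: (local_ring_sum XQ) => m _.
apply: local_ringM; first exact: local_ring_constant.
by apply: local_ringM; apply: local_ringX.
Qed.
End Dependence.

(** * Local rings of the curve *)

(** For the equations of the curve it puts the coordinate vector of a point in the kernel of the
    Jacobian matrix there. *)
Lemma euler_identity (R : comNzRingType) n d (p : {mpoly R[n]}) (v : 'I_n -> R) :
  p \is d.-homog -> \sum_i v i * (p^`M(i)).@[v] = p.@[v] *+ d.
Proof.
move=> /dhomogP hp.
have mon m : \sum_i v i * ('X_[m]^`M(i)).@[v] = 'X_[m].@[v] *+ mdeg m.
  rewrite mdegE -sumrMnr; apply: eq_bigr => i _.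
  rewrite mderivX mevalZ; have [->|mi] := posnP (m i).
    by rewrite mul0r mulr0.
  rewrite mulrCA -[v i](mevalXU v) -mevalM -mpolyXD.
  have -> : (U_(i) + (m - U_(i)))%MM = m; last by rewrite mulr_natl.
  apply/mnmP => j; rewrite mnmDE mnmBE mnm1E.
  by case: eqP => [<-|_]; rewrite ?subn0 ?subnKC.
rewrite {2}[p]mpolyE raddf_sum -sumrMnl /=.
transitivity (\sum_(m <- msupp p) \sum_i v i * ((p@_m *: 'X_[m])^`M(i)).@[v]).
  rewrite exchange_big; apply: eq_bigr => i _.
  rewrite -mulr_sumr {1}[p]mpolyE; congr (_ * _).
  by rewrite (raddf_sum (mderiv i)) (raddf_sum (meval v)).
apply: eq_big_seq => m /hp/= mdm; rewrite mevalZ -mulrnAr -mdm -mon mulr_sumr.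
by apply: eq_bigr => i _; rewrite mderivZ mevalZ mulrCA.
Qed.

Section LocalStructure.
Variables (F : finFieldType) (K : closedFieldType) (iota : {rmorphism F -> K}).
Variables (n : nat) (X : variety iota n).
Local Notation I := (ideal_of X).
Local Notation KX := (@function_field_closure F K iota n X).
Local Notation cst := (@Defs.constant F K iota n X).
Local Notation cl := (form_class X).
Variables (Q : 'rV[K]_n.+1) (XQ : point_of X Q).
Local Notation hv := (@has_value F K iota n X Q).
Local Notation reg := (@local_ring F K iota n X Q).
Implicit Types (f g : coord_frac X).

Lemma has_value_det m (M : 'M[coord_frac X]_m) (M0 : 'M[K]_m) :
  (forall i j, hv (M i j) (M0 i j)) -> hv (\det M) (\det M0).
Proof.
move=> h; apply: has_value_sum => // s _; apply: has_valueM.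
  by apply: has_valueX; rewrite -(rmorphN1 cst); apply: has_value_constant.
by apply: has_value_prod.
Qed.

(** Serves to solve a linear system over the local ring by Cramer's rule. *)
Lemma local_ring_adj m (M : 'M[coord_frac X]_m) :
  (forall i j, reg (M i j)) -> forall i j, reg ((\adj M) i j).
Proof.
move=> h i j; rewrite mxE /cofactor; apply: local_ringM.
  by apply: local_ringX; rewrite -(rmorphN1 cst); apply: local_ring_constant.
exists (\det (\matrix_(a, b) eval_at Q (row' j (col' i M) a b))).
by apply: has_value_det => a b; rewrite !mxE; apply: local_ringP.
Qed.

Section Chart.
Variables (j0 : 'I_n.+1) (Qj0 : Q 0 j0 != 0).

(** The factor [Q 0 j0] makes the value at [Q] equal to [Q 0 i] itself, so polynomials and their
    derivatives are evaluated at [Q] without normalizing its coordinates. *)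
Definition chart_coord (i : 'I_n.+1) : coord_frac X :=
  cst (Q 0 j0) * (cl 'X_i / cl 'X_j0).
Definition local_coord i : coord_frac X := chart_coord i - cst (Q 0 i).
Local Notation y := local_coord.

Lemma chart_var_neq0 : cl 'X_j0 != 0.
Proof. by rewrite form_class_eq0 (value_ideal XQ) // mevalXU. Qed.

Lemma has_value_chart i : hv (chart_coord i) (Q 0 i).
Proof.
have -> : Q 0 i = Q 0 j0 * (('X_i).@[Q 0] / ('X_j0).@[Q 0]).
  by rewrite !mevalXU mulrC mulfVK.
apply: has_valueM; first exact: has_value_constant.
by apply: (@has_value_form _ _ _ _ _ _ 1); rewrite ?homog_var ?mevalXU.
Qed.

Lemma has_value_local i : hv (y i) 0.
Proof.
rewrite -(subrr (Q 0 i)); apply: has_valueB => //; first exact: has_value_chart.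
exact: has_value_constant.
Qed.

Lemma local_coord0 : y j0 = 0.
Proof.
by rewrite /y /chart_coord divff ?chart_var_neq0 // mulr1 subrr.
Qed.

Lemma mmap_chart d p : p \is d.-homog ->
  mmap cst chart_coord p = (cst (Q 0 j0) / cl 'X_j0) ^+ d * cl p.
Proof.
move=> /dhomogP hp; rewrite [in cl p](mpolyE p) rmorph_sum mulr_sumr.
apply: eq_big_seq => m /hp/= md.
rewrite -mul_mpolyC rmorphM /= -constantE mulrCA; congr (_ * _).
rewrite [in cl 'X_[m]]mpolyXE_id rmorph_prod /mmap1 -md mdegE expr_sum -big_split.
apply: eq_bigr => i _; rewrite rmorphXn /= -exprMn /chart_coord; congr (_ ^+ _).
by rewrite mulrA mulrAC.
Qed.

(** A first order Taylor formula with the remainder hidden in the coefficients: [u i] is a function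
    whose value is the partial derivative. In this form the polynomials that satisfy it are closed
    under sums and products, so constants and variables suffice. *)
Lemma taylor p : exists2 u : 'I_n.+1 -> coord_frac X,
  forall i, hv (u i) (p^`M(i)).@[Q 0] &
  mmap cst chart_coord p = cst p.@[Q 0] + \sum_i u i * y i.
Proof.
pose T p := exists2 u : 'I_n.+1 -> coord_frac X,
  forall i, hv (u i) (p^`M(i)).@[Q 0] &
  mmap cst chart_coord p = cst p.@[Q 0] + \sum_i u i * y i.
have TC c : T c%:MP.
  exists (fun _ => 0) => [i|].
    by rewrite mderivC meval0; apply: has_value0.
  by rewrite mmapC mevalC big1 ?addr0 // => i _; rewrite mul0r.
have TX j : T 'X_j.
  exists (fun i => cst (j == i)%:R) => [i|].
    rewrite mderivX mevalZ mnm1E.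
    case: eqP => [->|_]; last by rewrite mulr0n mul0r; apply: has_value_constant.
    have -> : (U_(i) - U_(i))%MM = 0%MM by apply/mnmP => k; rewrite mnmBE mnm0E subnn.
    by rewrite mpolyX0 meval1 mulr1; apply: has_value_constant.
  rewrite mmapX mmap1U mevalXU (bigD1 j) //= eqxx rmorph1 mul1r big1 ?addr0.
    by rewrite /local_coord addrC subrK.
  by move=> i; rewrite eq_sym => /negPf->; rewrite rmorph0 mul0r.
have TD p1 p2 : T p1 -> T p2 -> T (p1 + p2).
  move=> [u hu eu] [w hw ew]; exists (fun i => u i + w i) => [i|].
    by rewrite mderivD mevalD; apply: has_valueD.
  rewrite mmapD eu ew mevalD rmorphD /= addrACA; congr (_ + _).
  by rewrite -big_split; apply: eq_bigr => i _; rewrite mulrDl.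
have TM p1 p2 : T p1 -> T p2 -> T (p1 * p2).
  move=> [u hu eu] [w hw ew].
  exists (fun i => u i * mmap cst chart_coord p2 + cst p1.@[Q 0] * w i) => [i|].
    rewrite mderivM mevalD !mevalM; apply: has_valueD => //.
      apply: has_valueM => //; rewrite -[p2.@[Q 0]]addr0 ew.
      apply: has_valueD => //; first exact: has_value_constant.
      have -> : 0 = \sum_(i < n.+1) (p2^`M(i)).@[Q 0] * 0 :> K.
        by rewrite big1 // => k _; rewrite mulr0.
      apply: has_value_sum => // k _; apply: has_valueM => //.
      exact: has_value_local.
    by apply: has_valueM => //; apply: has_value_constant.
  rewrite rmorphM /= {1}eu mulrDl {1}ew mulrDr mevalM rmorphM -addrA; congr (_ + _).
  rewrite mulr_sumr mulr_suml -big_split; apply: eq_bigr => i _.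
  by rewrite [RHS]mulrDl [RHS]addrC mulrA; congr (_ + _); rewrite mulrAC.
have TP k (G : 'I_k -> {mpoly K[n.+1]}) : (forall i, T (G i)) -> T (\prod_i G i).
  by move=> TG; elim/big_ind: _ => //; rewrite -mpolyC1.
elim/mpolyind: p => [|c m p _ _ IH]; first exact: (TC 0).
apply: TD => //; rewrite -mul_mpolyC; apply: (TM _ _) => //.
rewrite [X in T X]mpolyXE_id; apply: TP => i; elim: (m i) => [|k IHk].
  by rewrite expr0 -mpolyC1.
by rewrite exprS; apply: (TM _ _).
Qed.

End Chart.
End LocalStructure.

Lemma homog_map (R S : nzRingType) (phi : {rmorphism R -> S}) n d
    (p : {mpoly R[n]}) :
  p \is d.-homog -> map_mpoly phi p \is d.-homog.
Proof.
move=> /dhomogP hp; apply/dhomogP => m; rewrite mcoeff_msupp mcoeff_map_mpoly => im.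
apply: hp; rewrite mcoeff_msupp; apply: contraNneq im => ->.
by rewrite raddf0.
Qed.

(** * Existence of uniformizers at nonsingular points *)

Section Uniformizer.
Variables (F : finFieldType) (K : closedFieldType) (iota : {rmorphism F -> K}).
Variables (n : nat) (X : variety iota n).
Local Notation I := (ideal_of X).
Local Notation KX := (@function_field_closure F K iota n X).
Local Notation cst := (@Defs.constant F K iota n X).
Local Notation cl := (form_class X).
Local Opaque form_class.
Hypotheses (dim1 : has_dimension X 1) (smooth : nonsingular X).
Variables (Q : 'rV[K]_n.+1) (XQ : point_of X Q).
Local Notation hv := (@has_value F K iota n X Q).
Local Notation reg := (@local_ring F K iota n X Q).
Implicit Types (f g : coord_frac X).

(** The Jacobian has rank n - 1 and kills [Q], while the row [delta_mx 0 j0] does not. Together they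
    have rank at least [n], so one further row suffices. The row [delta_mx 0 j0] stands for the
    relation y_j0 = 0; the row [b] will give the uniformizer. *)
Lemma jacobian_complement (j0 : 'I_n.+1) : Q 0 j0 != 0 ->
  exists b : 'rV[K]_n.+1,
    row_full (col_mx (col_mx (jacobian X Q) (delta_mx 0 j0 : 'rV[K]_n.+1)) b).
Proof.
move=> Qj0; set J := jacobian X Q.
have rankJ : (\rank J + 1 = n)%N by apply: smooth.
have JQ : J *m Q^T = 0.
  apply/matrixP => k i; rewrite ord1 !mxE.
  have [_ /(_ _ (mem_nth 0 (ltn_ord k))) Qk] := XQ.
  have [d hd] := eqns_homog X _ (mem_nth 0 (ltn_ord k)).
  under eq_bigr do rewrite !mxE mulrC.
  by rewrite (@euler_identity _ _ d) ?Qk ?mul0rn ?homog_map.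
set e := delta_mx 0 j0.
have ltJ : (J < J + e)%MS.
  rewrite ltmxE addsmxSl addsmx_sub submx_refl /=.
  apply: contra Qj0 => /submxP[D eD].
  have /matrixP/(_ 0 0) : e *m Q^T = 0.
    by rewrite eD -mulmxA JQ mulmx0.
  by rewrite -rowE !mxE => ->.
have rankJ' : (n <= \rank (col_mx J e))%N.
  by rewrite -{1}rankJ addn1 -addsmxE rank_ltmx.
set J' := col_mx J _ in rankJ' *.
have full m (A : 'M[K]_(m, n.+1)) : (n < \rank A)%N -> row_full A.
  by move=> h; rewrite /row_full eqn_leq rank_leq_col.
have [fJ|/row_subPn[i iJ]] := boolP (1%:M <= J')%MS.
  exists 0; apply: full; rewrite -addsmxE addsmx0.
  by move: fJ; rewrite sub1mx => /eqP->.
exists (row i 1%:M); apply: full; apply: leq_ltn_trans rankJ' _.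
rewrite -[X in (_ < X)%N]addsmxE; apply: rank_ltmx.
by rewrite ltmxE addsmxSl addsmx_sub submx_refl.
Qed.

(** Nakayama's lemma made explicit. The equations of the curve and y_j0 = 0 express each local
    coordinate as a constant times [t] plus a combination of the local coordinates with coefficients
    [B] that vanish at [Q]. The matrix 1 - [B] has a determinant of value 1 at [Q], so it is
    invertible over the local ring. *)
Lemma local_coord_multiple (j0 : 'I_n.+1) : Q 0 j0 != 0 ->
  exists2 t, hv t 0 & forall i, exists2 r, reg r & local_coord X Q j0 i = r * t.
Proof.
move=> Qj0; set y := local_coord X Q j0.
have [b /eqP full] := jacobian_complement Qj0.
set J := jacobian X Q in full; set M := col_mx _ _ in full.
have /submxP[D eD] : (1%:M <= M)%MS by rewrite sub1mx /row_full full.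
have hy i : hv (y i) 0 by apply: has_value_local.
have /boolp.choice[u hu] : forall k, exists u : 'I_n.+1 -> coord_frac X,
    (forall i, hv (u i) (J k i)) /\ \sum_i u i * y i = 0.
  move=> k.
  have [w hw ew] := taylor XQ Qj0 (map_mpoly iota (eqns X)`_k).
  exists w; split=> [i|]; first by rewrite mxE.
  have [_ /(_ _ (mem_nth 0 (ltn_ord k))) Qk] := XQ.
  move: ew; rewrite Qk rmorph0 add0r => <-.
  have [d hd] := eqns_homog X _ (mem_nth 0 (ltn_ord k)).
  rewrite (@mmap_chart _ _ _ _ _ _ _ d) ?homog_map //.
  suff /eqP-> : cl (map_mpoly iota (eqns X)`_k) == 0 by rewrite mulr0.
  rewrite form_class_eq0; apply/idealP => R [_]; apply.
  exact: mem_nth.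
pose t := \sum_i cst (b 0 i) * y i.
have t0 : hv t 0.
  have -> : 0 = \sum_i b 0 i * 0 :> K by rewrite big1 // => i _; rewrite mulr0.
  apply: has_value_sum => // i _; apply: has_valueM => //.
  exact: has_value_constant.
exists t => //.
(* [D] is a left inverse of the completed matrix [M]. [D1] and [d] are its columns facing the
   Jacobian rows and [b]; the column facing [delta_mx 0 j0] drops out because y_j0 = 0. *)
pose D1 i k := D i (lshift 1 (lshift 1 k)).
pose d i := D i (rshift _ 0).
(* As [\sum_j u k j * y j = 0], the linear part with coefficients [J k j] equals minus the sum with
   coefficients [u k j - J k j], which vanish at [Q]. *)
pose B i j := - \sum_k cst (D1 i k) * (u k j - cst (J k j)).
have hB i j : hv (B i j) 0.
  rewrite -oppr0; apply: has_valueN.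
  have -> : 0 = \sum_k D1 i k * 0 :> K by rewrite big1 // => k _; rewrite mulr0.
  apply: has_value_sum => // k _; apply: has_valueM; first exact: has_value_constant.
  rewrite -(subrr (J k j)); apply: has_valueB => //; first exact: (hu k).1.
  exact: has_value_constant.
have yE i : y i = \sum_j B i j * y j + cst (d i) * t.
  have : \sum_j cst ((1%:M : 'M[K]_n.+1) i j) * y j = y i.
    rewrite (bigD1 i) //= mxE eqxx rmorph1 mul1r big1 ?addr0 // => j ji.
    by rewrite mxE eq_sym (negPf ji) rmorph0 mul0r.
  rewrite eD => <-.
  under eq_bigr do rewrite mxE rmorph_sum mulr_suml /=.
  rewrite exchange_big /= big_split_ord big_ord1 /=; congr (_ + _); last first.
    rewrite /t mulr_sumr; apply: eq_bigr => j _.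
    by rewrite rmorphM /= -mulrA col_mxEd.
  rewrite big_split_ord big_ord1 /= [X in _ + X]big1 ?addr0; last first.
    move=> j _; rewrite col_mxEu col_mxEd !mxE eqxx /=.
    case: eqP => [->|_]; first by rewrite /y local_coord0 // mulr0.
    by rewrite mulr0 rmorph0 mul0r.
  under [RHS]eq_bigr do rewrite mulNr mulr_suml -sumrN.
  rewrite [RHS]exchange_big /=; apply: eq_bigr => k _.
  transitivity (cst (D1 i k) * \sum_j cst (J k j) * y j).
    rewrite mulr_sumr; apply: eq_bigr => j _.
    by rewrite !col_mxEu rmorphM /= mulrA.
  have -> : \sum_j cst (J k j) * y j = - \sum_j (u k j - cst (J k j)) * y j.
    apply/eqP; rewrite -addr_eq0 -[X in _ == X](hu k).2 -big_split.
    by apply/eqP/eq_bigr => j _ /=; rewrite -mulrDl addrC subrK.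
  rewrite mulrN mulr_sumr -sumrN; apply: eq_bigr => j _; by rewrite mulrA.
pose N : 'M[coord_frac X]_n.+1 := \matrix_(i, j) (cst (i == j)%:R - B i j).
have hN i j : hv (N i j) ((1%:M : 'M[K]_n.+1) i j).
  rewrite !mxE -[X in hv _ X]subr0; apply: has_valueB => //.
  exact: has_value_constant.
have detN : hv (\det N) 1.
  by rewrite -[X in hv _ X](det1 K n.+1); apply: has_value_det.
have eN : N *m (\col_i y i) = \col_i (cst (d i) * t).
  apply/matrixP => i k; rewrite !mxE.
  under eq_bigr do rewrite !mxE mulrBl.
  rewrite sumrB (bigD1 i) //= eqxx rmorph1 mul1r big1 ?addr0.
    by rewrite {1}yE addrAC subrr add0r.
  by move=> j ji; rewrite eq_sym (negPf ji) rmorph0 mul0r.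
have detN0 : \det N != 0.
  apply: contra_neq (oner_neq0 K) => e; apply: (has_value_uniq XQ detN).
  by rewrite e; apply: has_value0.
move=> i; exists ((\sum_j (\adj N) i j * cst (d j)) / \det N).
  apply: local_ringM; last by exists 1^-1; apply: has_valueV; rewrite ?oner_eq0.
  apply: local_ring_sum => // j _; apply: local_ringM; last exact: local_ring_constant.
  by apply: local_ring_adj => // k l; eexists; apply: hN.
have : \det N * y i = (\sum_j (\adj N) i j * cst (d j)) * t.
  have := congr1 (fun A : 'cV[coord_frac X]_n.+1 => A i 0) (congr1 (mulmx (\adj N)) eN).
  rewrite mulmxA mul_adj_mx mul_scalar_mx !mxE => ->.
  by rewrite mulr_suml; apply: eq_bigr => j _; rewrite [X in _ * X]mxE mulrA.
by move=> e; rewrite mulrAC -e mulrAC divff // mul1r.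
Qed.

Lemma exists_uniformizer : exists2 t : coord_frac X, uniformizer Q t & t != 0.
Proof.
have /rV0Pn[j0 Qj0] := point_neq0 XQ.
have [t t0 ty] := local_coord_multiple Qj0.
have hphi p := taylor XQ Qj0 p.
pose phi := mmap cst (chart_coord X Q j0).
have form_phi d p q : p \is d.-homog -> q \is d.-homog ->
    form_ratio X p q = phi p / phi q.
  move=> hp hq; rewrite /phi (mmap_chart X Q j0 hp) (mmap_chart X Q j0 hq) form_ratioE.
  rewrite -mulf_div divff ?mul1r // expf_neq0 // mulf_neq0 ?fmorph_eq0 //.
  by rewrite invr_eq0; apply: (chart_var_neq0 XQ).
have phi_value p : hv (phi p) p.@[Q 0].
  rewrite /phi; have [u hu ->] := hphi p; rewrite -[X in hv _ X]addr0.
  apply: has_valueD => //; first exact: has_value_constant.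
  have -> : 0 = \sum_i (p^`M(i)).@[Q 0] * 0 :> K by rewrite big1 // => i _; rewrite mulr0.
  by apply: has_value_sum => // i _; apply: has_valueM => //; apply: has_value_local.
exists t; first split => // f.
  move=> [d [p [q [hp hq qQ -> /esym/eqP]]]].
  rewrite mulf_eq0 invr_eq0 (negPf qQ) orbF => /eqP pQ.
  have [u hu ep] := hphi p.
  have /boolp.choice[r hr] : forall i, exists r, reg r /\ local_coord X Q j0 i = r * t.
    by move=> i; have [r] := ty i; exists r.
  exists ((\sum_i u i * r i) / phi q).
    apply: local_ringM; last by eexists; apply: has_valueV (phi_value q) qQ.
    apply: local_ring_sum => // i _; apply: local_ringM; last exact: (hr i).1.
    by eexists; apply: hu.
  rewrite (form_phi d) // {1}/phi ep pQ rmorph0 add0r mulrAC; congr (_ / _).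
  by rewrite mulr_suml; apply: eq_bigr => i _; rewrite (hr i).2 mulrA.
(* If [t] were 0, all local coordinates would vanish, every form would be constant in the chart and
   every rational function a constant, against transcendence degree 1. *)
apply: contraPneq dim1 => tz [[s Ks indep] _].
have [d [p [q [hp hq qI es]]]] := Ks ord0.
have phic p0 : phi p0 = cst p0.@[Q 0].
  have [u _] := hphi p0; rewrite /phi => ->; rewrite big1 ?addr0 // => i _.
  by have [r _ ->] := ty i; rewrite tz !mulr0.
pose c := p.@[Q 0] / q.@[Q 0].
have qQ : q.@[Q 0] != 0.
  apply: contraNneq qI => qQ; rewrite -form_class_eq0.
  have /eqP : phi q = 0 by rewrite phic qQ rmorph0.
  rewrite /phi (mmap_chart X Q j0 hq) mulf_eq0 => /orP[|//].
  rewrite expf_eq0 mulf_eq0 invr_eq0 (negPf (chart_var_neq0 XQ Qj0)) orbF.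
  by rewrite fmorph_eq0 (negPf Qj0) andbF.
have sc : s ord0 = cst c.
  by rewrite es (form_phi d) // !phic /c fmorph_div.
have /eqP : 'X_ord0 - c%:MP = 0 :> {mpoly K[1]}.
  by apply: indep; rewrite mmapB mmapC mmapX mmap1U sc subrr.
move=> /eqP/(congr1 (fun p => p.@[fun=> c + 1])).
rewrite mevalB mevalXU mevalC meval0 addrAC subrr add0r => /eqP.
by rewrite oner_eq0.
Qed.
End Uniformizer.

(** * Valuations *)

Section Valuation.
Variables (F : finFieldType) (K : closedFieldType) (iota : {rmorphism F -> K}).
Variables (n : nat) (X : variety iota n).
Local Notation I := (ideal_of X).
Local Notation KX := (@function_field_closure F K iota n X).
Local Notation cst := (@Defs.constant F K iota n X).
Local Notation cl := (form_class X).
Local Opaque form_class.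
Implicit Types (f g h s t u w : coord_frac X) (Q : 'rV[K]_n.+1).

Lemma valuation_same_point Q Q' f : point_of X Q -> point_of X Q' ->
  same_point Q Q' -> valuation Q f = valuation Q' f.
Proof.
move=> XQ XQ' QQ'; suff E : @has_value F K iota n X Q = has_value Q'.
  by rewrite /valuation /has_valuation /uniformizer /maximal_ideal /local_ring E.
apply/funext => g; apply/funext => v; apply/propext.
by split; apply: same_point_value => //; rewrite same_point_sym.
Qed.

Hypotheses (dim1 : has_dimension X 1) (smooth : nonsingular X).

Section AtPoint.
Variables (Q : 'rV[K]_n.+1) (XQ : point_of X Q).
Local Notation hv := (@has_value F K iota n X Q).
Local Notation reg := (@local_ring F K iota n X Q).
Local Notation val := (@valuation F K iota n X Q).

Definition unit_at f := exists2 v, hv f v & v != 0.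

Lemma unit_at_neq0 f : unit_at f -> f != 0.
Proof.
by move=> [v fv]; apply: contra_neq => f0; apply: has_value_uniq fv _;
  rewrite // f0; apply: has_value0.
Qed.

Lemma unit_atM f g : unit_at f -> unit_at g -> unit_at (f * g).
Proof.
by move=> [v fv v0] [w gw w0]; exists (v * w); [apply: has_valueM|apply: mulf_neq0].
Qed.

Lemma unit_atV f : unit_at f -> unit_at f^-1.
Proof. by move=> [v fv v0]; exists v^-1; [apply: has_valueV|rewrite invr_eq0]. Qed.

Lemma unit_at_reg f : unit_at f -> reg f.
Proof. by move=> [v fv _]; exists v. Qed.

Lemma unit_atP f : unit_at f <-> [/\ f != 0, reg f & reg f^-1].
Proof.
split=> [fU|[f0 [v fv] [w fw]]].
  by split; [apply: unit_at_neq0|apply: unit_at_reg|apply/unit_at_reg/unit_atV].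
exists v => //; apply: contra_neq (oner_neq0 K) => v0.
apply: (has_value_uniq XQ (has_value1 _ _)).
by rewrite -(divff f0) -(mul0r w) -v0; apply: has_valueM.
Qed.

Lemma uniformizer_neq0 t : uniformizer Q t -> t != 0.
Proof.
move=> [_ tm]; have [s [s0 _] sn] := exists_uniformizer dim1 smooth XQ.
apply: contra_neq sn => t0; have [g _ ->] := tm _ s0.
by rewrite t0 mulr0.
Qed.

Lemma uniformizer_associate s t : uniformizer Q s -> uniformizer Q t ->
  exists2 w, unit_at w & s = w * t.
Proof.
move=> sU tU; have s0 := uniformizer_neq0 sU.
have [w rw ew] := tU.2 _ sU.1; have [w' rw' ew'] := sU.2 _ tU.1.
exists w => //; apply/unit_atP.
have e : w * w' = 1 by apply: (mulIf s0); rewrite mul1r -mulrA -ew' -ew.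
have w0 : w != 0 by apply: contra_eq_neq e => ->; rewrite mul0r eq_sym oner_neq0.
by split=> //; suff -> : w^-1 = w' by []; apply: (mulfI w0); rewrite e divff.
Qed.

(** Induction on [k]: if [f] vanishes at [Q], a factor [t] is cancelled on both sides; for [k = 0]
    the product is a unit and [f] cannot vanish. *)
Lemma regular_power_factor t k f h w : uniformizer Q t -> reg f -> reg h ->
  unit_at w -> f * h = t ^+ k * w -> exists j, exists2 u, unit_at u & f = u * t ^+ j.
Proof.
move=> tU + rh [v wv v0]; elim: k f => [|k IH] f [a fa] e.
  have [b hb] := rh; exists 0%N, f; last by rewrite expr0 mulr1.
  exists a => //; apply: contra_neq v0 => a0.
  apply: (has_value_uniq XQ wv); rewrite -[w]mul1r -[1](expr0 t) -e.
  by rewrite -(mul0r b) -a0; apply: has_valueM.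
have [a0|a0] := eqVneq a 0; last by exists 0%N, f; [exists a|rewrite expr0 mulr1].
rewrite a0 in fa; have [g rg eg] := tU.2 _ fa.
have [|j [u uU eu]] := IH g rg.
  apply: (mulfI (uniformizer_neq0 tU)); rewrite mulrA [t * g]mulrC -eg e.
  by rewrite exprS mulrA.
by exists j.+1, u => //; rewrite eg eu exprSr mulrA.
Qed.

(** Some nonzero polynomial in [t] is a multiple of [f]. Splitting off the power of [t] leaves a
    polynomial in [t] with nonzero constant term, a unit at [Q]. *)
Lemma regular_factor t f : uniformizer Q t -> f != 0 -> reg f ->
  exists j, exists2 u, unit_at u & f = u * t ^+ j.
Proof.
move=> tU f0 rf; have Kt := has_value_KX XQ tU.1.
have [p p0 [h ep rh]] := divides_poly dim1 f0 (local_ring_KX XQ rf) Kt.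
have rt : reg t by exists 0; apply: tU.1.
have [k [q + eq]] := multiplicity_XsubC p 0; rewrite p0 => qn.
apply: (@regular_power_factor t k f h (map_poly cst q).[t]) => //.
- exact: rh.
- by exists q.[0] => //; apply: has_value_horner => //; apply: tU.1.
by rewrite -ep eq subr0 rmorphM rmorphXn /= map_polyX hornerM hornerXn mulrC.
Qed.

(** Numerator and denominator, divided by the power of ['X_j0] of the same degree, are regular at
    [Q], and each is a unit times a power of [t]. *)
Lemma exists_valuation f : KX f -> f != 0 -> exists k, has_valuation Q f k.
Proof.
have [t tU tn] := exists_uniformizer dim1 smooth XQ.
have /rV0Pn[j0 Qj0] := point_neq0 XQ.
move=> [d [p [q [hp hq qI ef]]]] f0.
pose L := cl ('X_j0 ^+ d).
have regL r : r \is d.-homog -> reg (cl r / L).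
  move=> hr; eexists; apply: (@has_value_form _ _ _ _ _ _ d) => //.
    exact: homog_varX.
  by rewrite rmorphXn /= mevalXU expf_neq0.
have L0 : L != 0.
  by rewrite form_class_eq0 (value_ideal XQ) // rmorphXn /= mevalXU expf_neq0.
have q0 : cl q != 0 by rewrite form_class_eq0.
have p0 : cl p != 0.
  by apply: contra_neq f0 => p0; rewrite ef form_ratioE p0 mul0r.
have [a [u uU eu]] := regular_factor tU (mulf_neq0 p0 (invr_neq0 L0)) (regL p hp).
have [b [w wU ew]] := regular_factor tU (mulf_neq0 q0 (invr_neq0 L0)) (regL q hq).
exists (a%:Z - b%:Z), (u / w), t; split.
- exact: mulf_neq0 (unit_at_neq0 uU) (invr_neq0 (unit_at_neq0 wU)).
- exact/unit_at_reg/unit_atM/unit_atV.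
- by rewrite invf_div; apply/unit_at_reg/unit_atM/unit_atV.
- exact: tU.
rewrite (expfzDr _ _ tn) -exprnN -exprnP mulf_div -eu -ew ef form_ratioE.
by rewrite invf_div mulrA (mulfVK L0).
Qed.

Lemma has_valuationP f k : has_valuation Q f k <->
  exists2 u, unit_at u & exists2 t, uniformizer Q t & f = u * t ^ k.
Proof.
split=> [[u [t [u0 ru ruV tU ->]]]|[u /unit_atP[u0 ru ruV] [t tU ->]]].
  by exists u; [apply/unit_atP|exists t].
by exists u, t; split.
Qed.

Lemma unit_exp_uniformizer t k : uniformizer Q t -> unit_at (t ^ k) -> k = 0.
Proof.
move=> tU.
have aux (j : nat) : unit_at (t ^+ j.+1) -> False.
  move=> [v tv /eqP[]]; apply: (has_value_uniq XQ tv).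
  have -> : 0 = 0 ^+ j.+1 :> K by rewrite expr0n.
  exact/has_valueX/tU.1.
case: k => [[|j]|j] //; first by move=> /aux.
by move=> /unit_atV; rewrite NegzE -exprnN invrK => /aux.
Qed.

Lemma unit_at_expz w k : unit_at w -> unit_at (w ^ k).
Proof.
move=> wU; have aux (j : nat) : unit_at (w ^+ j).
  elim: j => [|j IH]; first by exists 1; rewrite ?oner_eq0 // expr0; apply: has_value1.
  by rewrite exprS; apply: unit_atM.
by case: k => j; [apply: aux|apply/unit_atV/aux].
Qed.

Lemma has_valuation_uniformizer f k t : has_valuation Q f k -> uniformizer Q t ->
  exists2 u, unit_at u & f = u * t ^ k.
Proof.
move=> /has_valuationP[u uU [s sU ->]] tU.
have [w wU ->] := uniformizer_associate sU tU.
exists (u * w ^ k); first exact/unit_atM/unit_at_expz.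
by rewrite expfzMl mulrA.
Qed.

Lemma has_valuation_uniq f k l : has_valuation Q f k -> has_valuation Q f l -> k = l.
Proof.
have [t tU tn] := exists_uniformizer dim1 smooth XQ.
move=> /has_valuation_uniformizer/(_ tU)[u uU ->].
move=> /has_valuation_uniformizer/(_ tU)[w wU e].
apply/eqP; rewrite -subr_eq0; apply/eqP/(unit_exp_uniformizer tU).
suff -> : t ^ (k - l) = w / u by exact/unit_atM/unit_atV.
have u0 := unit_at_neq0 uU.
apply: (mulfI u0); rewrite [RHS]mulrC (mulfVK u0) (expfzDr _ _ tn) [LHS]mulrA e.
by rewrite -mulrA -(expfzDr _ _ tn) subrr expr0z mulr1.
Qed.

Lemma valuationE f k : has_valuation Q f k -> val f = k.
Proof.
move=> fk; rewrite /valuation; case: xgetP => [l _ /= fl|/(_ k)//].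
exact: has_valuation_uniq fl fk.
Qed.

Lemma valuation_factor f t : KX f -> f != 0 -> uniformizer Q t ->
  exists2 u, unit_at u & f = u * t ^ val f.
Proof.
move=> Kf f0 tU; have [k fk] := exists_valuation Kf f0.
by have := has_valuation_uniformizer fk tU; rewrite (valuationE fk).
Qed.

Lemma valuation_eq f t u k : uniformizer Q t -> unit_at u -> f = u * t ^ k -> val f = k.
Proof.
by move=> tU uU e; apply/valuationE/has_valuationP; exists u => //; exists t.
Qed.

Lemma valuationM f g : KX f -> KX g -> f != 0 -> g != 0 -> val (f * g) = val f + val g.
Proof.
move=> Kf Kg f0 g0; have [t tU tn] := exists_uniformizer dim1 smooth XQ.
have [u uU eu] := valuation_factor Kf f0 tU.
have [w wU ew] := valuation_factor Kg g0 tU.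
apply: (valuation_eq tU (unit_atM uU wU)).
by rewrite {1}eu {1}ew mulrACA -(expfzDr _ _ tn).
Qed.

Lemma valuation_unit f : unit_at f -> val f = 0.
Proof.
move=> fU; have [t tU tn] := exists_uniformizer dim1 smooth XQ.
by apply: (valuation_eq tU fU); rewrite expr0z mulr1.
Qed.

Lemma valuation_ge0 f : KX f -> f != 0 -> 0 <= val f <-> reg f.
Proof.
have [t tU tn] := exists_uniformizer dim1 smooth XQ.
have rt : reg t by exists 0; apply: tU.1.
move=> Kf f0; split=> [|rf].
  have [u uU {2}->] := valuation_factor Kf f0 tU.
  case: (val f) => // k _; apply: local_ringM; first exact: unit_at_reg.
  exact: local_ringX.
have [j [u uU e]] := regular_factor tU f0 rf.
by rewrite (valuation_eq (k := j%:Z) tU uU e).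
Qed.

Lemma valuation_gt0 f : hv f 0 -> f != 0 -> 0 < val f.
Proof.
move=> fv f0; have [t tU tn] := exists_uniformizer dim1 smooth XQ.
have [j [u uU e]] := regular_factor tU f0 (ex_intro _ 0 fv).
rewrite (valuation_eq (k := j%:Z) tU uU e); case: j e => // e.
have [v uv /eqP[]] := uU; apply: (has_value_uniq XQ uv).
by move: fv; rewrite e expr0 mulr1.
Qed.

Lemma valuationD f g : KX f -> KX g -> f != 0 -> g != 0 -> val f < val g ->
  f + g != 0 /\ val (f + g) = val f.
Proof.
move=> Kf Kg f0 g0 lt; have [t tU tn] := exists_uniformizer dim1 smooth XQ.
have [u uU eu] := valuation_factor Kf f0 tU.
have [w wU ew] := valuation_factor Kg g0 tU.
case ek : (val g - val f) => [k|k]; last by move: lt; rewrite -subr_gt0 ek.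
have k0 : (0 < k)%N by move: lt; rewrite -subr_gt0 ek.
have e : f + g = (u + w * t ^+ k) * t ^ val f.
  by rewrite mulrDl -eu -mulrA [t ^+ k]exprnP -(expfzDr _ _ tn) -ek subrK -ew.
have U : unit_at (u + w * t ^+ k).
  have [[v uv v0] [v' wv' _]] := (uU, wU); exists v => //.
  rewrite -[v]addr0; apply: has_valueD => //.
  have -> : 0 = v' * 0 ^+ k :> K by rewrite expr0n -(prednK k0) mulr0.
  exact/has_valueM/has_valueX/tU.1.
split; last exact: valuation_eq tU U e.
by rewrite e; apply: mulf_neq0 (unit_at_neq0 U) (expfz_neq0 _ tn).
Qed.

End AtPoint.
End Valuation.

(** * Zeros of forms *)

(** For nonempty [s], a root of \prod_(a in s) (X - a) + 1 is none of the a. *)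
Lemma closed_field_avoid (K : closedFieldType) (s : seq K) : exists c, c \notin s.
Proof.
pose p := \prod_(a <- s) ('X - a%:P) + (s != [::])%:R.
have [s0|sn] := eqVneq s [::]; first by exists 0; rewrite s0.
have : size p != 1%N.
  rewrite /p sn size_polyDl size_prod_XsubC ?eqSS ?size_eq0 //.
  by rewrite size_poly1 ltnS lt0n size_eq0.
move=> /closed_rootP[c /rootP]; rewrite /p sn hornerD hornerC => e.
exists c; apply: contraTN isT => cs; move: e.
rewrite (_ : (\prod_(a <- s) _).[c] = 0) ?add0r; first by move/eqP; rewrite oner_eq0.
by apply/rootP; rewrite root_prod_XsubC.
Qed.

(* A vector space over an infinite field is not a finite union of hyperplanes. *)
Lemma common_nonzero (K : closedFieldType) (V : Type) (T : eqType)
    (comb : K -> V -> V -> V) (W : set V) (e : T -> V -> K) (s : seq T) :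
  (exists v, W v) ->
  (forall c v w, W v -> W w -> W (comb c v w)) ->
  (forall i c v w, i \in s -> W v -> W w -> e i (comb c v w) = e i v + c * e i w) ->
  (forall i, i \in s -> exists2 v, W v & e i v != 0) ->
  exists2 v, W v & forall i, i \in s -> e i v != 0.
Proof.
move=> [v0 Wv0] combW; elim: s => [|i s IH] lin nz; first by exists v0.
have [|j js|v Wv vnz] := IH.
- by move=> j c v w js; apply: lin; rewrite inE js orbT.
- by apply: nz; rewrite inE js orbT.
have [iv|iv] := eqVneq (e i v) 0; last first.
  by exists v => // j; rewrite inE => /predU1P[->|/vnz].
have [w Ww iw] := nz i (mem_head _ _).
have [c cs] := closed_field_avoid [seq - e j w / e j v | j <- s].
exists (comb c w v) => [|j]; first exact: combW.
rewrite inE => /predU1P[->|js].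
  by rewrite lin ?mem_head // iv mulr0 addr0.
rewrite lin ?inE ?js ?orbT //; apply: contra cs => /eqP e0.
apply/mapP; exists j => //; apply: (mulIf (vnz j js)).
by rewrite mulfVK ?vnz //; apply/eqP; rewrite -addr_eq0 addrC e0.
Qed.

Lemma nonzero_solution (K : fieldType) (T S : finType) (C : T -> S -> K) :
  (#|S| < #|T|)%N ->
  exists2 c : T -> K, exists t, c t != 0 & forall s, \sum_t c t * C t s = 0.
Proof.
move=> lt; pose M := \matrix_(a < #|T|, b < #|S|) C (enum_val a) (enum_val b).
have : kermx M != 0.
  by rewrite -mxrank_eq0 mxrank_ker -lt0n subn_gt0 (leq_ltn_trans (rank_leq_col M)).
case/rowV0Pn => v /sub_kermxP vM /rV0Pn[a va].
exists (fun t => v 0 (enum_rank t)).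
  by exists (enum_val a); rewrite enum_valK.
move=> s; move/rowP/(_ (enum_rank s)): vM; rewrite !mxE => e.
rewrite -[RHS]e (reindex _ (onW_bij _ (enum_val_bij T))) /=.
by apply: eq_bigr => b _; rewrite mxE enum_valK enum_rankK.
Qed.

Section Zeros.
Variables (F : finFieldType) (K : closedFieldType) (iota : {rmorphism F -> K}).
Variables (n : nat) (X : variety iota n).
Local Notation I := (ideal_of X).
Local Notation KX := (@function_field_closure F K iota n X).
Local Notation cst := (@Defs.constant F K iota n X).
Local Notation cl := (form_class X).
Local Opaque form_class.
Implicit Types (f g h : coord_frac X) (Q R : 'rV[K]_n.+1).

Lemma exists_representatives (r : seq 'rV[K]_n.+1) :
  exists s, [/\ {subset s <= r}, pairwise (fun Q R => ~~ same_point Q R) s &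
    forall Q, Q \in r -> exists2 R, R \in s & same_point Q R].
Proof.
elim: r => [|Q r [s [sr ps cs]]]; first by exists [::].
have [/hasP[R Rs QR]|/hasPn nQ] := boolP (has (same_point Q) s).
  exists s; split=> // [R' /sr|R']; rewrite inE; first by move->; rewrite orbT.
  by case/predU1P => [->|/cs//]; exists R.
exists (Q :: s); split=> [R|/=|R].
- by rewrite !inE => /predU1P[->|/sr->]; rewrite ?eqxx ?orbT.
- by rewrite ps andbT; apply/allP.
rewrite inE => /predU1P[->|/cs[R' R's RR']].
  by exists Q; rewrite ?mem_head ?same_point_refl.
by exists R' => //; rewrite inE R's orbT.
Qed.

(** Distinct points have a nonzero 2 by 2 minor of coordinates; the form is that minor with the
    second point replaced by variables. *)
Lemma linear_form_separating Q R : Q != 0 -> R != 0 -> ~~ same_point Q R ->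
  exists2 p : {mpoly K[n.+1]}, p \is 1.-homog & p.@[Q 0] = 0 /\ p.@[R 0] != 0.
Proof.
move=> /rV0Pn[a Qa] R0 QR.
have [b Rb] : exists b, Q 0 a * R 0 b - Q 0 b * R 0 a != 0.
  apply/existsP; apply: contraNT QR; rewrite negb_exists => /forallP h.
  rewrite same_point_sym; apply/same_pointP => //.
  have e : R = (R 0 a / Q 0 a) *: Q.
    apply/rowP => b; have := h b; rewrite negbK subr_eq0 => /eqP eb.
    by apply: (mulfI Qa); rewrite eb !mxE [RHS]mulrA [Q 0 a * _]mulrC (mulfVK Qa) mulrC.
  exists (R 0 a / Q 0 a) => //; apply: contraNneq R0 => e0.
  by rewrite e e0 scale0r.
exists (Q 0 a *: 'X_b - Q 0 b *: 'X_a).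
  by rewrite rpredB // dhomogZ ?homog_var.
by rewrite !(mevalB, mevalZ, mevalXU) mulrC subrr.
Qed.

Lemma linear_form_avoiding (s : seq 'rV[K]_n.+1) :
  (forall Q, Q \in s -> Q != 0) ->
  exists2 p : {mpoly K[n.+1]}, p \is 1.-homog & forall Q, Q \in s -> p.@[Q 0] != 0.
Proof.
move=> s0; apply: (@common_nonzero _ _ _ (fun c p q => p + c *: q)
  [set p : {mpoly K[n.+1]} | p \is 1.-homog]%classic (fun Q p => p.@[Q 0])).
- by exists 0; apply: rpred0.
- by move=> c p q hp hq; rewrite /= rpredD ?dhomogZ.
- by move=> Q c p q _ _ _; rewrite mevalD mevalZ.
move=> Q /s0/rV0Pn[a Qa]; exists 'X_a; first exact: homog_var.
by rewrite mevalXU.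
Qed.

Hypothesis dim1 : has_dimension X 1.

(** With [f] the form divided by ['X_j ^+ d] and [g i] an affine coordinate, a nonzero polynomial in
    [g i] is a multiple of [f] on the chart. At a zero of the form each affine coordinate is a root
    of that polynomial, which leaves finitely many points. *)
Lemma finite_zeros_chart d (p : {mpoly K[n.+1]}) (j : 'I_n.+1) :
  p \is d.-homog -> p \notin I -> exists s : seq 'rV[K]_n.+1,
  forall Q, point_of X Q -> Q 0 j != 0 -> p.@[Q 0] = 0 -> (Q 0 j)^-1 *: Q \in s.
Proof.
move=> hp pI; have [jI|jI] := boolP ('X_j \in I).
  exists [::] => Q XQ; move: jI => /idealP/(_ Q XQ); rewrite mevalXU => ->.
  by rewrite eqxx.
pose f := form_ratio X p ('X_j ^+ d); pose g i := form_ratio X 'X_i 'X_j.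
have hj : ('X_j ^+ d : {mpoly K[n.+1]}) \is d.-homog by exact: homog_varX.
have c0 : cl 'X_j != 0 by rewrite form_class_eq0.
have f0 : f != 0.
  have p0 : cl p != 0 by rewrite form_class_eq0.
  by rewrite /f form_ratioE rmorphXn; apply: mulf_neq0 p0 (invr_neq0 (expf_neq0 d c0)).
have xI : ('X_j ^+ d : {mpoly K[n.+1]}) \notin I := idealX_notin d jI.
have Kf : KX f by apply: KX_form hp hj xI.
have Kg i : KX (g i) by apply: KX_form (homog_var K i) (homog_var K j) jI.
have /boolp.choice[r hr] : forall i, exists r : seq K, forall Q, point_of X Q ->
    Q 0 j != 0 -> p.@[Q 0] = 0 -> (Q 0 j)^-1 * Q 0 i \in r.
  move=> i; have [a a0 [h ea rh]] := divides_poly dim1 f0 Kf (Kg i).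
  have [r er] := closed_field_poly_normal a.
  exists r => Q XQ Qj pQ; rewrite mulrC -root_prod_XsubC.
  rewrite -(@rootZ _ _ (lead_coef a)) ?lead_coef_eq0 // -er.
  have fQ : has_value Q f 0.
    rewrite -(mul0r (('X_j ^+ d).@[Q 0])^-1) -pQ; apply: (@has_value_form _ _ _ _ _ _ d) => //.
    by rewrite rmorphXn /= mevalXU expf_neq0.
  have gQ : has_value Q (g i) (Q 0 i / Q 0 j).
    rewrite -{1}(mevalXU (Q 0) i) -(mevalXU (Q 0) j).
    by apply: (@has_value_form _ _ _ _ _ _ 1); rewrite ?homog_var ?mevalXU.
  apply/rootP; apply: (has_value_uniq XQ (has_value_horner a XQ gQ)).
  rewrite ea -(mul0r (eval_at Q h)); apply: (has_valueM fQ).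
  by apply: (local_ringP XQ); apply: rh XQ (ex_intro _ _ fQ) (ex_intro _ _ gQ).
pose T := flatten [seq r i | i <- enum 'I_n.+1].
pose v (a : {ffun 'I_n.+1 -> seq_sub T}) : 'rV[K]_n.+1 := \row_i val (a i).
exists (codom v) => Q XQ Qj pQ; apply/codomP.
have inT i : (Q 0 j)^-1 * Q 0 i \in T.
  by apply/flatten_mapP; exists i; rewrite ?mem_enum ?hr.
exists [ffun i => SeqSub (inT i)]; apply/rowP => i.
by rewrite !mxE ffunE.
Qed.

Lemma finite_zeros d (p : {mpoly K[n.+1]}) : p \is d.-homog -> p \notin I ->
  exists s : seq 'rV[K]_n.+1,
    [/\ forall Q, Q \in s -> point_of X Q /\ p.@[Q 0] = 0,
        pairwise (fun Q R => ~~ same_point Q R) s &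
        forall Q, point_of X Q -> p.@[Q 0] = 0 -> exists2 R, R \in s & same_point Q R].
Proof.
move=> hp pI.
have /boolp.choice[r hr] := fun j => finite_zeros_chart j hp pI.
pose s0 := [seq Q <- flatten [seq r j | j <- enum 'I_n.+1] |
  `[< point_of X Q /\ p.@[Q 0] = 0 >]].
have [s [ss0 ps cs]] := exists_representatives s0.
exists s; split=> // [Q /ss0|Q XQ pQ].
  by rewrite mem_filter => /andP[/asboolP].
have /rV0Pn[j Qj] := point_neq0 XQ.
pose Q' := (Q 0 j)^-1 *: Q.
have QQ' : same_point Q Q'.
  rewrite same_point_sym; apply/same_pointP; last by exists (Q 0 j)^-1; rewrite ?invr_eq0.
  by rewrite scaler_eq0 invr_eq0 negb_or Qj (point_neq0 XQ).
have XQ' : point_of X Q'.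
  split; first by rewrite scaler_eq0 invr_eq0 negb_or Qj (point_neq0 XQ).
  move=> e es; have [d' hd'] := eqns_homog X _ es.
  by rewrite (meval_scale _ _ (homog_map iota hd')) (XQ.2 _ es) mulr0.
have [|R Rs Q'R] := cs Q'.
  rewrite mem_filter; apply/andP; split.
    by apply/asboolP; split; rewrite ?(meval_scale _ _ hp) ?pQ ?mulr0.
  by apply/flatten_mapP; exists j; rewrite ?mem_enum // hr.
by exists R => //; apply: same_point_trans Q'R.
Qed.
End Zeros.

(** * Functions with a single pole *)

Section Jets.
Variables (F : finFieldType) (K : closedFieldType) (iota : {rmorphism F -> K}).
Variables (n : nat) (X : variety iota n).
Local Notation cst := (@Defs.constant F K iota n X).
Variables (Q : 'rV[K]_n.+1) (XQ : point_of X Q).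
Local Notation hv := (@has_value F K iota n X Q).
Local Notation reg := (@local_ring F K iota n X Q).
Implicit Types (f g h t u w : coord_frac X).

Lemma eval_at_comb c f g : reg f -> reg g ->
  eval_at Q (f + cst c * g) = eval_at Q f + c * eval_at Q g.
Proof.
move=> rf rg; apply: (eval_atE XQ); apply: (has_valueD XQ); first exact: local_ringP.
by apply: has_valueM (has_value_constant _ _ _) (local_ringP XQ rg).
Qed.

(** Evaluation at [Q] shows that the constant coefficient is 0; a factor [t] is then cancelled and
    the argument repeated. *)
Lemma powers_independent t e (c : 'I_e -> K) r : hv t 0 -> t != 0 -> reg r ->
  \sum_j cst (c j) * t ^+ j = t ^+ e * r -> forall j, c j = 0.
Proof.
move=> t0 tn rr; elim: e c => [|e IH] c; first by move=> _ [].
rewrite big_ord_recl mulr1.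
pose S := \sum_j cst (c (lift ord0 j)) * t ^+ j.
have -> : \sum_(i < e) cst (c (lift ord0 i)) * t ^+ lift ord0 i = t * S.
  by rewrite mulr_sumr; apply: eq_bigr => j _; rewrite mulrCA -exprS.
have rS : reg S.
  apply: (local_ring_sum XQ) => j _; apply: local_ringM; first exact: local_ring_constant.
  by apply: local_ringX; exists 0.
move=> e1; have c0 : c ord0 = 0.
  have [[a Sa] [b rb]] := (rS, rr).
  have := has_valueD XQ (has_value_constant _ _ (c ord0)) (has_valueM t0 Sa).
  rewrite e1 mul0r addr0 => h; apply: (has_value_uniq XQ h).
  have -> : 0 = 0 ^+ e.+1 * b :> K by rewrite expr0n mul0r.
  exact: has_valueM (has_valueX _ t0) rb.
move: e1; rewrite c0 rmorph0 add0r exprS -mulrA => /(mulfI tn)/IH h j.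
by case: (unliftP ord0 j) => [j' ->|->].
Qed.

(** The conditions say that the first [N] Taylor coefficients in [t] vanish. That of order 0 is the
    value at [Q]; the others are those of the quotients [g i] in u_i = u_i(Q) + g_i t. *)
Lemma vanishing_conditions t (T : finType) N (u : T -> coord_frac X) :
  uniformizer Q t -> (forall i, reg (u i)) ->
  exists C : T -> 'I_N -> K, forall c : T -> K,
    (forall b, \sum_i c i * C i b = 0) ->
    exists2 g, reg g & \sum_i cst (c i) * u i = t ^+ N * g.
Proof.
move=> tU; elim: N u => [|N IH] u ru.
  exists (fun _ _ => 0) => c _; exists (\sum_i cst (c i) * u i); last first.
    by rewrite expr0 mul1r.
  by apply: (local_ring_sum XQ) => i _; apply: local_ringM; first exact: local_ring_constant.
have /boolp.choice[g hg] : forall i, exists g, reg g /\ u i = cst (eval_at Q (u i)) + g * t.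
  move=> i; have hi : hv (u i - cst (eval_at Q (u i))) 0.
    rewrite -(subrr (eval_at Q (u i))).
    exact: has_valueB XQ _ _ _ _ (local_ringP XQ (ru i)) (has_value_constant _ _ _).
  by have [g rg eg] := tU.2 _ hi; exists g; rewrite -eg addrC subrK.
have [C hC] := IH g (fun i => (hg i).1).
exists (fun i b => if unlift ord0 b is Some b' then C i b' else eval_at Q (u i)) => c hc.
have [b|h rh eh] := hC c; first by have := hc (lift ord0 b); rewrite liftK.
exists h => //; have := hc ord0; rewrite unlift_none => h0.
under eq_bigr do rewrite (hg _).2 mulrDr -rmorphM.
rewrite big_split /= -rmorph_sum h0 rmorph0 add0r.
under eq_bigr do rewrite mulrA.
by rewrite -mulr_suml eh exprS mulrC mulrA.
Qed.
End Jets.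

Section Polar.
Variables (F : finFieldType) (K : closedFieldType) (iota : {rmorphism F -> K}).
Variables (n : nat) (X : variety iota n).
Local Notation I := (ideal_of X).
Local Notation KX := (@function_field_closure F K iota n X).
Local Notation cst := (@Defs.constant F K iota n X).
Local Notation cl := (form_class X).
Local Opaque form_class.
Implicit Types (f g h t u w : coord_frac X) (Q R : 'rV[K]_n.+1).
Variables (A : {mpoly K[n.+1]}) (hA : A \is 1.-homog) (AI : A \notin I).

(** The poles of such a function lie on [A = 0] and are bounded by [d] times that section. The
    number [d] tells which power of [A / L] turns them into poles on [L = 0]. *)
Definition polar d f := exists2 G, G \is d.-homog & f = cl G / cl A ^+ d.

Lemma homog_exp1 d : A ^+ d \is d.-homog.
Proof. by have := dhomogMn d hA; rewrite mul1n. Qed.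

Lemma clA_neq0 : cl A != 0. Proof. by rewrite form_class_eq0. Qed.

Lemma polarM d e f g : polar d f -> polar e g -> polar (d + e) (f * g).
Proof.
move=> [G hG ->] [H hH ->]; exists (G * H); first exact: dhomogM.
by rewrite mulf_div rmorphM exprD.
Qed.

Lemma polarW d e f : (d <= e)%N -> polar d f -> polar e f.
Proof.
move=> de [G hG ->]; exists (G * A ^+ (e - d)).
  by rewrite -{2}(subnKC de) dhomogM ?homog_exp1.
rewrite -{2}(subnKC de) exprD rmorphM rmorphXn -mulf_div divff ?mulr1 //.
exact/expf_neq0/clA_neq0.
Qed.

Lemma polar1 : polar 0 1.
Proof. by exists 1; rewrite ?dhomog1 // rmorph1 expr0 divr1. Qed.

Lemma polarX d f k : polar d f -> exists e, polar e (f ^+ k).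
Proof.
move=> df; elim: k => [|k [e IH]]; first by exists 0%N; rewrite expr0; apply: polar1.
by exists (d + e)%N; rewrite exprS; apply: polarM.
Qed.

Lemma polar_prod (J : Type) (r : seq J) (P : pred J) (u : J -> coord_frac X) :
  (forall i, exists d, polar d (u i)) -> exists d, polar d (\prod_(i <- r | P i) u i).
Proof.
move=> ud; elim/big_ind: _ => [|f g [d df] [e eg]|i _]; last exact: ud.
  by exists 0%N; apply: polar1.
by exists (d + e)%N; apply: polarM.
Qed.

Lemma polar_uniform (T : finType) (u : T -> coord_frac X) :
  (forall i, exists d, polar d (u i)) -> exists d, forall i, polar d (u i).
Proof.
move=> /boolp.choice[d du]; exists (\sum_i d i)%N => i; apply: polarW (du i).
by rewrite (bigD1 i) //= leq_addr.
Qed.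

Lemma polar_reg d f R : point_of X R -> A.@[R 0] != 0 -> polar d f -> local_ring R f.
Proof.
move=> XR AR [G hG ->]; rewrite -rmorphXn; eexists.
apply: (@has_value_form _ _ _ _ _ _ d) => //; first exact: homog_exp1.
by rewrite rmorphXn expf_neq0.
Qed.

Lemma polar_reg_off d f L R : L \is 1.-homog -> point_of X R -> L.@[R 0] != 0 ->
  polar d f -> local_ring R (f * (cl A / cl L) ^+ d).
Proof.
move=> hL XR LR [G hG ->].
rewrite expr_div_n mulrA mulfVK ?expf_neq0 ?clA_neq0 // -rmorphXn; eexists.
apply: (@has_value_form _ _ _ _ _ _ d) => //.
  by have := dhomogMn d hL; rewrite mul1n.
by rewrite rmorphXn expf_neq0.
Qed.

Hypotheses (dim1 : has_dimension X 1) (smooth : nonsingular X).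

(** A generic element of [W] will do, since each requirement excludes only a hyperplane. At [Q] the
    requirement is that the quotient by a known uniformizer [t0] does not vanish there; at another
    [Z j] it is a nonzero value. *)
Lemma uniformizer_avoiding m (Z : 'I_m -> 'rV[K]_n.+1) (i : 'I_m) :
  (forall j, point_of X (Z j)) -> (forall j, A.@[Z j 0] != 0) ->
  (forall j l, j != l -> ~~ same_point (Z j) (Z l)) ->
  exists t, [/\ uniformizer (Z i) t, forall j, j != i -> unit_at (Z j) t &
                exists d, polar d t].
Proof.
move=> XZ AZ dist; set Q := Z i; have XQ : point_of X Q by apply: XZ.
have [t0 t0U tn] := exists_uniformizer dim1 smooth XQ.
have [d [a [b [ha hb bQ et /esym/eqP]]]] := t0U.1.
rewrite mulf_eq0 invr_eq0 (negPf bQ) orbF => /eqP aQ.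
have a0 : cl a != 0.
  by apply: contra_neq tn => e; rewrite et form_ratioE e mul0r.
have b0 : cl b != 0 by rewrite form_class_eq0 (value_ideal XQ).
pose W : set (coord_frac X) := [set f | exists G,
  [/\ G \is d.+1.-homog, G.@[Q 0] = 0 & f = cl G / cl A ^+ d.+1]]%classic.
pose e j f := if j == i then eval_at Q (f / t0) else eval_at (Z j) f.
have WV f : W f -> has_value Q f 0.
  move=> [G [hG GQ ->]]; rewrite -rmorphXn.
  rewrite -(mul0r (((A ^+ d.+1).@[Q 0])^-1)) -GQ.
  apply: (@has_value_form _ _ _ _ _ _ d.+1) => //; first exact: homog_exp1.
  by rewrite rmorphXn expf_neq0 // AZ.
have Wt f : W f -> local_ring Q (f / t0).
  by move=> /WV/t0U.2[g rg ->]; rewrite (mulfK tn).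
have Wreg j f : W f -> local_ring (Z j) f.
  by move=> [G [hG _ ef]]; apply: (polar_reg (d := d.+1)) => //; exists G.
have [||||t Wt' tnz] := @common_nonzero K (coord_frac X) _ (fun c f g => f + cst c * g)
    W e (enum 'I_m).
- by exists 0, 0; split; rewrite ?rpred0 ?meval0 // rmorph0 mul0r.
- move=> c f g [G [hG GQ ->]] [H [hH HQ ->]]; exists (G + c *: H); split.
  + by rewrite rpredD ?dhomogZ.
  + by rewrite mevalD mevalZ GQ HQ mulr0 addr0.
  + by rewrite constantE mulrA -rmorphM mul_mpolyC rmorphD mulrDl.
- move=> j c f g _ Wf Wg; rewrite /e; case: ifP => _; last first.
    by apply: eval_at_comb => //; apply: Wreg.
  by rewrite mulrDl -mulrA; apply: eval_at_comb => //; apply: Wt.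
(* [a] is the numerator of [t0 = a / b], so [a / A ^+ d] divided by [t0] is [b / A ^+ d], nonzero at
   [Q]. For another point, a linear form [c] that vanishes at [Q] but not at [Z j] gives [c / A].
   The exponent [d.+1] in [W] leaves room for both. *)
- move=> j _; have [->|ji] := eqVneq j i.
    exists (cl (a * A) / cl A ^+ d.+1).
      exists (a * A); split; rewrite ?mevalM ?aQ ?mul0r //.
      by rewrite -(addn1 d) dhomogM.
    rewrite /e eqxx.
    have -> : cl (a * A) / cl A ^+ d.+1 / t0 = form_ratio X b (A ^+ d).
      rewrite et !form_ratioE rmorphM rmorphXn exprSr invf_div -mulf_div.
      by rewrite (divff clA_neq0) mulr1 mulrC mulrA (mulfVK a0).
    have AdQ : (A ^+ d).@[Q 0] != 0 by rewrite rmorphXn; apply/expf_neq0/AZ.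
    rewrite (eval_atE XQ (has_value_form X hb (homog_exp1 d) AdQ)).
    exact: mulf_neq0 bQ (invr_neq0 AdQ).
  have ij : i != j by rewrite eq_sym.
  have [c hc [cQ cZ]] := linear_form_separating (point_neq0 XQ)
    (point_neq0 (XZ j)) (dist i j ij).
  exists (cl (c * A ^+ d) / cl A ^+ d.+1).
    exists (c * A ^+ d); split; rewrite ?mevalM ?cQ ?mul0r //.
    by rewrite -(add1n d) dhomogM ?homog_exp1.
  rewrite /e (negPf ji).
  have -> : cl (c * A ^+ d) / cl A ^+ d.+1 = form_ratio X c A.
    rewrite rmorphM rmorphXn form_ratioE exprS -mulf_div.
    by rewrite (divff (expf_neq0 d clA_neq0)) mulr1.
  rewrite (eval_atE (XZ j) (has_value_form X hc hA (AZ j))).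
  exact: mulf_neq0 cZ (invr_neq0 (AZ j)).
have tz j : e j t != 0 by apply: tnz; rewrite mem_enum.
exists t; split; last 1 first.
- by case: Wt' => G [hG _ et']; exists d.+1, G.
- have := tz i; rewrite /e eqxx => tti.
  have wU : unit_at Q (t / t0) by eexists; [apply: (local_ringP XQ (Wt _ Wt'))|].
  have tn' : t != 0.
    by apply: contra_neq (unit_at_neq0 XQ wU) => ->; rewrite mul0r.
  have tE : t0 = (t / t0)^-1 * t by rewrite invf_div (mulfVK tn').
  split=> [|f /t0U.2[g rg ->]]; first exact: WV.
  exists (g * (t / t0)^-1); last by rewrite {1}tE mulrA.
  exact/local_ringM/unit_at_reg/unit_atV.
move=> j ji; have := tz j; rewrite /e (negPf ji) => tj.
by eexists; [apply: (local_ringP (XZ j) (Wreg j _ Wt'))|].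
Qed.
End Polar.

(** * A function with a zero at [Q] and poles at most at [P] *)

Section PoleFunction.
Variables (F : finFieldType) (K : closedFieldType) (iota : {rmorphism F -> K}).
Variables (n : nat) (X : variety iota n).
Local Notation I := (ideal_of X).
Local Notation KX := (@function_field_closure F K iota n X).
Local Notation cst := (@Defs.constant F K iota n X).
Local Notation cl := (form_class X).
Local Opaque form_class.
Implicit Types (f g h u w : coord_frac X) (Q R : 'rV[K]_n.+1).
Hypotheses (dim1 : has_dimension X 1) (smooth : nonsingular X).

(** [P] stands at index 0, followed by one vector for each other zero of [L], so that the pole to be
    kept and the poles to be removed are told apart by the index. *)
Lemma hyperplane_section P Q : point_of X P -> point_of X Q -> ~~ same_point P Q ->
  exists k (Z : 'I_k.+1 -> 'rV[K]_n.+1) (L A : {mpoly K[n.+1]}),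
    [/\ L \is 1.-homog /\ A \is 1.-homog, Z ord0 = P /\ L.@[Q 0] != 0,
        forall i, [/\ point_of X (Z i), L.@[Z i 0] = 0 & A.@[Z i 0] != 0],
        forall i j, i != j -> ~~ same_point (Z i) (Z j) &
        forall R, point_of X R -> L.@[R 0] = 0 -> exists i, same_point R (Z i)].
Proof.
move=> XP XQ PQ.
have [L hL [LP LQ]] := linear_form_separating (point_neq0 XP) (point_neq0 XQ) PQ.
have [s [sX ps cs]] := finite_zeros dim1 hL (value_ideal XQ LQ).
pose s1 := [seq R <- s | ~~ same_point P R].
have [|A hA As] := @linear_form_avoiding K n (P :: s1).
  move=> R; rewrite inE => /predU1P[->|]; first exact: point_neq0 XP.
  by rewrite mem_filter => /andP[_ /sX[/point_neq0]].
have Zin (i : 'I_(size s1).+1) : nth P (P :: s1) i \in P :: s1 by apply: mem_nth.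
have ps1 : pairwise (fun Q R => ~~ same_point Q R) (P :: s1).
  rewrite /= pairwise_filter // andbT; apply/allP => R.
  by rewrite mem_filter => /andP[].
exists (size s1), (fun i => nth P (P :: s1) i), L, A; split=> //.
- move=> i; split; last exact: As.
    have := Zin i; rewrite inE => /predU1P[->//|].
    by rewrite mem_filter => /andP[_ /sX[]].
  have := Zin i; rewrite inE => /predU1P[->//|].
  by rewrite mem_filter => /andP[_ /sX[]].
- move=> i j; rewrite neq_ltn => /orP[] ij; last rewrite same_point_sym.
    by move/(pairwiseP P): ps1 => h; apply: (h i j) => //; apply: ltn_ord.
  by move/(pairwiseP P): ps1 => h; apply: (h j i) => //; apply: ltn_ord.
move=> R XR LR; have [R' R's RR'] := cs R XR LR.
have [PR|PR] := boolP (same_point P R').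
  by exists ord0; apply: same_point_trans RR' _; rewrite same_point_sym.
have R'1 : R' \in P :: s1 by rewrite inE mem_filter PR R's orbT.
have lt := R'1; rewrite -index_mem in lt.
by exists (Ordinal lt); rewrite /= nth_index.
Qed.

Section Count.
Variables (k : nat) (Z : 'I_k.+1 -> 'rV[K]_n.+1) (L A : {mpoly K[n.+1]}).
Hypotheses (hL : L \is 1.-homog) (hA : A \is 1.-homog).
Hypotheses (XZ : forall i, point_of X (Z i)) (LZ : forall i, L.@[Z i 0] = 0).
Hypotheses (AZ : forall i, A.@[Z i 0] != 0).
Hypothesis Zall : forall R, point_of X R -> L.@[R 0] = 0 -> exists i, same_point R (Z i).
Hypothesis LI : L \notin I.

Let y : coord_frac X := cl L / cl A.
Let AI : A \notin I := value_ideal (XZ ord0) (AZ ord0).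
Let L0 : cl L != 0. Proof. by rewrite form_class_eq0. Qed.
Let y0 : y != 0. Proof. exact: mulf_neq0 L0 (invr_neq0 (clA_neq0 AI)). Qed.
Let yV : y^-1 = cl A / cl L. Proof. by rewrite invf_div. Qed.

Let y_value i : has_value (Z i) y 0.
Proof. by rewrite -(mul0r (A.@[Z i 0])^-1) -(LZ i); apply: (has_value_form X hL hA (AZ i)). Qed.

Let Ky : KX y := has_value_KX (XZ ord0) (y_value ord0).

Let e i : nat := `|valuation (Z i) y|%N.

Let e_gt0 i : (0 < e i)%N.
Proof.
by rewrite absz_gt0 gt_eqF // (valuation_gt0 dim1 smooth (XZ i) (y_value i) y0).
Qed.

Let y_factor i t : uniformizer (Z i) t ->
  exists2 w, unit_at (Z i) w & y = w * t ^+ e i.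
Proof.
move=> tU; have [w wU ey] := valuation_factor dim1 smooth (XZ i) Ky y0 tU.
exists w => //; rewrite {1}ey exprnP /e gez0_abs //.
exact/ltW/(valuation_gt0 dim1 smooth (XZ i) (y_value i) y0).
Qed.

Section SinglePole.
Variable t : 'I_k.+1 -> coord_frac X.
Hypotheses (tU : forall i, uniformizer (Z i) (t i)).
Hypotheses (tN : forall i j, j != i -> unit_at (Z j) (t i)).
Hypotheses (tP : forall i, exists d, polar A d (t i)).

(** As in the Chinese remainder theorem, [cofac i] is a unit at [Z i] and vanishes at each other
    [Z l] to the order [e l] of [y] there. This makes the functions [g], [e i] of them for each [i],
    independent modulo [y]. *)
Let cofac i := \prod_(l | l != i) t l ^+ e l.
Let g (s : {i : 'I_k.+1 & 'I_(e i)}) := t (tag s) ^+ tagged s * cofac (tag s).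

Lemma cofac_unit i : unit_at (Z i) (cofac i).
Proof.
rewrite /cofac; elim/big_ind: _ => [|f h fU hU|l li].
- by exists 1; [apply: has_value1|apply: oner_neq0].
- exact: unit_atM.
- by rewrite exprnP; apply/unit_at_expz/tN; rewrite eq_sym.
Qed.

Lemma parameter_reg i l : local_ring (Z i) (t l).
Proof.
have [->|il] := eqVneq i l; first by exists 0; apply: (tU l).1.
exact/unit_at_reg/tN.
Qed.

Lemma cofac_reg i l : local_ring (Z i) (cofac l).
Proof. by apply: local_ring_prod => j _; apply/local_ringX/parameter_reg. Qed.

Lemma g_reg i s : local_ring (Z i) (g s).
Proof. exact/local_ringM/cofac_reg/local_ringX/parameter_reg. Qed.

Lemma g_polar s : exists d, polar A d (g s).
Proof.
have aux (l : 'I_k.+1) j : exists d, polar A d (t l ^+ j).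
  by have [d td] := tP l; apply: (polarX _ td).
have [d1 h1] := aux (tag s) (tagged s).
have [d2 h2] : exists d, polar A d (cofac (tag s)) by apply: polar_prod => l; apply: aux.
by exists (d1 + d2)%N; apply: polarM.
Qed.

(** At [Z i] the terms of the other points contain [t i ^+ e i] through their cofactors, and so does
    [y]. What remains is the unit [cofac i] times a polynomial in [t i] of degree below [e i],
    divisible by [t i ^+ e i]. *)
Lemma g_independent (c : {i : 'I_k.+1 & 'I_(e i)} -> K) r :
  (forall i, local_ring (Z i) r) -> \sum_s cst (c s) * g s = y * r ->
  forall s, c s = 0.
Proof.
move=> rr E [i j]; have [w wU ey] := y_factor (tU i).
pose S := \sum_(j < e i) cst (c (Tagged _ j)) * t i ^+ j.
have [r' rr' er'] : exists2 r', local_ring (Z i) r' &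
    \sum_s cst (c s) * g s = S * cofac i + t i ^+ e i * r'.
  pose h l (j : 'I_(e l)) := cst (c (Tagged _ j)) * g (Tagged _ j).
  exists (\sum_(l | l != i) \sum_(j < e l) cst (c (Tagged _ j)) *
      (t l ^+ j * \prod_(l' | (l' != l) && (l' != i)) t l' ^+ e l')).
    apply: (local_ring_sum (XZ i)) => l li; apply: (local_ring_sum (XZ i)) => a _.
    apply: local_ringM; first exact: local_ring_constant.
    apply: local_ringM; first exact/local_ringX/parameter_reg.
    by apply: local_ring_prod => l' _; apply/local_ringX/parameter_reg.
  transitivity (\sum_l \sum_(a < e l) h l a).
    rewrite sig_big_dep /=; apply: eq_bigr => -[l a] _ //.
  rewrite (bigD1 i) //=; congr (_ + _).
    by rewrite mulr_suml; apply: eq_bigr => a _; rewrite /h /g /= mulrA.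
  rewrite mulr_sumr; apply: eq_bigr => l li; rewrite mulr_sumr; apply: eq_bigr => a _.
  rewrite /h /g /= /cofac (bigD1 i) 1?eq_sym //=.
  by rewrite [RHS]mulrCA; congr (_ * _); rewrite mulrCA.
have bU := cofac_unit i.
have b0 := unit_at_neq0 (XZ i) bU.
have tn := uniformizer_neq0 dim1 smooth (XZ i) (tU i).
have rr2 : local_ring (Z i) ((w * r - r') * (cofac i)^-1).
  apply: local_ringM; last exact/unit_at_reg/unit_atV.
  by apply: (local_ringB (XZ i)) => //; apply: local_ringM => //; apply: unit_at_reg.
apply: (powers_independent (XZ i) (c := fun j => c (Tagged _ j)) (tU i).1 tn rr2).
rewrite -/S; apply: (mulIf b0); rewrite -[RHS]mulrA (mulfVK b0) mulrBr.
by rewrite [_ * (w * r)]mulrA [t i ^+ _ * w]mulrC -ey -E er' addrK.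
Qed.

Lemma card_sigma_ord (J : finType) (d : J -> nat) : #|{: {i : J & 'I_(d i)}}| = (\sum_i d i)%N.
Proof.
rewrite card_tagged sumnE big_map big_enum /=.
by apply: eq_bigr => i _; rewrite card_ord.
Qed.

(* The functions [y ^+ (l - N) * g s] span a space of dimension [m * sum_i e i];
   regularity away from [P = Z 0] and vanishing at [Q] impose fewer conditions. *)
Lemma pole_function Q : point_of X Q -> L.@[Q 0] != 0 ->
  exists z : coord_frac X, [/\ z != 0, has_value Q z 0 &
    forall R, point_of X R -> ~~ same_point R (Z ord0) -> local_ring R z].
Proof.
move=> XQ LQ.
have [D gD] := polar_uniform hA AI g_polar.
(* There are [m * (e ord0 + E0)] unknowns and [(D + m) * E0 + 1] conditions, the extra one at [Q].
   As [e ord0] is at least 1, it is enough that [m] exceeds [D * E0 + 1]. *)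
pose E0 := (\sum_(i < k) e (lift ord0 i))%N; pose m := (D * E0).+2.
pose N := (D + m)%N.
pose phi (s : {i : 'I_k.+1 & 'I_(e i)} * 'I_m) := y^-1 ^+ N * y ^+ s.2 * g s.1.
have phi_off R s : point_of X R -> L.@[R 0] != 0 -> local_ring R (phi s).
  move=> XR LR.
  (* [y^-1 ^+ D] trades the poles of [g] on [A = 0] for poles on [L = 0], and the remaining power of
     [y^-1 = A / L] is regular off [L = 0]. This is why [N] is [D + m]. *)
  have -> : phi s = g s.1 * y^-1 ^+ D * y^-1 ^+ (m - s.2).
    rewrite /phi /N -{1}(subnK (ltnW (ltn_ord s.2))) addnA !exprD.
    by rewrite -[_ * _ * y ^+ _]mulrA -exprMn (mulVf y0) expr1n mulr1 mulrC mulrA.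
  apply: local_ringM; first by rewrite yV; apply: (polar_reg_off AI hL XR LR (gD _)).
  by apply: local_ringX; rewrite yV; eexists; apply: (has_value_form X hA hL LR).
(* The pole of [phi] at a zero of [L] has order at most [N] times the multiplicity, so this many
   conditions remove it. The index [lift ord0 i] spares the pole at [P]. *)
pose M i := (N * e (lift ord0 i))%N.
have cond (i : 'I_k) := vanishing_conditions (XZ (lift ord0 i)) (M i)
  (u := fun s => t (lift ord0 i) ^+ M i * phi s) (tU _).
have reg_u i s : local_ring (Z (lift ord0 i)) (t (lift ord0 i) ^+ M i * phi s).
  have [w wU ey] := y_factor (tU (lift ord0 i)).
  have w0 := unit_at_neq0 (XZ _) wU.
  have -> : t (lift ord0 i) ^+ M i * phi s = w^-1 ^+ N * (y ^+ s.2 * g s.1).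
    have -> : t (lift ord0 i) ^+ M i = w^-1 ^+ N * y ^+ N.
      by rewrite -exprMn {1}ey mulrA (mulVf w0) mul1r -exprM mulnC.
    by rewrite /phi -!mulrA; congr (_ * _); rewrite [LHS]mulrA -exprMn (divff y0) expr1n mul1r.
  apply: local_ringM; first exact/local_ringX/unit_at_reg/unit_atV.
  apply: local_ringM; last exact: g_reg.
  by apply: local_ringX; eexists; apply: y_value.
pose C i := sval (cid (cond i (reg_u i))).
have CP i := svalP (cid (cond i (reg_u i))).
pose Cf s (b : option {i : 'I_k & 'I_(M i)}) :=
  if b is Some p then C (tag p) s (tagged p) else eval_at Q (phi s).
have [|c [s0 cs0] hc] := nonzero_solution Cf.
  rewrite card_option card_prod !card_sigma_ord card_ord big_ord_recl -/E0 /M -big_distrr /=.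
  rewrite -/E0 mulnDl; have := e_gt0 ord0; rewrite /N /m; nia.
pose z := \sum_s cst (c s) * phi s.
exists z; split.
- apply: contra_neq cs0 => z0.
  pose H (l : 'I_m) := \sum_s cst (c (s, l)) * g s.
  have H0 : \sum_(l < m) y ^+ l * H l = 0.
    apply: (mulfI (expf_neq0 N (invr_neq0 y0))); rewrite mulr0 -[RHS]z0 /z.
    rewrite mulr_sumr [RHS](eq_bigr (fun p => cst (c (p.1, p.2)) * phi (p.1, p.2))); last by case.
    rewrite -(pair_bigA _ (fun s l => cst (c (s, l)) * phi (s, l))) /=.
    rewrite [RHS]exchange_big; apply: eq_bigr => l _; rewrite /H !mulr_sumr.
    by apply: eq_bigr => s _; rewrite /phi /= [LHS]mulrA [LHS]mulrCA.
  have H_reg i l : local_ring (Z i) (H l).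
    apply: (local_ring_sum (XZ i)) => s _; apply: local_ringM; last exact: g_reg.
    exact: local_ring_constant.
  have y_reg i : local_ring (Z i) y by eexists; apply: y_value.
  (* Lowest power first: once the coefficients of index below [l] vanish, cancelling [y ^+ l] leaves
     [H l] equal to [y] times a function regular at all [Z i]. *)
  suff c0 l (lm : (l < m)%N) : forall s, c (s, Ordinal lm) = 0.
    by case: s0 => s [l lm]; apply: c0.
  elim/ltn_ind: l lm => l IH lm.
  pose r := \sum_(j < m | j != Ordinal lm)
    (if (l < j)%N then y ^+ (j - l.+1) * H j else 0).
  have r_reg i : local_ring (Z i) r.
    apply: (local_ring_sum (XZ i)) => j _; case: ifP => _; last exact: local_ring0.
    by apply: local_ringM => //; apply: local_ringX.
  apply: (@g_independent _ (- r)) => [i|]; first exact/local_ringN.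
  rewrite -/(H (Ordinal lm)) mulrN; apply/eqP; rewrite -addr_eq0; apply/eqP.
  apply: (mulfI (expf_neq0 l y0)); rewrite mulr0 -[RHS]H0 (bigD1 (Ordinal lm)) //=.
  rewrite mulrDr; congr (_ + _); rewrite mulrA -exprSr mulr_sumr.
  apply: eq_bigr => j jl; case: ifP => lj.
    by rewrite mulrA -exprD subnKC.
  rewrite mulr0; have jl' : (j < l)%N.
    by rewrite ltn_neqAle leqNgt lj andbT.
  rewrite /H big1 ?mulr0 // => s _; case: j {jl lj} jl' => j jm jl' /=.
  by rewrite IH // rmorph0 mul0r.
- have := hc None; rewrite /Cf => <-.
  apply: has_value_sum => // s _; apply: has_valueM; first exact: has_value_constant.
  exact/local_ringP/phi_off.
move=> R XR RP; have [LR|LR] := eqVneq L.@[R 0] 0; last first.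
  by apply: (local_ring_sum XR) => s _; apply: local_ringM;
    [apply: local_ring_constant|apply: phi_off].
have [i Ri] := Zall XR LR.
have [i0 ei|ei] := unliftP ord0 i; last by rewrite ei in Ri; rewrite Ri in RP.
have [|f [a fa] ef] := CP i0 c.
  by move=> b; apply: (hc (Some (Tagged _ b))).
have tn := uniformizer_neq0 dim1 smooth (XZ _) (tU (lift ord0 i0)).
have -> : z = f.
  apply: (mulfI (expf_neq0 (M i0) tn)); rewrite -ef mulr_sumr.
  by apply: eq_bigr => s _; rewrite mulrCA.
exists a; apply: same_point_value fa; first exact: XZ.
by rewrite same_point_sym -ei.
Qed.

End SinglePole.
End Count.

Lemma exists_pole_function P Q : point_of X P -> point_of X Q -> ~~ same_point P Q ->
  exists z : coord_frac X, [/\ z != 0, has_value Q z 0 &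
    forall R, point_of X R -> ~~ same_point R P -> local_ring R z].
Proof.
move=> XP XQ PQ.
have [k [Z [L [A [[hL hA] [<- LQ] ZP Zd Za]]]]] := hyperplane_section XP XQ PQ.
have XZ i : point_of X (Z i) by case: (ZP i).
have LZ i : L.@[Z i 0] = 0 by case: (ZP i).
have AZ i : A.@[Z i 0] != 0 by case: (ZP i).
have AI := value_ideal (XZ ord0) (AZ ord0).
have /boolp.choice[t ht] := fun i => uniformizer_avoiding hA AI dim1 smooth i XZ AZ Zd.
have tU i : uniformizer (Z i) (t i) by case: (ht i).
have tN i j : j != i -> unit_at (Z j) (t i) by case: (ht i) => _ h _; apply: h.
have tP i : exists d, polar A d (t i) by case: (ht i).
exact: (pole_function hL hA XZ LZ AZ Za (value_ideal XQ LQ) tU tN tP XQ LQ).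
Qed.
End PoleFunction.

(** * Functions that separate points *)

Section Separation.
Variables (F : finFieldType) (K : closedFieldType) (iota : {rmorphism F -> K}).
Variables (n : nat) (X : variety iota n).
Local Notation I := (ideal_of X).
Local Notation KX := (@function_field_closure F K iota n X).
Local Notation cst := (@Defs.constant F K iota n X).
Local Notation cl := (form_class X).
Local Opaque form_class.
Implicit Types (f g h u w z : coord_frac X) (P Q R S : 'rV[K]_n.+1).
Hypotheses (dim1 : has_dimension X 1) (smooth : nonsingular X).

Lemma form_value_same_point d (p : {mpoly K[n.+1]}) Q R : Q != 0 -> p \is d.-homog ->
  same_point Q R -> (p.@[Q 0] == 0) = (p.@[R 0] == 0).
Proof.
move=> Q0 hp /(same_pointP _ Q0)[c c0 ->].
by rewrite (meval_scale _ _ hp) mulf_eq0 expf_eq0 (negPf c0) andbF.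
Qed.

Lemma function_zeros f : KX f -> f != 0 -> exists s : seq 'rV[K]_n.+1,
  (forall Q, Q \in s -> point_of X Q) /\
  forall Q, point_of X Q -> has_value Q f 0 -> exists2 R, R \in s & same_point Q R.
Proof.
move=> [d [p [q [hp hq qI ->]]]] f0.
have pI : p \notin I.
  rewrite -form_class_eq0; apply: contra_neq f0 => p0.
  by rewrite form_ratioE p0 mul0r.
have [s [sX _ cs]] := finite_zeros dim1 hp pI.
exists s; split=> [Q /sX[]//|Q XQ]; move=> [d' [p' [q' [hp' hq' q'Q /eqP e /esym/eqP]]]].
rewrite mulf_eq0 invr_eq0 (negPf q'Q) orbF => /eqP p'Q.
apply: cs => //; move: e; rewrite (form_ratio_eq _ _ qI (value_ideal XQ q'Q)).
move=> /idealP/(_ Q XQ)/eqP; rewrite mevalB !mevalM p'Q mul0r subr0.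
by rewrite mulf_eq0 (negPf q'Q) orbF => /eqP.
Qed.

Lemma pole_cancellation Q f h : point_of X Q -> KX f -> f != 0 -> has_value Q h 0 ->
  exists N, local_ring Q (h ^+ N * f).
Proof.
move=> XQ Kf f0 h0; have [t tU tn] := exists_uniformizer dim1 smooth XQ.
have [u uU ef] := valuation_factor dim1 smooth XQ Kf f0 tU.
have [g rg ->] := tU.2 _ h0.
have rt : local_ring Q t by exists 0; apply: tU.1.
have [m em] : exists m, t ^+ `|valuation Q f|%N * t ^ valuation Q f = t ^+ m.
  case: (valuation Q f) => k /=.
    by exists (k + k)%N; rewrite exprD exprnP.
  exists 0%N; rewrite NegzE -exprnN expr0.
  exact: divff (expf_neq0 _ tn).
exists `|valuation Q f|%N; rewrite {2}ef exprMn mulrACA em.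
apply: local_ringM; last exact: local_ringX.
by apply: local_ringM; [apply: local_ringX|apply: unit_at_reg].
Qed.

Lemma exists_separating_function P Q R :
  point_of X P -> point_of X Q -> point_of X R ->
  ~~ same_point Q P -> ~~ same_point R P -> ~~ same_point Q R ->
  exists h : coord_frac X, [/\ has_value Q h 0, unit_at R h &
    forall S, point_of X S -> ~~ same_point S P -> local_ring S h].
Proof.
move=> XP XQ XR QP RP QR.
have PQ : ~~ same_point P Q by rewrite same_point_sym.
have [z [z0 zQ zreg]] := exists_pole_function dim1 smooth XP XQ PQ.
have Kz := has_value_KX XQ zQ.
pose tau S := z - cst (eval_at S z).
(* A constant [z] would equal its value at [Q], which is 0. *)
have tau0 S : tau S != 0.
  apply: contra_neq z0 => /eqP; rewrite subr_eq0 => /eqP e.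
  have c0 : eval_at S z = 0.
    by apply: (has_value_uniq XQ _ zQ); rewrite {1}e; apply: has_value_constant.
  by rewrite e c0 rmorph0.
have Ktau S : KX (tau S) by apply: KX_sub => //; apply: KX_constant.
have tau_value S T : point_of X T -> ~~ same_point T P ->
    has_value T (tau S) (eval_at T z - eval_at S z).
  move=> XT TP; apply: (has_valueB XT); last exact: has_value_constant.
  exact/(local_ringP XT)/zreg.
have [s [sX cs]] := function_zeros (Ktau R) (tau0 R).
(* [s] represents the zeros of z - z(R). As [B] is nonzero on them, a zero [S] of [B] other than [P]
   has z(S) different from z(R), so [tau S] does not vanish at [R]. *)
have [|B hB Bs] := @linear_form_avoiding K n (Q :: s).
  by move=> S; rewrite inE => /predU1P[->|/sX]; apply: point_neq0 => //; apply: XQ.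
have BQ : B.@[Q 0] != 0 by apply: Bs; rewrite mem_head.
have Bfiber S : point_of X S -> has_value S (tau R) 0 -> B.@[S 0] != 0.
  move=> XS /(cs S XS)[S' S's SS'].
  by rewrite (form_value_same_point (point_neq0 XS) hB SS') Bs // inE S's orbT.
have BR : B.@[R 0] != 0.
  by apply: Bfiber => //; rewrite -(subrr (eval_at R z)); apply: tau_value.
have [c hc [cQ cR]] := linear_form_separating (point_neq0 XQ) (point_neq0 XR) QR.
pose f := form_ratio X c B.
have f0 : f != 0.
  rewrite /f form_ratioE; apply: mulf_neq0; last apply: invr_neq0.
    by rewrite form_class_eq0; apply: (value_ideal XR).
  by rewrite form_class_eq0; apply: (value_ideal XR).
have BI := value_ideal XQ BQ.
have Kf : KX f by apply: KX_form hc hB BI.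
have [s2 [s2X _ cs2]] := finite_zeros dim1 hB BI.
pose s3 := [seq S <- s2 | ~~ same_point S P].
have s3P S : S \in s3 -> [/\ point_of X S, B.@[S 0] = 0 & ~~ same_point S P].
  by rewrite mem_filter => /andP[SP /s2X[]].
have /boolp.choice[N hN] : forall S, exists N, S \in s3 -> local_ring S (tau S ^+ N * f).
  move=> S; have [/s3P[XS _ SP]|_] := boolP (S \in s3); last by exists 0%N.
  have := tau_value S S XS SP; rewrite subrr => /(pole_cancellation XS Kf f0)[k hk].
  by exists k.
have reg_tau S T k : point_of X T -> ~~ same_point T P -> local_ring T (tau S ^+ k).
  by move=> XT TP; apply: local_ringX; eexists; apply: tau_value.
exists (f * \prod_(S <- s3) tau S ^+ N S); split.
- rewrite -(mul0r (eval_at Q (\prod_(S <- s3) tau S ^+ N S))); apply: has_valueM.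
    by rewrite -(mul0r (B.@[Q 0])^-1) -cQ; apply: (has_value_form X hc hB BQ).
  by apply: (local_ringP XQ); apply: local_ring_prod => S _; apply: reg_tau.
- apply: unit_atM.
    eexists; first by apply: (has_value_form X hc hB BR).
    exact: mulf_neq0 cR (invr_neq0 BR).
  rewrite big_seq; elim/big_ind: _ => [|g1 g2 U1 U2|S /s3P[XS BS SP]].
  + by exists 1; [apply: has_value1|apply: oner_neq0].
  + exact: unit_atM U1 U2.
  + rewrite exprnP; apply: unit_at_expz; eexists; first exact: tau_value.
    rewrite subr_eq0; apply: contra_eq_neq BS => e; apply: Bfiber => //.
    by rewrite -(subrr (eval_at S z)) -{2}e; apply: tau_value.
move=> S XS SP; have [BS|BS] := eqVneq B.@[S 0] 0; last first.
  apply: local_ringM; first by eexists; apply: (has_value_form X hc hB BS).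
  by apply: local_ring_prod => T _; apply: reg_tau.
have [T Ts2 ST] := cs2 S XS BS.
have TP : ~~ same_point T P.
  by apply: contra SP; apply: same_point_trans.
have Ts3 : T \in s3 by rewrite mem_filter TP.
have [XT _ _] := s3P T Ts3.
have [a ha] : local_ring T (f * \prod_(S <- s3) tau S ^+ N S).
  rewrite (big_rem T Ts3) /= mulrA [f * _]mulrC; apply: local_ringM; first exact: hN.
  by apply: local_ring_prod => U _; apply: reg_tau.
by exists a; apply: same_point_value ha => //; rewrite same_point_sym.
Qed.
End Separation.

(** * Frobenius descent *)

Lemma meval_map (R S : comNzRingType) (phi : {rmorphism R -> S}) n (v : 'I_n -> R)
    (p : {mpoly R[n]}) :
  (map_mpoly phi p).@[fun i => phi (v i)] = phi p.@[v].
Proof.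
elim/mpolyind: p => [|c m p _ _ IH]; first by rewrite raddf0 !meval0 rmorph0.
rewrite rmorphD /= map_mpolyZ map_mpolyX !mevalD !mevalZ !mevalX IH.
by rewrite rmorphD rmorphM rmorph_prod; under [in RHS]eq_bigr do rewrite rmorphXn.
Qed.

Section Frobenius.
Variables (F : finFieldType) (K : closedFieldType) (iota : {rmorphism F -> K}).

Lemma card_pchar_nat k : [pchar K].-nat (#|F| ^ k)%N.
Proof.
have [p _ pF] := finPcharP F.
have pK : p \in [pchar K] by rewrite (fmorph_pchar iota).
rewrite pnatX (eq_pnat _ (pcharf_eq pK)); apply/orP; left.
have := abelem_pgroup (fin_ring_pchar_abelem pF).
by rewrite /pgroup cardsT.
Qed.

(* [iota] is an argument only because the characteristic of [K], hence the ring
   morphism instance, comes from it. *)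
Definition frob of {rmorphism F -> K} := fun (k : nat) (x : K) => x ^+ (#|F| ^ k).
Local Notation fr := (frob iota).

Lemma frob_zmod k : zmod_morphism (fr k).
Proof.
move=> x y; rewrite /frob exprDn_pchar ?card_pchar_nat //; congr (_ + _).
apply/eqP; rewrite -addr_eq0 -exprDn_pchar ?card_pchar_nat // addNr expr0n.
by rewrite expn_eq0 -leqn0 leqNgt (ltnW (finNzRing_gt1 F)).
Qed.
HB.instance Definition _ k := GRing.isZmodMorphism.Build K K (fr k) (frob_zmod k).

Lemma frob_monoid k : monoid_morphism (fr k).
Proof. by split=> [|x y]; rewrite /frob ?expr1n ?exprMn. Qed.
HB.instance Definition _ k := GRing.isMonoidMorphism.Build K K (fr k) (frob_monoid k).

Lemma frob0 x : fr 0 x = x. Proof. by []. Qed.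

Lemma frobD k l x : fr (k + l) x = fr k (fr l x).
Proof. by rewrite /frob -exprM -expnD addnC. Qed.

Lemma frob_iota k a : fr k (iota a) = iota a.
Proof.
rewrite /frob -rmorphXn; congr (iota _).
by elim: k => [|k IH]; rewrite ?expr1 // expnS exprM expf_card.
Qed.

Lemma frob_surj k x : exists y, fr k y = x.
Proof.
have q0 : (0 < #|F| ^ k)%N by rewrite expn_gt0 (ltnW (finNzRing_gt1 F)).
have [y /rootP] : exists y, root ('X^(#|F| ^ k) - x%:P) y.
  by apply/closed_rootP; rewrite size_XnsubC // eqSS gtn_eqF.
rewrite hornerD hornerN hornerC hornerXn => /eqP; rewrite subr_eq0 => /eqP.
by exists y.
Qed.

Lemma frob1_iota x : fr 1 x = x -> exists a, x = iota a.
Proof.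
rewrite /frob expn1 => /eqP; rewrite -subr_eq0 => xq.
have : root (map_poly iota ('X^#|F| - 'X)) x.
  by rewrite rmorphB /= map_polyXn map_polyX rootE !hornerE.
rewrite finField_genPoly rmorph_prod rootE horner_prod prodf_seq_eq0 => /hasP[a _].
rewrite rmorphB /= map_polyX map_polyC hornerXsubC subr_eq0 => /eqP->.
by exists a.
Qed.

Lemma frobM k l x : fr k x = x -> fr (k * l) x = x.
Proof. by move=> kx; elim: l => [|l IH]; rewrite ?muln0 ?mulnS ?frobD ?IH ?frob0. Qed.

(** All powers of [x] lie in a finite-dimensional space over the finite field [F], so two of the
    iterates x^(q^i) coincide; injectivity of the Frobenius cancels the smaller exponent. *)
Lemma frob_periodic : integralRange iota -> forall x, exists2 s, (0 < s)%N & fr s x = x.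
Proof.
move=> alg x; have [p mp px] := alg x.
pose d := (size p).-1.
have p0 : p != 0 by apply: monic_neq0.
pose v m : 'rV[F]_d := poly_rV ('X^m %% p).
pose w (u : 'rV[F]_d) : K := (map_poly iota (rVpoly u)).[x].
have wv m : w (v m) = x ^+ m.
  rewrite /w /v poly_rV_K; last first.
    have := ltn_modp 'X^m p; rewrite p0 => lt.
    by rewrite -ltnS /d prednK // size_poly_gt0.
  have := congr1 (fun r => (map_poly iota r).[x]) (divp_eq 'X^m p).
  rewrite rmorphD rmorphM /= map_polyXn hornerD hornerM hornerXn (rootP px) mulr0 add0r.
  by move->.
pose f (i : 'I_(#|{: 'rV[F]_d}|.+1)) := v (#|F| ^ i)%N.
have : ~~ injectiveb f.
  by apply/negP => /injectiveP/leq_card; rewrite card_ord ltnn.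
case/injectivePn => i [j ij fij].
wlog lt : i j ij fij / (i < j)%N.
  move=> W; have := ij; rewrite neq_ltn => /orP[] lt; first exact: (W i j).
  by apply: (W j i) => //; rewrite eq_sym.
exists (j - i)%N; first by rewrite subn_gt0.
apply: (fmorph_inj (frob iota i)); rewrite /= -frobD subnKC ?(ltnW lt) //.
by rewrite /frob -!wv; congr w.
Qed.

End Frobenius.

Section AdditivePolynomial.
Variables (F : finFieldType) (K : closedFieldType) (iota : {rmorphism F -> K}).

Lemma card_natr0 k : (0 < k)%N -> (#|F| ^ k)%:R = 0 :> K.
Proof.
have [p pp pF] := finPcharP F.
have pK : p \in [pchar K] by rewrite (fmorph_pchar iota).
move=> k0; apply/eqP; rewrite -(dvdn_pcharf pK) Euclid_dvdX // k0 andbT.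
have /p_natP[[|m] e] : p.-nat #|F|.
- have := abelem_pgroup (fin_ring_pchar_abelem pF).
  by rewrite /pgroup cardsT.
- by have := finNzRing_gt1 F; rewrite e.
by rewrite e expnS dvdn_mulr.
Qed.

(** The polynomial X^(q^s) - X has derivative -1, so its roots are distinct. *)
Lemma frob_roots s : (0 < s)%N -> exists rs : seq K,
  [/\ uniq rs, size rs = (#|F| ^ s)%N & forall c, c \in rs -> frob iota s c = c].
Proof.
move=> s0; set q := (#|F| ^ s)%N.
have q1 : (1 < q)%N by rewrite -(exp1n s) ltn_exp2r // finNzRing_gt1.
have sz : size ('X^q - 'X : {poly K}) = q.+1.
  by rewrite size_polyDl size_polyXn // size_polyN size_polyX ltnS.
have [rs e] := closed_field_poly_normal ('X^q - 'X : {poly K}).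
have lc : lead_coef ('X^q - 'X : {poly K}) = 1.
  by rewrite lead_coefDl ?lead_coefXn // size_polyN size_polyX size_polyXn ltnS.
rewrite lc scale1r in e; exists rs; split.
- rewrite -separable_prod_XsubC -e separable_poly.unlock derivB derivXn derivX.
  rewrite -mulr_natr -polyC_natr (card_natr0 s0) polyC0 mulr0 sub0r.
  by rewrite -[X in coprimep _ X]scaleN1r coprimepZr ?oppr_eq0 ?oner_eq0 // coprimep1.
- by apply: succn_inj; rewrite -sz e size_prod_XsubC.
move=> c crs; have : root ('X^q - 'X) c by rewrite e root_prod_XsubC.
by rewrite rootE !hornerE subr_eq0 => /eqP.
Qed.

(** The polynomial \sum_k W_k X^(q^k) has degree at most q^(s-1) but q^s roots, and its exponents
    are distinct. *)
Lemma additive_poly_zero s (W : 'I_s -> K) :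
  (forall c, frob iota s c = c -> \sum_k W k * frob iota k c = 0) -> forall k, W k = 0.
Proof.
case: s W => [|s] W hW; first by case.
pose p := \sum_(k < s.+1) W k *: 'X^(#|F| ^ k) : {poly K}.
have F1 := finNzRing_gt1 F.
have sp : (size p <= #|F| ^ s.+1)%N.
  apply: (leq_trans (size_sum _ _ _)); apply/bigmax_leqP => k _.
  apply: (leq_trans (size_scale_leq _ _)).
  by rewrite size_polyXn ltn_exp2l.
have p0 : p = 0.
  have [rs [urs srs rsP]] := frob_roots (ltn0Sn s).
  apply/eqP; apply: contraLR sp => pn; rewrite -ltnNge -srs.
  apply: max_poly_roots => //; apply/allP => c /rsP/hW h; apply/rootP.
  rewrite /p horner_sum -[RHS]h; apply: eq_bigr => k _.
  by rewrite hornerZ hornerXn.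
move=> k; have := congr1 (fun r : {poly K} => r`_(#|F| ^ k)) p0.
rewrite coef0 /p coef_sum (bigD1 k) //= coefZ coefXn eqxx mulr1 big1 ?addr0 //.
move=> j jk; rewrite coefZ coefXn; case: eqP => [/eqP|_]; last by rewrite mulr0.
by rewrite eqn_exp2l // => /eqP e; case/eqP: jk; apply/val_inj.
Qed.
End AdditivePolynomial.

Section FrobeniusForms.
Variables (F : finFieldType) (K : closedFieldType) (iota : {rmorphism F -> K}).
Variable n : nat.
Implicit Types (p q : {mpoly K[n]}).
Local Notation sg k p := (map_mpoly (frob iota k) p).

Lemma frob_form0 p : sg 0 p = p.
Proof. by apply/mpolyP => m; rewrite mcoeff_map_mpoly. Qed.

Lemma frob_formD k l p : sg (k + l) p = sg k (sg l p).
Proof. by apply/mpolyP => m; rewrite !mcoeff_map_mpoly /= frobD. Qed.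

Lemma frob_form_iota k (e : {mpoly F[n]}) : sg k (map_mpoly iota e) = map_mpoly iota e.
Proof. by apply/mpolyP => m; rewrite !mcoeff_map_mpoly /= frob_iota. Qed.

Lemma frob_formM k l p : sg k p = p -> sg (k * l) p = p.
Proof.
by move=> kp; elim: l => [|l IH]; rewrite ?muln0 ?frob_form0 // mulnS frob_formD IH.
Qed.

Lemma frob_form_periodic : integralRange iota ->
  forall p, exists2 s, (0 < s)%N & sg s p = p.
Proof.
move=> alg; elim/mpolyind => [|c m p _ _ [s s0 sp]]; first by exists 1%N; rewrite ?raddf0.
have [l l0 lc] := frob_periodic alg c.
exists (s * l)%N; first by rewrite muln_gt0 s0.
by rewrite rmorphD /= map_mpolyZ map_mpolyX frob_formM //= mulnC frobM.
Qed.

Lemma frob_fixed_form d p : sg 1 p = p -> p \is d.-homog ->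
  exists2 p1 : {mpoly F[n]}, p1 \is d.-homog & p = map_mpoly iota p1.
Proof.
move=> fp hp.
have /boolp.choice[a ha] : forall m, exists a, p@_m = iota a.
  by move=> m; apply: frob1_iota; rewrite -{2}fp mcoeff_map_mpoly.
exists (\sum_(m <- msupp p) a m *: 'X_[m]).
  rewrite big_seq; apply: rpred_sum => m mp.
  by rewrite dhomogZ // dhomogX; apply/eqP/(dhomogP _ _ _ hp).
rewrite {1}[p]mpolyE rmorph_sum /=; apply: eq_bigr => m _.
by rewrite map_mpolyZ map_mpolyX -ha.
Qed.

Lemma frob_sum_fixed s p : sg s p = p -> sg 1 (\sum_(k < s) sg k p) = \sum_(k < s) sg k p.
Proof.
case: s => [|s] sp; first by rewrite !big_ord0 raddf0.
rewrite [RHS]big_ord_recl frob_form0 rmorph_sum /= big_ord_recr /= addrC.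
by rewrite -frob_formD sp; congr (_ + _); apply: eq_bigr => k _; rewrite -frob_formD.
Qed.

Lemma frob_prod_fixed s p : sg s p = p -> sg 1 (\prod_(k < s) sg k p) = \prod_(k < s) sg k p.
Proof.
case: s => [|s] sp; first by rewrite !big_ord0 rmorph1.
rewrite [RHS]big_ord_recl frob_form0 rmorph_prod /= big_ord_recr /= mulrC.
by rewrite -frob_formD sp; congr (_ * _); apply: eq_bigr => k _; rewrite -frob_formD.
Qed.
End FrobeniusForms.

Section FrobeniusPoints.
Variables (F : finFieldType) (K : closedFieldType) (iota : {rmorphism F -> K}).
Variables (n : nat) (X : variety iota n).
Local Notation I := (ideal_of X).
Local Notation KX := (@function_field_closure F K iota n X).
Local Notation cst := (@Defs.constant F K iota n X).
Local Notation cl := (form_class X).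
Local Opaque form_class.
Local Notation sg k p := (map_mpoly (frob iota k) p).
Local Notation sp k Q := (map_mx (frob iota k) Q).
Implicit Types (f g : coord_frac X) (P Q R : 'rV[K]_n.+1) (p q : {mpoly K[n.+1]}).

Lemma frob_meval k p Q : (sg k p).@[(sp k Q) 0] = frob iota k p.@[Q 0].
Proof. by rewrite -meval_map; apply: meval_eq => i; rewrite mxE. Qed.

Lemma frob_point k Q : point_of X Q -> point_of X (sp k Q).
Proof.
move=> [Q0 XQ]; split; first by rewrite map_mx_eq0.
by move=> e /XQ eQ; rewrite -(frob_form_iota _ k) frob_meval eQ rmorph0.
Qed.

Lemma frob_point_surj k Q : point_of X Q -> exists2 R, point_of X R & Q = sp k R.
Proof.
move=> [Q0 XQ]; have /boolp.choice[r hr] := frob_surj iota k.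
have e : Q = sp k (\row_i r (Q 0 i)) by apply/rowP => i; rewrite !mxE hr.
exists (\row_i r (Q 0 i)) => //; split; first by move: Q0; rewrite {1}e map_mx_eq0.
move=> f /XQ fQ; apply/eqP; rewrite -(fmorph_eq0 (frob iota k)) /= -frob_meval -e.
by rewrite frob_form_iota fQ.
Qed.

(** The equations have coefficients in [F], so the Frobenius maps the points of the curve onto
    themselves. *)
Lemma frob_ideal k p : (sg k p \in I) = (p \in I).
Proof.
apply/idealP/idealP => h Q XQ.
  apply/eqP; rewrite -(fmorph_eq0 (frob iota k)) /= -frob_meval h //.
  exact: frob_point.
by have [R XR ->] := frob_point_surj k XQ; rewrite frob_meval h ?rmorph0.
Qed.

(** The value may come from another representation p' / q' of the same function; the equality of the
    two ratios is carried over because the ideal is stable under the Frobenius. *)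
Lemma frob_value k Q p q v : point_of X Q -> q \notin I ->
  has_value Q (form_ratio X p q) v ->
  has_value (sp k Q) (form_ratio X (sg k p) (sg k q)) (frob iota k v).
Proof.
move=> XQ qI [d [p' [q' [hp hq qQ /eqP e ->]]]].
have q'I := value_ideal XQ qQ; exists d, (sg k p'), (sg k q'); split.
- exact: homog_map.
- exact: homog_map.
- by rewrite frob_meval fmorph_eq0.
- move: e; rewrite form_ratio_eq // => e; apply/eqP; rewrite form_ratio_eq ?frob_ideal //.
  by rewrite -!rmorphM -rmorphB frob_ideal.
by rewrite !frob_meval fmorph_div.
Qed.

Lemma frob_same_point k Q R : same_point (sp k Q) (sp k R) = same_point Q R.
Proof. by rewrite /same_point !map_submx. Qed.

Lemma same_point_in Q R : point_of X Q -> same_point Q R -> point_of X R.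
Proof.
move=> XQ; rewrite same_point_sym => RQ.
have R0 : R != 0.
  case/andP: RQ => _ /sub_rVP[a Qa]; apply: contra_neq (point_neq0 XQ) => R0.
  by rewrite Qa R0 scaler0.
have [c c0 e] := same_pointP _ R0 RQ; split=> // f fX.
have [d hd] := eqns_homog X _ fX.
by rewrite e (meval_scale _ _ (homog_map iota hd)) (XQ.2 _ fX) mulr0.
Qed.

(** On coordinates in F_{q^l} the l-th Frobenius fixes the point, and it fixes a function defined
    over [F]; by uniqueness it fixes the value. *)
Lemma rational_value l Q f : point_of X Q -> rational F l Q -> function_field f ->
  local_ring Q f -> subfield F K l (eval_at Q f).
Proof.
move=> XQ [R QR Rl] [d [p [q [hp hq qI ef]]]] fQ.
have XR := same_point_in XQ QR.
have fR : has_value R f (eval_at Q f).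
  exact: same_point_value XQ QR (local_ringP XQ fQ).
have eR : sp l R = R by apply/rowP => i; rewrite mxE; apply: Rl.
have := fR; rewrite {1}ef => /(frob_value l XR qI).
by rewrite eR !frob_form_iota -ef => /(has_value_uniq XR)/(_ fR).
Qed.

(** Serves to deduce from the distinctness of the closed points that the points themselves are
    distinct. *)
Lemma closed_point_eq l l' Q R : point_of X Q -> has_degree F l Q -> has_degree F l' R ->
  same_point Q R -> closed_point F l Q = closed_point F l' R.
Proof.
move=> XQ [l0 Ql lmin] [l'0 Rl l'min] QR.
have rat m (S T : 'rV[K]_n.+1) : same_point S T -> rational F m T -> rational F m S.
  by move=> ST [U TU Um]; exists U => //; apply: same_point_trans ST TU.
have RQ : same_point R Q by rewrite same_point_sym.
have -> : l = l'.
  apply/eqP; rewrite eqn_leq (lmin l' l'0 (rat _ _ _ QR Rl)).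
  exact: l'min l l0 (rat _ _ _ RQ Ql).
have it k : same_point (iter k (@frobenius F K n) Q) (iter k (@frobenius F K n) R).
  elim: k => //= k; by rewrite -(frob_same_point 1) /frob expn1.
apply/predeqP => S; split=> [[k kl Sk]|[k kl Sk]]; exists k => //.
  exact: same_point_trans Sk (it k).
by apply: same_point_trans Sk _; rewrite same_point_sym.
Qed.
End FrobeniusPoints.

(** * The ring of functions with poles only at P *)

Section PoleRing.
Variables (F : finFieldType) (K : closedFieldType) (iota : {rmorphism F -> K}).
Variables (n : nat) (X : variety iota n).
Local Notation I := (ideal_of X).
Local Notation KX := (@function_field_closure F K iota n X).
Local Notation KF := (@function_field F K iota n X).
Local Notation cst := (@Defs.constant F K iota n X).
Local Notation cl := (form_class X).
Local Opaque form_class.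
Local Notation sg k p := (map_mpoly (frob iota k) p).
Implicit Types (f g x : coord_frac X) (Q R : 'rV[K]_n.+1) (p q : {mpoly K[n.+1]}).
Hypotheses (dim1 : has_dimension X 1) (smooth : nonsingular X).
Variables (P : 'rV[K]_n.+1) (XP : point_of X P).

Lemma function_field_KX f : KF f -> KX f.
Proof.
move=> [d [p [q [hp hq qI ->]]]].
by apply: (KX_form (homog_map iota hp) (homog_map iota hq) qI).
Qed.

Lemma function_fieldM f g : KF f -> KF g -> KF (f * g).
Proof.
move=> [d [p [q [hp hq qI ->]]]] [d' [p' [q' [hp' hq' q'I ->]]]].
exists (d + d')%N, (p * p'), (q * q'); split; [exact: dhomogM|exact: dhomogM| |].
  by rewrite (rmorphM (map_mpoly iota)); apply: idealM_notin qI q'I.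
by rewrite !form_ratioE mulf_div !rmorphM.
Qed.

(** Trades the valuations in the Riemann-Roch spaces for regularity; for the converse, the absolute
    value of the valuation at [P] is a large enough multiple. *)
Lemma pole_ringP f : pole_ring X P f <->
  KF f /\ forall R, point_of X R -> ~~ same_point R P -> local_ring R f.
Proof.
split=> [[m [Ff fm]]|[Ff freg]].
  split=> // R XR RP; have [->|f0] := eqVneq f 0; first exact: local_ring0.
  apply/(valuation_ge0 dim1 smooth XR (function_field_KX Ff) f0).
  by have := fm f0 R XR; rewrite /multiple_of_point (negPf RP) addr0.
exists `|valuation P f|%N; split=> // f0 Q XQ; rewrite /multiple_of_point.
case: ifPn => QP; last first.
  rewrite addr0; apply/(valuation_ge0 dim1 smooth XQ (function_field_KX Ff) f0).
  exact: freg.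
rewrite (valuation_same_point f XQ XP QP); lia.
Qed.

Lemma pole_ringM f g : pole_ring X P f -> pole_ring X P g -> pole_ring X P (f * g).
Proof.
move=> /pole_ringP[Ff rf] /pole_ringP[Fg rg]; apply/pole_ringP.
split=> [|R XR RP]; first exact: function_fieldM.
by apply: local_ringM; [apply: rf|apply: rg].
Qed.

Lemma pole_ring1 : pole_ring X P 1.
Proof.
apply/pole_ringP; split=> [|R _ _]; last exact: local_ring1.
exists 0%N, 1, 1; rewrite dhomog1; split=> //.
  by rewrite rmorph1 -form_class_eq0 rmorph1 oner_eq0.
by rewrite form_ratioE !rmorph1 divr1.
Qed.

Lemma semigroupP eta : weierstrass_semigroup X P eta <->
  exists f, [/\ pole_ring X P f, f != 0 & valuation P f = - eta%:Z].
Proof.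
split=> [] [f [Rf f0 e]]; exists f; split=> //; first by rewrite -e opprK.
by rewrite /rho e opprK.
Qed.

Lemma semigroup0 : weierstrass_semigroup X P 0%N.
Proof.
apply/semigroupP; exists 1; split; [exact: pole_ring1|exact: oner_neq0|].
rewrite oppr0; apply: valuation_unit => //.
by exists 1; [apply: has_value1|apply: oner_neq0].
Qed.

Lemma semigroupD a b : weierstrass_semigroup X P a -> weierstrass_semigroup X P b ->
  weierstrass_semigroup X P (a + b)%N.
Proof.
move=> /semigroupP[f [Rf f0 ef]] /semigroupP[g [Rg g0 eg]]; apply/semigroupP.
have Kf := function_field_KX (proj1 (proj1 (pole_ringP f) Rf)).
have Kg := function_field_KX (proj1 (proj1 (pole_ringP g) Rg)).
exists (f * g); split; [exact: pole_ringM|exact: mulf_neq0 f0 g0|].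
by rewrite (valuationM dim1 smooth XP Kf Kg f0 g0) ef eg PoszD opprD.
Qed.

Section Basis.
Variable f : nat -> coord_frac X.
Local Notation Gamma := (weierstrass_semigroup X P).
Hypothesis f_basis : is_basis (fun c : F => scale_by (iota c)) setT Gamma f (pole_ring X P).
Hypothesis f_rho : forall eta, Gamma eta -> rho P (f eta) = eta%:Z.

Lemma basis_in eta : Gamma eta -> pole_ring X P (f eta).
Proof.
move=> G; rewrite -f_basis.2; exists eta.+1, (fun k => (k == eta)%:R); split=> //.
rewrite big_mkcond big_ord_recr /= big1 ?add0r => [|k _].
  by rewrite mem_set // eqxx rmorph1 /scale_by rmorph1 mul1r.
case: ifP => // _; rewrite ltn_eqF // rmorph0 /scale_by rmorph0 mul0r //.
Qed.

Lemma basis_KX eta : Gamma eta -> KX (f eta).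
Proof. by move=> /basis_in/pole_ringP[/function_field_KX]. Qed.

Lemma basis_neq0 eta : Gamma eta -> f eta != 0.
Proof.
move=> G; apply/eqP => e.
have := f_basis.1 eta.+1 (fun k => (k == eta)%:R) (fun _ => Logic.I) _ eta (ltnSn _) G.
rewrite eqxx => h; have /eqP := oner_neq0 F; apply; apply: h.
rewrite big_mkcond big_ord_recr /= big1 ?add0r => [|k _].
  by rewrite e /scale_by mulr0 if_same.
by case: ifP => // _; rewrite ltn_eqF // /scale_by rmorph0 rmorph0 mul0r.
Qed.

Lemma basis_valuation eta : Gamma eta -> valuation P (f eta) = - eta%:Z.
Proof. by move=> /f_rho; rewrite /rho => <-; rewrite opprK. Qed.

Definition comb (c : nat -> K) N := \sum_(k < N | (k : nat) \in Gamma) cst (c k) * f k.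

Lemma combS c N :
  comb c N.+1 = comb c N + if N \in Gamma then cst (c N) * f N else 0.
Proof. by rewrite /comb big_mkcond big_ord_recr -big_mkcond. Qed.

Lemma comb_KX c N : KX (comb c N).
Proof.
apply: KX_sum => k /set_mem kG; apply: KX_mul; last exact: basis_KX.
exact: KX_constant.
Qed.

Lemma basis_term_valuation a N : Gamma N -> a != 0 ->
  [/\ KX (cst a * f N), cst a * f N != 0 & valuation P (cst a * f N) = - N%:Z].
Proof.
move=> G a0; have ca : cst a != 0 by rewrite fmorph_eq0.
split; first by apply: KX_mul; [apply: KX_constant|apply: basis_KX].
  exact: mulf_neq0 ca (basis_neq0 G).
rewrite (valuationM dim1 smooth XP (KX_constant X a) (basis_KX G) ca (basis_neq0 G)).
rewrite (basis_valuation G) (valuation_unit dim1 smooth XP) ?add0r //.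
by exists a => //; apply: has_value_constant.
Qed.

(** The terms have distinct pole orders, so the one of highest order dominates. The zero combination
    is set apart because [valuation] is meaningful on nonzero functions only. *)
Lemma comb_valuation c N : comb c N = 0 \/ - N%:Z < valuation P (comb c N).
Proof.
elim: N => [|N IH]; first by left; rewrite /comb big_ord0.
have step : comb c N = 0 \/ - (N.+1)%:Z < valuation P (comb c N).
  by case: IH => [|h]; [left|right; lia].
rewrite combS; case: ifP => [/set_mem G|_]; last by rewrite addr0.
have [c0|c0] := eqVneq (c N) 0; first by rewrite c0 rmorph0 mul0r addr0.
have [Kt tn tv] := basis_term_valuation G c0.
have [e|cn] := eqVneq (comb c N) 0.
  by right; rewrite e add0r tv; lia.
case: IH => [/eqP|h]; first by rewrite (negPf cn).
rewrite -tv in h; right; rewrite addrC.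
by have [_ ->] := valuationD dim1 smooth XP Kt (comb_KX c N) tn cn h; rewrite tv; lia.
Qed.

Lemma comb_lead c N : Gamma N -> c N != 0 ->
  comb c N.+1 != 0 /\ valuation P (comb c N.+1) = - N%:Z.
Proof.
move=> G c0; rewrite combS mem_set //.
have [Kt tn tv] := basis_term_valuation G c0.
have [->|h] := comb_valuation c N; first by rewrite add0r.
have [->|cn] := eqVneq (comb c N) 0; first by rewrite add0r.
rewrite -tv in h; rewrite addrC.
by have [-> ->] := valuationD dim1 smooth XP Kt (comb_KX c N) tn cn h.
Qed.

(** Once trailing zero coefficients are dropped, the last index is the pole order. *)
Lemma comb_expansion x : pole_ring X P x -> x != 0 ->
  exists N (c : nat -> F),
    [/\ Gamma N, c N != 0, x = comb (iota \o c) N.+1 & valuation P x = - N%:Z].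
Proof.
rewrite -f_basis.2 => -[m [c [_ ->]]].
rewrite -/(comb (iota \o c) m); elim: m => [|m IH]; first by rewrite /comb big_ord0 eqxx.
have [/set_mem G|mG] := boolP (m \in Gamma); last by rewrite combS (negPf mG) addr0.
have [c0|c0] := eqVneq (c m) 0; first by rewrite combS /= c0 !rmorph0 mul0r if_same addr0.
have c0' : (iota \o c) m != 0 by rewrite /= fmorph_eq0.
by move=> _; exists m, c; split=> //; apply: (comb_lead G c0').2.
Qed.

(** Pole orders add, so the expansion of the product ends exactly at [a + b]. *)
Lemma basis_product a b : Gamma a -> Gamma b ->
  exists2 c : nat -> F, c (a + b)%N != 0 & f a * f b = comb (iota \o c) (a + b).+1.
Proof.
move=> Ga Gb; have fab0 := mulf_neq0 (basis_neq0 Ga) (basis_neq0 Gb).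
have [N [c [GN cN e]]] := comb_expansion (pole_ringM (basis_in Ga) (basis_in Gb)) fab0.
rewrite (valuationM dim1 smooth XP (basis_KX Ga) (basis_KX Gb)) ?basis_neq0 //.
rewrite !basis_valuation // -opprD -PoszD => /oppr_inj[eN].
by exists c; rewrite eN.
Qed.

(** The expansion of 1, which has pole order 0, is a single multiple of [f 0]. *)
Lemma basis0 : exists2 a : K, a != 0 & f 0%N = cst a.
Proof.
have [N [c [GN cN e vN]]] := comb_expansion pole_ring1 (oner_neq0 _).
have U1 : unit_at P (1 : coord_frac X) by exists 1; [apply: has_value1|apply: oner_neq0].
have N0 : N = 0%N.
  by have := valuation_unit dim1 smooth XP U1; rewrite vN; lia.
have ca : cst (iota (c 0%N)) != 0 by rewrite !fmorph_eq0 -N0.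
exists (iota (c 0%N))^-1; first by rewrite invr_eq0 fmorph_eq0 -N0.
move: e; rewrite N0 combS /comb big_ord0 add0r mem_set /=; last by rewrite -N0.
by move=> e; apply: (mulfI ca); rewrite -e fmorphV divff.
Qed.

Section Evaluation.
Variables (h : nat) (Pt : 'I_h -> 'rV[K]_n.+1).
Hypotheses (Pt_in : forall i, point_of X (Pt i)) (Pt_neq : forall i, ~~ same_point (Pt i) P).
Local Notation ev := (evaluation Pt).

Lemma basis_value i a : Gamma a -> has_value (Pt i) (f a) (ev (f a) 0 i).
Proof.
move=> Ga; rewrite mxE; apply: (local_ringP (Pt_in i)).
by have /pole_ringP[_ r] := basis_in Ga; apply: r.
Qed.

Lemma comb_value i c N : has_value (Pt i) (comb c N)
  ((\sum_(k < N | (k : nat) \in Gamma) c k *: ev (f k)) 0 i).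
Proof.
rewrite summxE; apply: (has_value_sum (Pt_in i)) => k /set_mem kG.
by rewrite mxE; apply: has_valueM; [apply: has_value_constant|apply: basis_value].
Qed.

Lemma evaluation_product a b : Gamma a -> Gamma b -> exists2 c : nat -> K,
  c (a + b)%N != 0 &
  \row_i (ev (f a) 0 i * ev (f b) 0 i) =
    \sum_(k < (a + b).+1 | (k : nat) \in Gamma) c k *: ev (f k).
Proof.
move=> Ga Gb; have [c c0 e] := basis_product Ga Gb.
exists (iota \o c); first by rewrite /= fmorph_eq0.
apply/rowP => i; rewrite [LHS]mxE.
apply: (has_value_uniq (Pt_in i) _ (comb_value i _ _)); rewrite -e.
by apply: has_valueM; apply: basis_value.
Qed.

Lemma evaluation_basis0 i : ev (f 0%N) 0 i != 0.
Proof.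
have [a a0 e] := basis0; rewrite mxE e.
by rewrite (eval_atE (Pt_in i) (has_value_constant _ _ _)).
Qed.
End Evaluation.
End Basis.
End PoleRing.

(** * Evaluations of functions over [F] and over [K] *)

Section Descent.
Variables (F : finFieldType) (K : closedFieldType) (iota : {rmorphism F -> K}).
Variables (n : nat) (X : variety iota n).
Local Notation I := (ideal_of X).
Local Notation KX := (@function_field_closure F K iota n X).
Local Notation KF := (@function_field F K iota n X).
Local Notation cst := (@Defs.constant F K iota n X).
Local Notation cl := (form_class X).
Local Opaque form_class.
Local Notation sg k p := (map_mpoly (frob iota k) p).
Local Notation sp k Q := (map_mx (frob iota k) Q).
Implicit Types (f g x : coord_frac X) (Q R : 'rV[K]_n.+1) (p q : {mpoly K[n.+1]}).
Hypothesis alg : integralRange iota.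

(** Numerator and denominator are multiplied by the other conjugates of the denominator [q], which
    becomes its norm, a form over [F]. The product of the periods of [p] and [q] serves as common
    period. *)
Lemma rational_denominator g : KX g -> exists s d p (q : {mpoly F[n.+1]}),
  [/\ (0 < s)%N, sg s p = p, p \is d.-homog /\ q \is d.-homog,
      map_mpoly iota q \notin I & g = form_ratio X p (map_mpoly iota q)].
Proof.
move=> [d [p [q [hp hq qI ->]]]].
have [a a0 ap] := frob_form_periodic alg p.
have [b b0 bq] := frob_form_periodic alg q.
have : (0 < a * b)%N by rewrite muln_gt0 a0.
case es : (a * b)%N => [//|s] _.
have sP : sg s.+1 p = p by rewrite -es frob_formM.
have sQ : sg s.+1 q = q by rewrite -es mulnC frob_formM.
pose r := \prod_(k < s) sg k.+1 q.
have hom_r : r \is (\sum_(k < s) d)%N.-homog.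
  rewrite /r; elim: (s) => [|m IH]; first by rewrite !big_ord0 dhomog1.
  by rewrite !big_ord_recr dhomogM // homog_map.
have rI : r \notin I.
  rewrite /r; elim: (s) => [|m IH].
    by rewrite big_ord0 -form_class_eq0 rmorph1 oner_eq0.
  by rewrite big_ord_recr; apply: idealM_notin; rewrite ?frob_ideal.
have qr : q * r = \prod_(k < s.+1) sg k q by rewrite big_ord_recl frob_form0.
have [q1 hq1 eq1] : exists2 q1 : {mpoly F[n.+1]},
    q1 \is (d + \sum_(k < s) d)%N.-homog & q * r = map_mpoly iota q1.
  apply: frob_fixed_form; last exact: dhomogM.
  by rewrite qr frob_prod_fixed.
exists s.+1, (d + \sum_(k < s) d)%N, (p * r), q1; split=> //.
- rewrite rmorphM /= sP; congr (_ * _); rewrite rmorph_prod; apply: eq_bigr => k _.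
  by rewrite /= -frob_formD addnC frob_formD sQ.
- by split=> //; apply: dhomogM.
- by rewrite -eq1; apply: idealM_notin.
have r0 : cl r != 0 by rewrite form_class_eq0.
by rewrite -eq1 !form_ratioE !rmorphM -mulf_div (divff r0) mulr1.
Qed.

Hypotheses (dim1 : has_dimension X 1) (smooth : nonsingular X).
Variables (P : 'rV[K]_n.+1) (XP : point_of X P) (Prat : rational F 1 P).

Lemma frob_rational_point k Q : same_point (sp k Q) P = same_point Q P.
Proof.
have [P' PP' P'1] := Prat.
have eP' : sp k P' = P'.
  apply/rowP => i; rewrite mxE; have := @frobM _ _ iota 1 k _ (P'1 i).
  by rewrite mul1n.
have P'P : same_point P' P by rewrite same_point_sym.
have aux S : same_point S P = same_point S P'.
  by apply/idP/idP => h; [apply: same_point_trans h PP'|apply: same_point_trans h P'P].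
by rewrite !aux -{1}eP' frob_same_point.
Qed.

Variables (h : nat) (Pt : 'I_h -> 'rV[K]_n.+1).
Hypotheses (Pt_in : forall i, point_of X (Pt i)) (Pt_neq : forall i, ~~ same_point (Pt i) P).

(* If [w] kills the evaluations of the traces [sum_k frob^k (c g)] for all [c]
   in F_{q^s}, then an additive polynomial in [c] of degree [< q^s] has [q^s]
   roots; its linear coefficient is the pairing of [w] with [g]. *)
Lemma evaluation_descent (w : 'I_h -> K) :
  (forall f, pole_ring X P f -> \sum_j w j * eval_at (Pt j) f = 0) ->
  forall g, KX g -> (forall R, point_of X R -> ~~ same_point R P -> local_ring R g) ->
  \sum_j w j * eval_at (Pt j) g = 0.
Proof.
move=> hw g Kg rg.
have [s [d [p [q [s0 sP [hp hq] qI eg]]]]] := rational_denominator Kg.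
pose G k := form_ratio X (sg k p) (map_mpoly iota q).
(* The Frobenius permutes the points and fixes [P], so the conjugates of [g] have no poles outside
   [P] either. *)
have G_reg k R : point_of X R -> ~~ same_point R P -> local_ring R (G k).
  move=> XR; have [R1 XR1 ->] := frob_point_surj k XR.
  rewrite frob_rational_point => /(rg _ XR1)[v]; rewrite eg.
  move=> /(frob_value k XR1 qI); rewrite frob_form_iota => hv.
  by eexists; apply: hv.
pose W (k : 'I_s) := \sum_j w j * eval_at (Pt j) (G k).
have W0 : forall k, W k = 0.
  apply: (additive_poly_zero (iota := iota)) => c sc.
  pose T := \sum_(k < s) cst (frob iota k c) * G k.
  have [N1 hN1 eN1] : exists2 N1 : {mpoly F[n.+1]}, N1 \is d.-homog &
      \sum_(k < s) sg k (c *: p) = map_mpoly iota N1.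
    apply: frob_fixed_form; first by rewrite frob_sum_fixed // map_mpolyZ /= sc sP.
    by apply: rpred_sum => k _; rewrite homog_map // dhomogZ.
  have eT : T = form_ratio X (map_mpoly iota N1) (map_mpoly iota q).
    rewrite form_ratioE -eN1 rmorph_sum mulr_suml; apply: eq_bigr => k _.
    by rewrite map_mpolyZ -mul_mpolyC rmorphM /= -constantE -mulrA.
  have RT : pole_ring X P T.
    apply/(pole_ringP dim1 smooth XP); split=> [|R XR RP].
      by rewrite eT; exists d, N1, q.
    apply: (local_ring_sum XR) => k _; apply: local_ringM; last exact: G_reg.
    exact: local_ring_constant.
  rewrite -[RHS](hw T RT) /W.
  under eq_bigr do rewrite mulr_suml.
  rewrite exchange_big; apply: eq_bigr => j _ /=.
  have -> : eval_at (Pt j) T = \sum_(k < s) frob iota k c * eval_at (Pt j) (G k).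
    apply: (eval_atE (Pt_in j)); apply: (has_value_sum (Pt_in j)) => k _.
    apply: has_valueM; first exact: has_value_constant.
    exact/(local_ringP (Pt_in j))/G_reg.
  by rewrite mulr_sumr; apply: eq_bigr => k _; rewrite -mulrA [_ * frob _ _ _]mulrC.
rewrite -[RHS](W0 (Ordinal s0)) /W; apply: eq_bigr => j _.
by rewrite /G frob_form0 -eg.
Qed.

Hypothesis Pt_dist : forall i j, i != j -> ~~ same_point (Pt i) (Pt j).

(** A product of separating functions vanishes at every [Pt j] except [Pt i], so its pairing with
    [w] is [w i] times a nonzero value. *)
Lemma evaluation_nondegenerate (w : 'I_h -> K) :
  (forall f, pole_ring X P f -> \sum_j w j * eval_at (Pt j) f = 0) -> forall j, w j = 0.
Proof.
move=> hw i.
have /boolp.choice[u hu] : forall j, exists u : coord_frac X, j != i ->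
    [/\ has_value (Pt j) u 0, unit_at (Pt i) u &
    forall S, point_of X S -> ~~ same_point S P -> local_ring S u].
  move=> j; have [_|ji] := boolP (j == i); first by exists 0.
  by have [u ?] := exists_separating_function dim1 smooth XP (Pt_in j) (Pt_in i)
    (Pt_neq j) (Pt_neq i) (Pt_dist ji); exists u.
pose g := \prod_(j | j != i) u j.
have rg R : point_of X R -> ~~ same_point R P -> local_ring R g.
  move=> XR RP; apply: local_ring_prod => j ji; have [_ _ r] := hu j ji; exact: r.
have gj j : j != i -> has_value (Pt j) g 0.
  move=> ji; rewrite /g (bigD1 j) //=; have [uj _ _] := hu j ji.
  rewrite -(mul0r (eval_at (Pt j) (\prod_(l | (l != i) && (l != j)) u l))).
  apply: (has_valueM uj); apply: (local_ringP (Pt_in j)).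
  apply: local_ring_prod => l /andP[li _]; have [_ _ r] := hu l li; exact: r.
have [a ga a0] : unit_at (Pt i) g.
  rewrite /g; elim/big_ind: _ => [|g1 g2 U1 U2|l li]; last by have [] := hu l li.
    by exists 1; [apply: has_value1|apply: oner_neq0].
  exact: unit_atM U1 U2.
have Kg : KX g := has_value_KX (Pt_in i) ga.
have := evaluation_descent hw Kg rg.
rewrite (bigD1 i) //= big1 ?addr0.
  by rewrite (eval_atE (Pt_in i) ga) => /eqP; rewrite mulf_eq0 (negPf a0) orbF => /eqP.
by move=> j ji; rewrite (eval_atE (Pt_in j) (gj j ji)) mulr0.
Qed.

End Descent.

(** * Rank jumps and the set Delta *)

Lemma leastP (A : set nat) : (exists a, A a) -> A (least A) /\ forall k, A k -> (least A <= k)%N.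
Proof.
move=> exA; rewrite /least; case: xgetP => [m _ //|none].
have exA' : exists a, `[< A a >] by have [a Aa] := exA; exists a; apply/asboolP.
case: (ex_minnP exA') => m /asboolP Am min; case: (none m); split=> // k /asboolP.
exact: min.
Qed.

Lemma count_iotaS (M : pred nat) N : count M (iota 0 N.+1) = (count M (iota 0 N) + M N)%N.
Proof. by rewrite -{1}addn1 iotaD count_cat /= addn0. Qed.

Section Filtration.
Variables (K : fieldType) (h : nat) (M : pred nat) (x : nat -> 'rV[K]_h).

(** The bound is strict: the vectors of index up to [lambda] span [filt lambda.+1], and [filt k] is
    what [x k] is compared with. *)
Definition filt N : 'M[K]_h := (\sum_(k < N | M k) <<x k>>)%MS.

Lemma filtS N : (filt N.+1 :=: filt N + (if M N then <<x N>> else 0))%MS.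
Proof. by rewrite /filt big_mkcond big_ord_recr -big_mkcond. Qed.

Lemma filt_sub a b : (a <= b)%N -> (filt a <= filt b)%MS.
Proof.
move=> /subnK <-; elim: (b - a)%N => [|d IH]; first exact: submx_refl.
by rewrite addSn filtS (submx_trans IH) ?addsmxSl.
Qed.

Lemma filt_mem k : M k -> (x k <= filt k.+1)%MS.
Proof. by move=> Mk; rewrite filtS Mk -genmxE addsmxSr. Qed.

(** Each new vector raises the rank by at most one, and by one exactly at a jump. *)
Lemma filt_rank N : \rank (filt N) = count (fun k => M k && ~~ (x k <= filt k)%MS) (iota 0 N).
Proof.
elim: N => [|N IH]; first by rewrite /filt big_ord0 mxrank0.
rewrite count_iotaS -IH filtS; case: (M N) => /=; last by rewrite addsmx0 addn0.
have [xN|xN] := boolP (x N <= filt N)%MS.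
  by rewrite addn0; apply: eqmx_rank; apply/andP; rewrite addsmxSl addsmx_sub genmxE xN submx_refl.
apply/eqP; rewrite eqn_leq; apply/andP; split.
  apply: leq_trans (mxrank_adds_leqif _ _) _; rewrite leq_add2l genmxE.
  exact: rank_leq_row.
by rewrite addn1; apply: rank_ltmx; rewrite ltmxE addsmxSl addsmx_sub genmxE submx_refl.
Qed.

Lemma filtP N v : reflect (exists c : nat -> K, v = \sum_(k < N | M k) c k *: x k)
  (v <= filt N)%MS.
Proof.
apply: (iffP idP) => [|[c ->]]; last first.
  apply: summx_sub => k Mk; apply: scalemx_sub.
  exact: submx_trans (filt_mem Mk) (filt_sub (ltn_ord k)).
elim: N v => [|N IH] v.
  by rewrite /filt big_ord0 submx0 => /eqP->; exists (fun _ => 0); rewrite big_ord0.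
rewrite filtS => /sub_addsmxP[[u1 u2] /= ->].
have [c ec] := IH _ (submxMl u1 (filt N)).
have [d ed] : exists d, u2 *m (if M N then <<x N>> else 0)%MS = d *: (if M N then x N else 0).
  case: (M N); last by exists 0; rewrite mulmx0 scale0r.
  by apply/sub_rVP; apply: submx_trans (submxMl _ _) _; rewrite genmxE.
exists (fun k => if k == N then d else c k).
rewrite big_mkcond big_ord_recr -big_mkcond /= eqxx ec ed; congr (_ + _).
  by apply: eq_bigr => k _; rewrite ltn_eqF.
by case: (M N); rewrite ?scaler0.
Qed.
End Filtration.

Lemma rank_support (K : fieldType) (h m : nat) (v : 'rV[K]_h) (A : 'M[K]_(m, h)) :
  (forall i j, v 0 j = 0 -> A i j = 0) -> (\rank A <= #|[set i | v 0%R i != 0%R]%SET|)%N.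
Proof.
move=> Av; have AS : (A <= \sum_(i | v 0 i != 0) <<delta_mx 0 i : 'rV[K]_h>>)%MS.
  apply/row_subP => a; rewrite [row a A]row_sum_delta (bigID (fun i => v 0 i != 0)) /=.
  rewrite [X in _ + X]big1 ?addr0 => [|i].
    apply: summx_sub => i vi; apply: scalemx_sub.
    by apply: (sumsmx_sup i) => //; rewrite genmxE.
  by rewrite negbK => /eqP vi; rewrite mxE Av ?scale0r.
apply: leq_trans (mxrankS AS) _; apply: leq_trans (mxrank_sum_leqif _) _.
rewrite /= -sum1dep_card; apply: leq_sum => i _.
by rewrite mxrank_gen rank_leq_row.
Qed.

(** * The set Delta of a multiplicative sequence of vectors *)

Section DeltaTheory.
Variables (F : finFieldType) (K : closedFieldType) (iota : {rmorphism F -> K}).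
Variables (h : nat) (Gamma : set nat) (l : nat) (w : nat -> 'rV[K]_h).
Local Notation S := (subfield F K l).
Local Notation G := (fun k => k \in Gamma).
Local Notation U := (filt G w).
Implicit Types v y : 'rV[K]_h.
Hypothesis h_gt0 : (0 < h)%N.
Hypothesis G0 : Gamma 0%N.
Hypothesis GD : forall a b, Gamma a -> Gamma b -> Gamma (a + b)%N.
Hypothesis wS : forall k i, Gamma k -> S (w k 0 i).
Hypothesis w0 : forall i, w 0%N 0 i != 0.
Hypothesis wM : forall a b, Gamma a -> Gamma b -> exists2 c : nat -> K, c (a + b)%N != 0 &
  \row_i (w a 0 i * w b 0 i) = \sum_(k < (a + b).+1 | G k) c k *: w k.
Hypothesis w_full : forall v : 'I_h -> K,
  (forall k, Gamma k -> \sum_j v j * w k 0 j = 0) -> forall j, v j = 0.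

(** The jumps over [K]. The definition of [Delta] tests spans over the subfield [S]; [span_filt]
    identifies the two tests. *)
Let J k := (k \in Gamma) && ~~ (w k <= U k)%MS.

Lemma frob_comb N (c : nat -> K) :
  map_mx (frob iota l) (\sum_(k < N | G k) c k *: w k) =
    \sum_(k < N | G k) frob iota l (c k) *: w k.
Proof.
rewrite map_mx_sum; apply: eq_bigr => k /set_mem kG; rewrite map_mxZ; congr (_ *: _).
by apply/rowP => i; rewrite mxE; apply: wS.
Qed.

(* Applying the Frobenius to an expression of a vector over the subfield shows
   that its coefficients on the jumps are fixed. *)
Lemma filt_subfield N v : (forall i, S (v 0 i)) -> (v <= U N)%MS ->
  exists2 c : nat -> K, (forall k, S (c k)) & v = \sum_(k < N | G k) c k *: w k.
Proof.
have S0 : S 0 by apply: (rmorph0 (frob iota l)).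
elim: N v => [|N IH] v vS.
  rewrite /filt big_ord0 submx0 => /eqP->.
  by exists (fun _ => 0); rewrite ?big_ord0.
have ext v' d : S d -> (forall i, S (v' 0 i)) -> (v' <= U N)%MS ->
    (N \in Gamma \/ d = 0) -> v = v' + d *: w N ->
    exists2 c : nat -> K, (forall k, S (c k)) & v = \sum_(k < N.+1 | G k) c k *: w k.
  move=> Sd v'S v'N ND ->; have [c cS ->] := IH v' v'S v'N.
  exists (fun k => if k == N then d else c k) => [k|]; first by case: ifP.
  rewrite [RHS]big_mkcond big_ord_recr -big_mkcond /= eqxx; congr (_ + _).
    by apply: eq_bigr => k _; rewrite ltn_eqF.
  by case: ND => [->//|->]; rewrite scale0r if_same.
rewrite filtS; have [NG|NG] := boolP (N \in Gamma); last first.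
  by rewrite addsmx0 => vN; apply: (ext v 0) => //; [right|rewrite scale0r addr0].
have [wN|wN] := boolP (w N <= U N)%MS => [vN|].
  apply: (ext v 0) => //; [|by right|by rewrite scale0r addr0].
  by apply: submx_trans vN _; rewrite addsmx_sub submx_refl genmxE.
move=> /sub_addsmxP[[u1 u2] /=].
have [c ->] := filtP _ _ _ _ (submxMl u1 (U N)).
have /sub_rVP[d ->] : (u2 *m <<w N>> <= w N)%MS.
  by apply: submx_trans (submxMl _ _) _; rewrite genmxE.
set y := \sum_(k < N | _) _ => ev.
have vN : map_mx (frob iota l) v = v by apply/rowP => i; rewrite mxE; apply: vS.
have wNf : map_mx (frob iota l) (w N) = w N.
  by apply/rowP => i; rewrite mxE; apply: wS; apply: set_mem.
(* Were [d] not fixed, subtracting from [v] its image under the Frobenius, which is 0, would express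
   a nonzero multiple of [w N] through earlier vectors. *)
have dS : S d.
  apply/eqP; rewrite -subr_eq0; apply: contraNT wN => dn.
  have e : (frob iota l d - d) *: w N = y - map_mx (frob iota l) y.
    move: vN; rewrite {1}ev map_mxD map_mxZ wNf ev /= => vN.
    have ey : y = map_mx (frob iota l) y + frob iota l d *: w N - d *: w N.
      by rewrite vN addrK.
    by rewrite {1}ey scalerBl -[_ + _ - d *: _]addrA [RHS]addrC addKr.
  rewrite -(scalerK dn (w N)) e; apply: scalemx_sub.
  rewrite addmx_sub ?eqmx_opp //; first by apply/filtP; exists c.
  by rewrite frob_comb; apply/filtP; exists (fun k => frob iota l (c k)).
apply: (ext y d) => //; [|by apply/filtP; exists c|by left].
move=> i; have -> : y = v - d *: w N by rewrite ev addrK.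
rewrite !mxE.
change (frob iota l (v 0 i - d * w N 0 i) = v 0 i - d * w N 0 i).
rewrite rmorphB rmorphM /=; congr (_ - _ * _); [exact: vS|exact: dS|].
by apply: wS; apply: set_mem.
Qed.

Lemma span_filt a : Gamma a ->
  Defs.span *:%R S [set mu | Gamma mu /\ (mu < a)%N]%classic w (w a) <-> (w a <= U a)%MS.
Proof.
move=> Ga; split=> [[m [c [_ ->]]]|].
  apply: summx_sub => k /set_mem[/mem_set kG ka]; apply: scalemx_sub.
  exact: submx_trans (filt_mem _ kG) (filt_sub _ _ ka).
move=> /filt_subfield[|c cS e]; first by move=> i; apply: wS.
exists a, c; split=> //; rewrite {1}e; apply: eq_bigl => k.
by apply/idP/idP => [/set_mem kG|/set_mem[/mem_set]//]; apply/mem_set; split.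
Qed.

Lemma jumps_bounded s : uniq s -> all J s -> (size s <= h)%N.
Proof.
move=> us /allP sJ; pose N := (\max_(k <- s) k).+1.
apply: leq_trans (rank_leq_row (U N)); rewrite filt_rank -size_filter.
apply: uniq_leq_size => // k ks; rewrite mem_filter mem_iota /= add0n ltnS.
by have := sJ k ks; rewrite /J => ->; apply: leq_bigmax_seq.
Qed.

(** At the maximal rank all [w k] lie in one [U N]. If that rank were below [h], some nonzero linear
    form would vanish on all of them, against [w_full]. *)
Lemma filt_full : exists N, \rank (U N) = h.
Proof.
have exP : exists r, [exists N : 'I_1, false] || `[< exists N, \rank (U N) = r >].
  by exists (\rank (U 0)); apply/orP; right; apply/asboolP; exists 0%N.
have bP r : [exists N : 'I_1, false] || `[< exists N, \rank (U N) = r >] -> (r <= h)%N.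
  by case/orP => [/existsP[]//|/asboolP[N <-]]; apply: rank_leq_row.
case: (ex_maxnP exP bP) => r /orP[/existsP[]//|/asboolP[N rN]] max.
exists N; apply/eqP; rewrite eqn_leq rank_leq_row /= leqNgt; apply/negP => lt.
have wN k : Gamma k -> (w k <= U N)%MS.
  move=> /mem_set kG; pose m := maxn k.+1 N.
  have sNm : (U N <= U m)%MS by apply/filt_sub/leq_maxr.
  have wm : (w k <= U m)%MS.
    by apply: submx_trans (filt_mem _ kG) _; apply/filt_sub/leq_maxl.
  apply: submx_trans wm _; rewrite -(mxrank_leqif_sup sNm) eqn_leq.
  rewrite mxrankS //= rN max //; apply/orP; right; apply/asboolP; by exists m.
have : kermx (U N)^T != 0.
  by rewrite -mxrank_eq0 mxrank_ker mxrank_tr -lt0n subn_gt0.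
case/rowV0Pn => v /sub_kermxP vU /eqP[]; apply/rowP => j; rewrite mxE.
apply: (w_full (v := fun j => v 0 j)) => k kG.
have /submxP[D eD] := wN k kG.
have /matrixP/(_ 0 0) : v *m (w k)^T = 0 by rewrite eD trmx_mul mulmxA vU mul0mx.
by rewrite !mxE => e; rewrite -[RHS]e; apply: eq_bigr => i _; rewrite mxE.
Qed.

Lemma J0 : J 0%N.
Proof.
rewrite /J mem_set //= /filt big_ord0 submx0.
apply/eqP => e; have := w0 (Ordinal h_gt0); rewrite e mxE.
by rewrite eqxx.
Qed.

(** The last clause makes the list an initial segment of the jumps, which is what the greedy choice
    of the least next element preserves. *)
Lemma delta_seqP i : (i < h)%N -> let s := delta_seq Gamma S w i in
  [/\ uniq s, size s = i.+1, all J s &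
    forall b, J b -> b \in s \/ forall a, a \in s -> (a < b)%N].
Proof.
elim: i => [_|i IH ih] /=.
  split=> //; first by rewrite /= J0.
  move=> [|b] _; [by left|right=> a].
  by rewrite inE => /eqP->.
have [us ss sJ sub] := IH (ltnW ih); set s := delta_seq Gamma S w i in us ss sJ sub *.
set A := (X in least X).
have AE a : A a <-> J a /\ forall b, b \in s -> (b < a)%N.
  rewrite /A /J; split=> [[Ga sa na]|[/andP[/set_mem Ga na] sa]].
    by rewrite mem_set //; split=> //; apply/negP => wU; apply/na/(span_filt Ga).
  by split=> // /(span_filt Ga); apply/negP.
have exA : exists a, A a.
  have [N rN] := filt_full; move: ih; rewrite -rN filt_rank -size_filter => lt.
  have : ~~ all (mem s) (filter J (seq.iota 0 N)).
    apply: contraTN lt => /allP sub'; rewrite -leqNgt -ss.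
    by apply: uniq_leq_size; rewrite ?filter_uniq ?iota_uniq.
  case/allPn => a; rewrite mem_filter => /andP[Ja _] as'.
  by exists a; apply/AE; split=> //; case: (sub a Ja) => // /(negP as').
have [/AE[Jm sm] min] := leastP exA.
split.
- by rewrite rcons_uniq us andbT; apply/negP => /sm; rewrite ltnn.
- by rewrite size_rcons ss.
- by rewrite all_rcons Jm.
move=> b Jb; rewrite mem_rcons inE; have [bs|lt] := sub b Jb; first by left; rewrite bs orbT.
have := min b (proj2 (AE b) (conj Jb lt)); rewrite leq_eqVlt => /predU1P[->|lb].
  by left; rewrite eqxx.
by right=> a; rewrite mem_rcons inE => /predU1P[->//|/lt].
Qed.

Let D := Delta Gamma S w.

(** A jump missing from [Delta] would be one more than the [h] that the rank allows. *)
Lemma DeltaP : [/\ uniq D, size D = h & D =i J].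
Proof.
have [|uD sD DJ _] := @delta_seqP h.-1; first by rewrite prednK.
rewrite prednK // in sD; split=> // a; apply/idP/idP => [/(allP DJ)//|Ja].
apply: contraT => aD; have := @jumps_bounded (a :: D).
by rewrite /= aD uD (Ja : J a) DJ sD ltnn => /(_ isT isT).
Qed.

Local Notation sigma := (sigma_Delta Gamma S w).

Lemma sigma_Delta_genus eta : eta \in D -> (h <= sigma eta + eta)%N.
Proof.
have [uD sD DJ] := DeltaP => etaD; rewrite /sigma_Delta -/D.
set q := fun mu => _; rewrite undup_id ?filter_uniq // -sD -(count_predC q D) size_filter.
rewrite leq_add2l -size_filter.
have etaG : Gamma eta by have := etaD; rewrite DJ => /andP[/set_mem].
(* For [eta = 0] there are no residues to count, but then every [mu - eta] is [mu], an element of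
   [Gamma]. *)
have [eta0|eta0] := posnP eta.
  rewrite eta0 leqn0 size_eq0 -(filter_pred0 D); apply/eqP/eq_in_filter => mu.
  rewrite DJ => /andP[muG _]; apply/negbTE; rewrite /= negbK /q eta0 subn0 leq0n.
  exact: muG.
rewrite -(size_map (fun mu => mu %% eta)%N) -{2}(size_iota 0 eta).
apply: uniq_leq_size => [|r /mapP[mu _ ->]]; last by rewrite mem_iota ltn_mod.
rewrite map_inj_in_uniq ?filter_uniq //.
(* If [mu < nu] are congruent, [nu - eta] is [mu] plus a multiple of [eta], hence in [Gamma]. *)
have key mu nu : mu \in filter (predC q) D -> nu \in filter (predC q) D ->
    (mu %% eta = nu %% eta)%N -> ~ (mu < nu)%N.
  rewrite !mem_filter /= !DJ /q => /andP[_ /andP[/set_mem muG _]] /andP[/negP nq _] e lt.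
  apply: nq; have dv : (eta %| nu - mu)%N.
    by rewrite -eqn_mod_dvd ?(ltnW lt) // e.
  case/dvdnP: dv => -[|k] ek; first by move: ek; lia.
  have -> : (eta <= nu)%N by move: ek; rewrite mulSn; lia.
  have -> : (nu - eta = k * eta + mu)%N by move: ek; rewrite mulSn; lia.
  apply/mem_set/GD => //; elim: k {ek} => [|k IHk]; first by rewrite mul0n.
  by rewrite mulSn; apply: GD.
move=> mu nu muq nuq e; case: (ltngtP mu nu) => // /key.
  by move=> /(_ muq nuq e).
by move=> /(_ nuq muq (esym e)).
Qed.

Lemma filt_mul y a b : Gamma b -> (y <= U a)%MS ->
  (\row_i (y 0 i * w b 0 i)%R <= U (a + b)%N)%MS.
Proof.
move=> Gb /filtP[c ->].
have -> : \row_i ((\sum_(k < a | G k) c k *: w k) 0 i * w b 0 i) =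
    \sum_(k < a | G k) c k *: \row_i (w k 0 i * w b 0 i).
  apply/rowP => i; rewrite mxE !summxE mulr_suml; apply: eq_bigr => k _.
  by rewrite !mxE mulrA.
apply: summx_sub => k /set_mem kG; apply: scalemx_sub.
have [d _ ->] := wM kG Gb; apply: submx_trans (_ : (_ <= U (k + b).+1)%MS) _.
  by apply/filtP; exists d.
by apply: filt_sub; rewrite -addSn leq_add2r.
Qed.

Lemma sigma_Delta_weight v lambda : v != 0 -> (v <= U lambda.+1)%MS ->
  exists eta, [/\ eta \in D, (eta <= lambda)%N & (sigma eta <= #|[set i | v 0%R i != 0%R]%SET|)%N].
Proof.
move=> v0 vl; have [uD sD DJ] := DeltaP.
have exv : exists a, (v <= U a.+1)%MS by exists lambda.
(* The least such [eta] is the leading index of [v] after every reduction by linear relations among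
   the [w k]. *)
case: (ex_minnP exv) => eta veta min.
have vn : ~~ (v <= U eta)%MS.
  case: eta {veta} min => [|eta] min; first by rewrite /filt big_ord0 submx0.
  by apply/negP => /min; rewrite ltnn.
have Geta : eta \in Gamma.
  by apply: contraNT vn => nG; move: veta; rewrite filtS (negPf nG) addsmx0.
have [y [d [yU d0 ev]]] : exists y d, [/\ (y <= U eta)%MS, d != 0 & v = y + d *: w eta].
  move: veta; rewrite filtS Geta => /sub_addsmxP[[u1 u2] /= ev].
  have /sub_rVP[d ed] : (u2 *m <<w eta>> <= w eta)%MS.
    by apply: submx_trans (submxMl _ _) _; rewrite genmxE.
  exists (u1 *m U eta), d; split; [exact: submxMl| |by rewrite ev ed].
  by apply: contraNneq vn => d0; rewrite ev ed d0 scale0r addr0 submxMl.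
have Jeta : J eta.
  rewrite /J Geta; apply: contra vn => weta; rewrite ev addmx_sub //.
  exact: scalemx_sub.
exists eta; rewrite DJ; split=> //; first exact: min.
pose q mu := (eta <= mu)%N && ((mu - eta)%N \in Gamma).
pose M mu := q mu && J mu.
pose x mu : 'rV[K]_h := \row_i (v 0 i * w (mu - eta) 0 i).
have xE mu : M mu -> exists y' e, [/\ (y' <= U mu)%MS, e != 0 & x mu = y' + e *: w mu].
  move=> /andP[/andP[le /set_mem muG] /andP[_ _]].
  have [c c0 ec] := wM (set_mem Geta) muG; rewrite subnKC // in c0 ec.
  have sumE : \sum_(k < mu.+1 | G k) c k *: w k =
      (\sum_(k < mu | G k) c k *: w k) + if mu \in Gamma then c mu *: w mu else 0.
    by rewrite big_mkcond big_ord_recr -big_mkcond.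
  have muG' : mu \in Gamma.
    by apply/mem_set; rewrite -(subnKC le); apply: GD => //; apply: set_mem.
  exists (\row_i (y 0 i * w (mu - eta) 0 i) + d *: (\sum_(k < mu | G k) c k *: w k)).
  exists (d * c mu); split; last first.
  - rewrite -addrA -scalerA -scalerDr; move: sumE; rewrite muG' => <-; rewrite -ec.
    by apply/rowP => i; rewrite !mxE ev !mxE mulrDl mulrA.
  - exact: mulf_neq0.
  rewrite addmx_sub //; first by rewrite -{2}(subnKC le); apply: filt_mul.
  by apply: scalemx_sub; apply/filtP; exists c.
(* As the span of the earlier [x k] lies in [U mu], and [x mu] is a nonzero multiple of [w mu]
   modulo [U mu], a jump of [w] at [mu] is also a jump of [x]. *)
have VU N : (filt M x N <= U N)%MS.
  elim: N => [|N IH]; first by rewrite /filt !big_ord0 submx_refl.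
  rewrite filtS addsmx_sub; apply/andP; split.
    exact: submx_trans IH (filt_sub _ _ (leqnSn N)).
  case: ifP => [MN|_]; last exact: sub0mx.
  have [y' [e [y'U _ ->]]] := xE N MN; rewrite genmxE addmx_sub //.
    exact: submx_trans y'U (filt_sub _ _ (leqnSn N)).
  by apply/scalemx_sub/filt_mem; move: MN => /andP[_ /andP[]].
pose N := (\max_(k <- D) k).+1.
apply: leq_trans (rank_support (A := filt M x N) _).
  rewrite filt_rank -size_filter /sigma_Delta -/D undup_id ?filter_uniq //.
  apply: uniq_leq_size => [|mu]; first exact: filter_uniq.
  rewrite !mem_filter mem_iota /= add0n ltnS => /andP[qmu muD].
  have Jmu : J mu by move: muD; rewrite DJ.
  have Mmu : M mu by rewrite /M /q qmu.
  rewrite Mmu /= leq_bigmax_seq // andbT.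
  have [y' [e [y'U e0 ->]]] := xE mu Mmu.
  have := Jmu; rewrite /J => /andP[_]; apply: contra => h1.
  rewrite -(scalerK e0 (w mu)); apply: scalemx_sub.
  have -> : e *: w mu = (y' + e *: w mu) - y' by rewrite addrC addKr.
  by rewrite addmx_sub ?eqmx_opp // (submx_trans h1).
move=> i j vj; have /row_subP/(_ i)/filtP[c] := submx_refl (filt M x N).
move=> /rowP/(_ j); rewrite mxE => ->; rewrite summxE big1 // => k _.
by rewrite !mxE vj mul0r mulr0.
Qed.

(** The index 0 belongs to [Delta], so the minimum is over a nonempty set and not a default
    value. *)
Lemma min_sigma_attained lambda : exists eta,
  [/\ eta \in D, (eta <= lambda)%N & min_sigma_Delta Gamma S w lambda = sigma eta] /\
  forall eta', eta' \in D -> (eta' <= lambda)%N ->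
    (min_sigma_Delta Gamma S w lambda <= sigma eta')%N.
Proof.
have [_ _ DJ] := DeltaP.
have [|[eta [eD el e]] min] := @leastP [set s | exists eta,
    [/\ eta \in D, (eta <= lambda)%N & s = sigma eta]]%classic.
  by exists (sigma 0), 0%N; split=> //; rewrite DJ; apply: J0.
exists eta; split=> // eta' eD' el'; apply: min; by exists eta'.
Qed.

Lemma min_sigma_genus lambda : (h <= min_sigma_Delta Gamma S w lambda + lambda)%N.
Proof.
have [eta [[eD el ->] _]] := min_sigma_attained lambda.
by apply: leq_trans (sigma_Delta_genus eD) _; rewrite leq_add2l.
Qed.

Lemma min_sigma_weight v lambda : v != 0 -> (v <= U lambda.+1)%MS ->
  (min_sigma_Delta Gamma S w lambda <= #|[set i | v 0%R i != 0%R]%SET|)%N.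
Proof.
move=> v0 /(sigma_Delta_weight v0)[eta [eD el le]].
have [eta' [_ min]] := min_sigma_attained lambda.
exact: leq_trans (min eta eD el) le.
Qed.
End DeltaTheory.

(** * The code *)

(** Each nonzero block has a nonzero entry, and [tagnat.sig1] sends an entry to its block. *)
Lemma support_mxrow (R : finFieldType) h (r : 'I_h -> nat) (B : forall i, 'rV[R]_(r i)) :
  (#|[set i | B i != 0%R]%SET| <= hamming_weight (\mxrow_i B i))%N.
Proof.
apply: leq_trans _ (leq_imset_card (@tagnat.sig1 _ r) _).
apply/subset_leq_card/fintype.subsetP => i; rewrite inE => /rV0Pn[j Bj]; apply/imsetP.
exists (tagnat.Rank i j); last by rewrite tagnat.Rank1K.
by rewrite inE; move: Bj; rewrite -{1}(mxrowK B i) mxE.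
Qed.

Section LinearIso.
Variables (F : finFieldType) (K : closedFieldType) (iota : {rmorphism F -> K}).
Variables (l : nat) (pi : K -> 'rV[F]_l) (pi_iso : linear_iso iota pi).
Local Notation S := (subfield F K l).

Lemma subfield_comb a x y : S x -> S y -> S (iota a * x + y).
Proof.
move=> Sx Sy; change (frob iota l (iota a * x + y) = iota a * x + y).
rewrite rmorphD rmorphM /= frob_iota; congr (_ * _ + _); [exact: Sx|exact: Sy].
Qed.

Lemma subfield0 : S 0.
Proof. exact: (rmorph0 (frob iota l)). Qed.

Lemma iso0 : pi 0 = 0.
Proof.
have [lin _ _] := pi_iso; have := lin 1 0 0 subfield0 subfield0.
by rewrite mulr0 addr0 scale1r => e; apply: (addrI (pi 0)); rewrite addr0 -e.
Qed.

Lemma iso_eq0 x : S x -> pi x = 0 -> x = 0.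
Proof. by move=> Sx; rewrite -iso0; have [_ inj _] := pi_iso; apply: inj Sx subfield0. Qed.

(** [pi] is linear on the subfield only, so membership of the partial sums is proved along with the
    formula. *)
Lemma iso_sum (J : Type) (s : seq J) (Q : pred J) (a : J -> F) (x : J -> K) :
  (forall j, Q j -> S (x j)) ->
  S (\sum_(j <- s | Q j) iota (a j) * x j) /\
  pi (\sum_(j <- s | Q j) iota (a j) * x j) = \sum_(j <- s | Q j) a j *: pi (x j).
Proof.
move=> Sx; have [lin _ _] := pi_iso.
elim: s => [|j s [IHS IH]]; first by rewrite !big_nil iso0; split; [apply: subfield0|].
rewrite !big_cons; case: ifP => // Qj; split; first by apply: subfield_comb (Sx j Qj) IHS.
by rewrite lin ?IH //; apply: Sx.
Qed.
End LinearIso.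

Theorem theorem4p2 (F : finFieldType) (K : closedFieldType)
    (iota : {rmorphism F -> K}) (K_algebraic : integralRange iota)
    (n : nat) (X : variety iota n)
    (X_curve : has_dimension X 1) (X_nonsingular : nonsingular X)
    (P : 'rV[K]_n.+1) (P_in : point_of X P) (P_rational : rational F 1 P)
    (h : nat) (h_gt0 : (0 < h)%N)
    (Pt : 'I_h -> 'rV[K]_n.+1) (r : 'I_h -> nat)
    (Pt_in : forall i, point_of X (Pt i))
    (Pt_neq : forall i, ~~ same_point (Pt i) P)
    (Pt_degree : forall i, has_degree F (r i) (Pt i))
    (Pt_distinct : forall i j : 'I_h, i != j ->
       closed_point F (r i) (Pt i) <> closed_point F (r j) (Pt j))
    (f : nat -> coord_frac X)
    (f_basis : is_basis (fun (c : F) => scale_by (iota c)) setT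
       (weierstrass_semigroup X P) f (pole_ring X P))
    (f_rho : forall eta, weierstrass_semigroup X P eta -> rho P (f eta) = eta%:Z)
    (pi : forall i, K -> 'rV[F]_(r i))
    (pi_iso : forall i, linear_iso iota (pi i))
    (lambda : nat) (lambda_in : weierstrass_semigroup X P lambda) :
  let Gamma := weierstrass_semigroup X P in
  let Fqr := subfield F K (\big[lcmn/1%N]_i r i) in
  let phi := evaluation Pt in
  let bound := min_sigma_Delta Gamma Fqr (fun eta => phi (f eta)) lambda in
  (bound <= minimum_distance (code Gamma Pt pi f lambda))%N /\
  h%:Z - lambda%:Z <= bound%:Z.
Proof.
move=> Gamma Fqr phi bound; pose w k := phi (f k).
have Pt_dist i j : i != j -> ~~ same_point (Pt i) (Pt j).
  move=> ij; apply/negP => /(closed_point_eq (Pt_in i) (Pt_degree i) (Pt_degree j)).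
  exact: Pt_distinct.
have G0 : Gamma 0%N := semigroup0 X_curve X_nonsingular P_in.
have GD a b : Gamma a -> Gamma b -> Gamma (a + b)%N.
  exact: (semigroupD X_curve X_nonsingular P_in).
have w_value k i : Gamma k -> subfield F K (r i) (w k 0 i).
  move=> kG; have [_ rat _] := Pt_degree i; rewrite mxE.
  have [Fk rk] := proj1 (pole_ringP X_curve X_nonsingular P_in _) (basis_in f_basis kG).
  exact: (rational_value (Pt_in i) rat Fk (rk _ (Pt_in i) (Pt_neq i))).
have wS k i : Gamma k -> Fqr (w k 0 i).
  move=> kG; have /dvdnP[m e] : (r i %| \big[lcmn/1%N]_i r i)%N by apply: (biglcmn_sup i).
  rewrite /Fqr e mulnC; apply: (@frobM _ _ iota); exact: w_value.
have w0 i : w 0%N 0 i != 0.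
  exact: (evaluation_basis0 X_curve X_nonsingular P_in f_basis f_rho Pt_in i).
have wM a b : Gamma a -> Gamma b -> exists2 c : nat -> K, c (a + b)%N != 0 &
    \row_i (w a 0 i * w b 0 i) = \sum_(k < (a + b).+1 | (k : nat) \in Gamma) c k *: w k.
  exact: (evaluation_product X_curve X_nonsingular P_in f_basis f_rho Pt_in Pt_neq).
have w_full (v : 'I_h -> K) : (forall k, Gamma k -> \sum_j v j * w k 0 j = 0) ->
    forall j, v j = 0.
  move=> vw; apply: (evaluation_nondegenerate K_algebraic X_curve X_nonsingular P_in
    P_rational Pt_in Pt_neq Pt_dist) => x Rx.
  have [->|x0] := eqVneq x 0.
    by rewrite big1 // => j _; rewrite (eval_atE (Pt_in j) (has_value0 _ _)) mulr0.
  have [N [c [_ _ -> _]]] := comb_expansion X_curve X_nonsingular P_in f_basis f_rho Rx x0.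
  have val j := comb_value X_curve X_nonsingular P_in f_basis Pt_in Pt_neq j (iota \o c) N.+1.
  under eq_bigr do rewrite (eval_atE (Pt_in _) (val _)) summxE mulr_sumr.
  rewrite exchange_big big1 // => k /set_mem kG.
  under eq_bigr do rewrite mxE mulrCA.
  by rewrite -mulr_sumr vw ?mulr0.
split; last first.
  rewrite lerBlDr -PoszD lez_nat.
  exact: (min_sigma_genus iota h_gt0 G0 GD wS w0 w_full lambda).
pose piv (v : 'rV[K]_h) := \mxrow_i pi i (v 0 i).
(* The codeword of the nonzero constant [f 0] is nonzero, so the minimum distance is the weight of
   an actual codeword and not the default value of [least]. *)
have code0 : code Gamma Pt pi f lambda (piv (w 0%N)).
  exists 1%N, (fun _ => 1); split=> //; rewrite [RHS]big_mkcond [RHS]big_ord1 mem_set //=.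
  by rewrite scale1r; apply: eq_mxrow => i; rewrite !mxE.
pose inG k := k \in Gamma.
have codeP c : code Gamma Pt pi f lambda c -> exists2 v : 'rV[K]_h,
    (v <= filt inG w lambda.+1)%MS &
    (forall i, subfield F K (r i) (v 0 i)) /\ c = piv v.
  move=> [m [a [_ ->]]].
  set Q := (X in \sum_(k < m | _ \in X) _).
  have QG (k : 'I_m) : (k : nat) \in Q -> Gamma k /\ (k <= lambda)%N by move/set_mem.
  exists (\sum_(k < m | (k : nat) \in Q) iota (a k) *: w k).
    apply: summx_sub => k /QG[/mem_set kG kl]; apply: scalemx_sub.
    by apply: submx_trans (@filt_mem _ _ inG w k kG) _; apply: filt_sub.
  have vE i : (\sum_(k < m | (k : nat) \in Q) iota (a k) *: w k) 0 i =
      \sum_(k < m | (k : nat) \in Q) iota (a k) * w k 0 i.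
    by rewrite summxE; apply: eq_bigr => k _; rewrite mxE.
  have isum i := @iso_sum _ _ _ _ _ (pi_iso i) _ (index_enum 'I_m)
    (fun k => (k : nat) \in Q) (fun k => a k) (fun k => w k 0 i)
    (fun k kQ => w_value k i (proj1 (QG k kQ))).
  split=> [i|]; first by rewrite vE; apply: (isum i).1.
  apply/rowP => j; rewrite summxE mxE vE (isum _).2 summxE.
  by apply: eq_bigr => k _; rewrite !mxE.
have supp (v : 'rV[K]_h) : (forall i, subfield F K (r i) (v 0 i)) ->
    (#|[set i | v 0%R i != 0%R]%SET| <= hamming_weight (piv v))%N.
  move=> vS; apply: leq_trans _ (support_mxrow _); apply/subset_leq_card.
  apply/fintype.subsetP => i; rewrite !inE; apply: contra_neq.
  exact: (iso_eq0 (pi_iso i) (vS i)).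
have code0_neq0 : piv (w 0%N) != 0.
  apply: contra_neq (w0 (Ordinal h_gt0)) => e.
  apply: (iso_eq0 (pi_iso _)); first exact: w_value.
  by have := mxrowK (fun i => pi i (w 0%N 0 i)) (Ordinal h_gt0); rewrite -/(piv _) e submxrow0.
have [|[c [Cc c0 ec]] _] := @leastP [set d | exists c,
    [/\ code Gamma Pt pi f lambda c, c != 0 & d = hamming_weight c]]%classic.
  by exists (hamming_weight (piv (w 0%N))), (piv (w 0%N)).
have [v vU [vS ev]] := codeP c Cc.
have v0 : v != 0.
  apply: contra_neq c0 => v0; rewrite ev /piv -[RHS]mxrow0; apply: eq_mxrow => i.
  by rewrite v0 mxE (iso0 (pi_iso i)).
rewrite /minimum_distance ec ev; apply: leq_trans _ (supp v vS).
exact: (min_sigma_weight iota h_gt0 G0 GD wS w0 wM w_full v0 vU).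
Qed.
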